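(* Let $\mathcal{G}$ be a second countable, locally compact, Hausdorff, étale groupoid. If $C^*_{\mathrm{red}}(\mathcal{G})$ is simple, and there exists a unit $u_0\in\mathcal{G}^{(0)}$ such that the augmentation homomorphism $\mathbb{C}[\mathrm{IntIso}(\mathcal{G})u_0]\to\mathbb{C}$ is continuous relative to the norm $\|\cdot\|_{\mathrm{other},u_0}$, then $\mathrm{IntIso}(\mathcal{G})u=\{e\}$ (the trivial group) for all $u\in\mathcal{G}^{(0)}$.
   Context: Ideals are closed and two-sided; a $C^*$-algebra is simple if it has no ideals other than $\{0\}$ and itself. A groupoid is étale if its range and source maps $r,s$ are local homeomorphisms. $\mathcal{G}^{(0)}$ is the unit space. $C_c(\mathcal{G})$ is a $*$-algebra under $(f\times g)(\gamma)=\sum_{\alpha\beta=\gamma}f(\alpha)g(\beta)$ and $f^*(\gamma)=\overline{f(\gamma^{-1})}$; $C^*(\mathcal{G})$ is its completion in the full norm $\|f\|_{\mathrm{full}}=\sup_\pi\|\pi(f)\|$ over all $*$-representations $\pi$ on Hilbert spaces. Restriction of functions to $\mathcal{G}^{(0)}$ extends to a conditional expectation $\mathbb{E}:C^*(\mathcal{G})\to C_0(\mathcal{G}^{(0)})$, and $C^*_{\mathrm{red}}(\mathcal{G})=C^*(\mathcal{G})/K_{\mathbb{E}}$, where $K_{\mathbb{E}}=\{a:\mathbb{E}(xay)=0\ \forall x,y\}$. $\mathrm{IntIso}(\mathcal{G})$ is the interior in $\mathcal{G}$ of $\mathrm{Iso}(\mathcal{G})=\{\gamma\in\mathcal{G}:r(\gamma)=s(\gamma)\}$;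 it is an open étale subgroupoid with unit space $\mathcal{G}^{(0)}$ on which $r=s$. For $u\in\mathcal{G}^{(0)}$, $\mathrm{IntIso}(\mathcal{G})u=\mathrm{IntIso}(\mathcal{G})\cap s^{-1}(u)$ is a countable discrete group. For $u\in\mathcal{G}^{(0)}$ let $J^{\mathrm{other}}_u$ be the closed two-sided ideal of $C^*_{\mathrm{red}}(\mathrm{IntIso}(\mathcal{G}))$ generated by $\{f\in C_0(\mathcal{G}^{(0)}):f(u)=0\}$. The $C^*$-norm $\|\cdot\|_{\mathrm{other},u}$ on the group algebra $\mathbb{C}[\mathrm{IntIso}(\mathcal{G})u]$ (finitely supported functions on $\mathrm{IntIso}(\mathcal{G})u$) is given by $\|x\|_{\mathrm{other},u}=\|f+J^{\mathrm{other}}_u\|$, the quotient norm in $C^*_{\mathrm{red}}(\mathrm{IntIso}(\mathcal{G}))/J^{\mathrm{other}}_u$, where $f\in C_c(\mathrm{IntIso}(\mathcal{G}))$ is any function whose restriction to $\mathrm{IntIso}(\mathcal{G})u$ is $x$ (independent of the choice of $f$). For a group $H$, the augmentation homomorphism $\mathbb{C}[H]\to\mathbb{C}$ is $\sum_h\zeta_h h\mapsto\sum_h\zeta_h$. *)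

(* Defs.v *)
From HB Require Import structures.
From mathcomp Require Import all_boot all_order all_algebra.
From mathcomp Require Import sesquilinear complex.
From mathcomp Require Import all_classical all_reals all_analysis.

Set Implicit Arguments.
Unset Strict Implicit.
Unset Printing Implicit Defensive.

Import Order.TTheory GRing.Theory Num.Theory.
Import numFieldNormedType.Exports.

Local Open Scope classical_set_scope.
Local Open Scope ring_scope.
Local Open Scope complex_scope.

(* Normed modules over R[i] have an R[i]-valued norm; [nrm] is the same norm
   seen in R. *)
Definition nrm (R : realType) (V : normedModType R[i]) (x : V) : R :=
  complex.Re `|x|.

(* The binary product is total; it is meaningful on composable pairs, i.e.
   those with [gsrc a = grng b]. Units are identified with identity arrows. *)
HB.mixin Record isTopologicalGroupoid (G : Type) of Topological G := {
  gsrc : G -> G;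
  grng : G -> G;
  ginv : G -> G;
  gmul : G -> G -> G;
  gsrc_src : forall a, gsrc (gsrc a) = gsrc a;
  grng_src : forall a, grng (gsrc a) = gsrc a;
  gsrc_rng : forall a, gsrc (grng a) = grng a;
  grng_rng : forall a, grng (grng a) = grng a;
  gsrc_mul : forall a b, gsrc a = grng b -> gsrc (gmul a b) = gsrc b;
  grng_mul : forall a b, gsrc a = grng b -> grng (gmul a b) = grng a;
  gmulA : forall a b c, gsrc a = grng b -> gsrc b = grng c ->
    gmul a (gmul b c) = gmul (gmul a b) c;
  gmul_rng : forall a, gmul (grng a) a = a;
  gmul_src : forall a, gmul a (gsrc a) = a;
  gsrc_inv : forall a, gsrc (ginv a) = grng a;
  grng_inv : forall a, grng (ginv a) = gsrc a;
  gmulV : forall a, gmul a (ginv a) = grng a;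
  gmulVr : forall a, gmul (ginv a) a = gsrc a;
  ginv_continuous : continuous ginv;
  gmul_continuous : {within [set p : G * G | gsrc p.1 = grng p.2],
    continuous (fun p : G * G => gmul p.1 p.2)}
}.

#[short(type="topGroupoidType")]
HB.structure Definition TopologicalGroupoid :=
  { G of isTopologicalGroupoid G & Topological G }.

(* [f] is a local homeomorphism from X to the subspace B of Y. *)
Definition local_homeo (X Y : topologicalType) (f : X -> Y) (B : set Y) :=
  [/\ forall x, B (f x), continuous f &
      forall x, exists U : set X, [/\ open U, U x, set_inj U f &
        forall W, open W -> W `<=` U ->
          exists2 V, open V & f @` W = V `&` B]].

Section Groupoid.
Variable G : topGroupoidType.

Definition units : set G := [set u | gsrc u = u].

Definition etale :=
  local_homeo (@gsrc G) units /\ local_homeo (@grng G) units.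

Definition Iso : set G := [set g | grng g = gsrc g].

Definition IntIso : set G := Iso°.

Definition IntIso_at (u : G) : set G := IntIso `&` [set g | gsrc g = u].

End Groupoid.

(* C*-algebras, not necessarily unital (hence not on top of a ring structure,
   which in MathComp has a unit). *)
HB.mixin Record isCstarAlgebra (R : realType) (A : Type)
    of CompleteNormedModule R[i] A := {
  cmul : A -> A -> A;
  cstar : A -> A;
  cmulA : associative cmul;
  cmulDl : left_distributive cmul +%R;
  cmulDr : right_distributive cmul +%R;
  cmulZl : forall (c : R[i]) (a b : A), cmul (c *: a) b = c *: cmul a b;
  cmulZr : forall (c : R[i]) (a b : A), cmul a (c *: b) = c *: cmul a b;
  cstarK : involutive cstar;
  cstarD : forall a b : A, cstar (a + b) = cstar a + cstar b;
  cstarZ : forall (c : R[i]) (a : A), cstar (c *: a) = c^* *: cstar a;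
  cstarM : forall a b : A, cstar (cmul a b) = cmul (cstar b) (cstar a);
  cnormM : forall a b : A, `|cmul a b| <= `|a| * `|b|;
  cnorm_star : forall a : A, `|cmul (cstar a) a| = `|a| ^+ 2
}.

#[short(type="cstarAlgType")]
HB.structure Definition CstarAlgebra (R : realType) :=
  { A of isCstarAlgebra R A & CompleteNormedModule R[i] A }.

Section CstarAlgebras.
Variable R : realType.

Definition closed_ideal (A : cstarAlgType R) (J : set A) :=
  [/\ closed J, J 0,
      forall (c : R[i]) a b, J a -> J b -> J (c *: a + b) &
      forall a b, J b -> J (cmul a b) /\ J (cmul b a)].

Definition cstar_simple (A : cstarAlgType R) :=
  forall J : set A, closed_ideal J -> J = [set 0] \/ J = setT.

(* The norm of a + J in A / J. *)
Definition quotient_norm (A : cstarAlgType R) (J : set A) (a : A) : R :=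
  inf [set nrm (a + k) | k in J].

(* (B, q) is the quotient C*-algebra A / J with its canonical map. *)
Definition is_quotient (A B : cstarAlgType R) (J : set A) (q : A -> B) :=
  [/\ forall (c : R[i]) a b, q (c *: a + b) = c *: q a + q b,
      forall a b, q (cmul a b) = cmul (q a) (q b),
      forall a, q (cstar a) = cstar (q a),
      set_surj setT setT q &
      (forall a, q a = 0 <-> J a) /\
      (forall a, nrm (q a) = quotient_norm J a)].

Record hilbertSpace := HilbertSpace {
  hspace :> completeNormedModType R[i];
  hdot : {dot hspace for @Num.conj R[i]};
  hdotE : forall x : hspace, hdot x x = `|x| ^+ 2
}.

Definition opnorm (K : hilbertSpace) (T : K -> K) : R :=
  sup [set nrm (T x) | x in [set x : K | nrm x <= 1]].

End CstarAlgebras.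

(* The algebras attached to an open subgroupoid H of G containing all units
   (below, H is either G itself or IntIso G). A function on H is represented
   by its extension by zero to G. *)
Section GroupoidAlgebras.
Variables (R : realType) (G : topGroupoidType).
Implicit Types (H : set G) (f g : G -> R[i]^o).

Definition Cc H : set (G -> R[i]^o) := [set f |
  [/\ continuous f, compact (closure [set x | f x != 0]) &
      closure [set x | f x != 0] `<=` H]].

Definition conv f g : G -> R[i]^o := fun c =>
  \sum_(p \in [set p : G * G | gsrc p.1 = grng p.2 /\ gmul p.1 p.2 = c])
    (f p.1 * g p.2).

Definition fstar f : G -> R[i]^o := fun c => (f (ginv c))^*.

Definition star_rep H (K : hilbertSpace R)
    (pi : (G -> R[i]^o) -> {linear K -> K}) :=
  [/\ forall f, Cc H f -> continuous (pi f),
      forall (c : R[i]) f g x, Cc H f -> Cc H g ->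
        pi (c *: f + g) x = c *: pi f x + pi g x,
      forall f g x, Cc H f -> Cc H g -> pi (conv f g) x = pi f (pi g x) &
      forall f x y, Cc H f ->
        hdot K (pi (fstar f) x) y = hdot K x (pi f y)].

Definition full_norm H f : \bar R := ereal_sup [set z |
  exists (K : hilbertSpace R) (pi : (G -> R[i]^o) -> {linear K -> K}),
    star_rep H pi /\ z = (opnorm (pi f))%:E].

(* A completion of C_c(H) in the full norm, that is, a model of C^*(H).
   [femb] is only relevant on C_c(H). *)
Record fullCstar H := FullCstar {
  falg :> cstarAlgType R;
  femb : (G -> R[i]^o) -> falg;
  femb_linear : forall (c : R[i]) f g, Cc H f -> Cc H g ->
    femb (c *: f + g) = c *: femb f + femb g;
  femb_conv : forall f g, Cc H f -> Cc H g ->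
    femb (conv f g) = cmul (femb f) (femb g);
  femb_star : forall f, Cc H f -> femb (fstar f) = cstar (femb f);
  femb_norm : forall f, Cc H f -> (nrm (femb f))%:E = full_norm H f;
  femb_dense : dense (femb @` Cc H)
}.

(* The conditional expectation C^*(H) -> C_0(units): the continuous extension
   of the restriction map C_c(H) -> C_0(units), for the full norm on the left
   and the uniform norm on the right. Values are extended by 0 off units. *)
Definition cond_exp H (A : fullCstar H) (a : A) : G -> R[i]^o :=
  xget (fun=> 0) [set g | (forall x, ~ units x -> g x = 0) /\
    forall e : R, 0 < e -> exists2 f, Cc H f &
      nrm (a - femb A f) < e /\ forall u, units u -> nrm (g u - f u) < e].

Definition K_E H (A : fullCstar H) : set A :=
  [set a | forall x y : A, cond_exp (cmul (cmul x a) y) = (fun=> 0)].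

(* A model of C^*_red(H) = C^*(H) / K_E. *)
Record redCstar H := RedCstar {
  rfull : fullCstar H;
  ralg :> cstarAlgType R;
  rquo : rfull -> ralg;
  rquoP : is_quotient (@K_E H rfull) rquo
}.

Definition C0_units : set (G -> R[i]^o) := [set f |
  [/\ {within @units G, continuous f}, forall x, ~ units x -> f x = 0 &
      forall e : R, 0 < e -> exists K : set G,
        [/\ compact K, K `<=` @units G &
            forall u, units u -> ~ K u -> nrm (f u) < e]]].

(* The embedding of C_0(units) in C^*(H): the extension by continuity, from
   the uniform norm, of C_c(units) -> C_c(H) -> C^*(H). *)
Definition C0_emb H (A : fullCstar H) f : A :=
  xget 0 [set a | forall e : R, 0 < e -> exists2 g, Cc (@units G) g &
    (forall x, nrm (f x - g x) < e) /\ nrm (a - femb A g) < e].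

Definition J_other (B : redCstar (@IntIso G)) (u : G) : set B :=
  smallest (@closed_ideal R B)
    [set rquo (C0_emb (rfull B) f) | f in [set f | C0_units f /\ f u = 0]].

(* The group algebra of IntIso(G)u; elements are extended by 0 to G. *)
Definition group_alg (u : G) : set (G -> R[i]^o) := [set x |
  finite_set [set h | x h != 0] /\ [set h | x h != 0] `<=` IntIso_at u].

Definition other_norm (B : redCstar (@IntIso G)) (u : G) (x : G -> R[i]^o) : R :=
  quotient_norm (@J_other B u) (rquo (femb (rfull B)
    (xget (fun=> 0) [set f | Cc (@IntIso G) f /\
       forall h, IntIso_at u h -> f h = x h]))).

Definition augmentation (u : G) (x : G -> R[i]^o) : R[i]^o :=
  \sum_(h \in IntIso_at u) x h.

Definition augmentation_continuous (B : redCstar (@IntIso G)) (u : G) :=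
  forall x, group_alg u x -> forall e : R, 0 < e ->
  exists2 d : R, 0 < d & forall y, group_alg u y ->
    other_norm B u (y - x) < d ->
    nrm (augmentation u y - augmentation u x) < e.

End GroupoidAlgebras.

(* Main.v *)
(* If some isotropy group of [IntIso G] were nontrivial, it would contain an
   element [h] lying on a bisection [B] of non-unit elements of [IntIso G]. For
   [f] in C_c(B) with [f h = 1], let [k] be [f] minus the function
   [f'] on units with [f' (r b) = f b]. Since [k] is nonzero in C*_red(G), by simplicity
   the ideal it generates contains, up to a small error, a function that is 1
   near [u0]. Each generator [x * k * y] acts on vectors supported over a unit [v]
   by differences [xi - L_t xi], where [t] is a conjugate of an element of [B] and
   lies in the isotropy at [v]; hence
   [e |xi|^2 <= sum_t |L_t xi - xi|^2] for some [e > 0] and finitely many local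
   sections [t] of [IntIso G] near [u0]. This makes
   [Y = sum_t d_t d_t^* - e g g^*], with [d_t] the difference of the bumps [g] on [t]
   and on units, a positive element of C*_red(IntIso G). Continuity of the
   augmentation for the norm of [J_other] extends it to a character of
   C*_red(IntIso G), which kills the [d_t] and so sends [Y] to [- e < 0]:
   a contradiction. *)
From HB Require Import structures.
From mathcomp Require Import all_boot all_order all_algebra.
From mathcomp Require Import finmap sesquilinear complex ring lra.
From mathcomp Require Import all_classical all_reals all_analysis.
Require Import Defs.

Set Implicit Arguments.
Unset Strict Implicit.
Unset Printing Implicit Defensive.

Import Order.TTheory GRing.Theory Num.Theory.
Import numFieldNormedType.Exports.

Local Open Scope classical_set_scope.
Local Open Scope ring_scope.
Local Open Scope complex_scope.

(** * Norms and C*-algebras *)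

(** Simplicity concerns C*_red(G) and the augmentation concerns C*_red(IntIso G), but no inclusion
    of one algebra in the other is constructed. Both are compared through one representation, [lam]
    on the square summable functions on [G]: [E(x^* f y)(v)] is the inner product of
    [lam f (lam y delta_v)] with [lam x delta_v], so the reduced norm of either algebra dominates
    these coefficients. What is transferred is an inequality between vectors, and only for vectors
    [lam x delta_v] with [x] in C_c(IntIso G), which stay over [v]. Positivity of [Y] enters without
    spectral theory. For a self-adjoint [y], an explicit iteration provides [s = |y|] and a
    self-adjoint [p] with [p ^ 2 = s]; nonnegative coefficients then force [s (s - y) = 0]. A
    character [chi] with [chi y = - e] has [chi s = (chi p) ^ 2 = e], and the relation becomes
    [2 e ^ 2 = 0]. The algebra may have no unit and the bounds hold near [u0] only. Hence the bump
    [g] in [Y]: it stands for the unit and localizes the inequality. *)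

Section Norm.
Variable R : realType.
Local Notation C := R[i].

Section NormedModule.
Variable V : normedModType C.
Implicit Types x y : V.

Lemma nrmE x : `|x| = (nrm x)%:C.
Proof. by rewrite /nrm RRe_real // ger0_real. Qed.

Lemma nrm_ge0 x : 0 <= nrm x.
Proof. by rewrite -ler0c -nrmE. Qed.

Lemma nrm_triangle x y : nrm (x + y) <= nrm x + nrm y.
Proof. by rewrite -lecR rmorphD /= -!nrmE ler_normD. Qed.

Lemma nrmN x : nrm (- x) = nrm x.
Proof. by rewrite /nrm normrN. Qed.

Lemma nrmBC x y : nrm (x - y) = nrm (y - x).
Proof. by rewrite -nrmN opprB. Qed.

Lemma nrm0 : nrm (0 : V) = 0.
Proof. by rewrite /nrm normr0. Qed.

Lemma nrm_eq0 x : nrm x = 0 -> x = 0.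
Proof. by move=> x0; apply/normr0_eq0; rewrite nrmE x0. Qed.

Lemma nrmZ (c : C) x : nrm (c *: x) = nrm (c : C^o) * nrm x.
Proof.
by apply: complexI; rewrite rmorphM /= -!nrmE normrZ.
Qed.

Lemma nrm_le_eps x : (forall e, 0 < e -> nrm x < e) -> x = 0.
Proof.
move=> h; apply: nrm_eq0; apply/eqP; rewrite eq_le nrm_ge0 andbT.
by rewrite leNgt; apply/negP => /h; rewrite ltxx.
Qed.

Lemma nrm_dist_triangle x y z : nrm (x - z) <= nrm (x - y) + nrm (y - z).
Proof. by rewrite (le_trans _ (nrm_triangle _ _))// subrKA. Qed.

End NormedModule.

Lemma nrm_real (t : R) : nrm (t%:C : C^o) = `|t|.
Proof. by rewrite /nrm normc_def /= expr0n addr0 sqrtr_sqr. Qed.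

Lemma nrm_mul (a b : C^o) : nrm (a * b : C^o) = nrm a * nrm b.
Proof. exact: (nrmZ (V := C^o)). Qed.

Lemma nrm_conj (a : C) : nrm ((a^*)%C : C^o) = nrm (a : C^o).
Proof. by rewrite /nrm normcJ. Qed.

Lemma conjcM (a b : C) : ((a * b)%R^*)%C = (a^*)%C * (b^*)%C :> C.
Proof. exact: rmorphM. Qed.

Lemma conjcD (a b : C) : ((a + b)%R^*)%C = (a^*)%C + (b^*)%C :> C.
Proof. exact: rmorphD. Qed.

Lemma conjcN (a : C) : ((- a)%R^*)%C = - (a^*)%C :> C.
Proof. exact: rmorphN. Qed.

Lemma conjcB (a b : C) : ((a - b)%R^*)%C = (a^*)%C - (b^*)%C :> C.
Proof. exact: rmorphB. Qed.

Lemma conjcE (a : C) : Num.conj a = (a^*)%C.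
Proof. by []. Qed.

Lemma nrm_i : nrm ('i : C^o) = 1.
Proof. by rewrite /nrm normc_def /= expr0n add0r expr1n sqrtr1. Qed.

Lemma nrm_sqr (a : C) : ((nrm (a : C^o)) ^+ 2)%:C = a * (a^*)%C.
Proof. by rewrite rmorphXn /= -nrmE sqr_normc. Qed.

Lemma nrm1 : nrm (1 : C^o) = 1.
Proof. by have := nrm_real 1; rewrite normr1. Qed.

Lemma Re_le_nrm (a : C) : `|complex.Re a| <= nrm (a : C^o).
Proof. by rewrite -lecR -nrmE normc_ge_Re. Qed.

Lemma nrm_Zreal (V : normedModType C) (t : R) (x : V) :
  nrm (t%:C *: x) = `|t| * nrm x.
Proof. by rewrite nrmZ nrm_real. Qed.

Lemma cauchy_nrm_cvg (V : completeNormedModType C) (u : nat -> V) :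
  (forall e, 0 < e -> exists N, forall m n, (N <= m)%N -> (N <= n)%N ->
     nrm (u m - u n) < e) ->
  exists a, forall e, 0 < e -> exists N, forall n, (N <= n)%N -> nrm (a - u n) < e.
Proof.
move=> cu.
have : cvgn u.
  apply/cauchy_cvgP; apply/cauchy_ballP => e e0.
  have eR : e = (complex.Re e)%:C by rewrite RRe_real// gtr0_real.
  have [N hN] : exists N, forall m n, (N <= m)%N -> (N <= n)%N ->
      nrm (u m - u n) < complex.Re e by apply: cu; rewrite -ltcR -eR.
  exists ([set x | exists2 n, (N <= n)%N & x = u n], [set x | exists2 n, (N <= n)%N & x = u n]).
    by split; exists N => //= n /= Nn; exists n.
  move=> [a b] /= [[m Nm ->] [n Nn ->]].
  by rewrite -ball_normE /= nrmE eR ltcR; apply: hN.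
move=> /cvgrPdist_lt h; exists (limn u) => e e0.
have /h : 0 < e%:C :> C by rewrite ltcR.
move=> [N _ hN]; exists N => n Nn.
by have := hN n Nn; rewrite nrmE ltcR.
Qed.

(** Real and imaginary parts are 1-Lipschitz, so completeness of [R] applies to each of them. *)
Lemma cauchy_complex_cvg (u : nat -> C^o) :
  (forall e, 0 < e -> exists N, forall m n, (N <= m)%N -> (N <= n)%N ->
     nrm (u m - u n) < e) ->
  exists a : C^o, forall e, 0 < e -> exists N, forall n, (N <= n)%N -> nrm (a - u n) < e.
Proof.
move=> cu.
have part (f : C -> R) : (forall a b, `|f a - f b| <= nrm (a - b : C^o)) ->
    exists l : R, forall e, 0 < e -> exists N, forall n, (N <= n)%N -> `|l - f (u n)| < e.
  move=> fle.
  have : cvgn (fun n => f (u n)).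
    apply/cauchy_cvgP; apply/cauchy_ballP => e e0.
    have [N hN] := cu _ e0.
    exists ([set x | exists2 n, (N <= n)%N & x = f (u n)],
            [set x | exists2 n, (N <= n)%N & x = f (u n)]).
      by split; exists N => //= n /= Nn; exists n.
    move=> [a b] /= [[m Nm ->] [n Nn ->]].
    by rewrite /ball /=; apply: le_lt_trans (fle _ _) _; apply: hN.
  move=> /cvgrPdist_lt h; exists (limn (fun n => f (u n))) => e e0.
  have [N _ hN] := h _ e0; exists N => n Nn.
  exact: hN.
have [|x hx] := part (@complex.Re R).
  by move=> a b; rewrite -raddfB; apply: Re_le_nrm.
have [|y hy] := part (@complex.Im R).
  move=> a b; rewrite -[X in _ <= X]mulr1 -nrm_i -nrm_mul.
  by apply: le_trans (Re_le_nrm _); rewrite ReiNIm normrN raddfB.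
exists (x +i* y) => e e0.
have e2 : 0 < e / 2 by rewrite divr_gt0.
have [N1 h1] := hx _ e2; have [N2 h2] := hy _ e2.
exists (maxn N1 N2) => n; rewrite geq_max => /andP[n1 n2].
have -> : (x +i* y) - u n = (x - complex.Re (u n))%:C + 'i * (y - complex.Im (u n))%:C.
  by case: (u n) => a b /=; rewrite [LHS]complexE.
rewrite (le_lt_trans (nrm_triangle _ _))// nrm_mul nrm_i mul1r !nrm_real.
by rewrite (splitr e) ltrD// ?h1 ?h2.
Qed.

End Norm.

Section Tends.
Variable R : realType.
Local Notation C := R[i].

Definition tends (V : normedModType C) (u : nat -> V) (a : V) :=
  forall e : R, 0 < e -> exists N, forall n, (N <= n)%N -> nrm (a - u n) < e.

Section NormedModule.
Variable V : normedModType C.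
Implicit Types (u v : nat -> V) (a b : V).

Lemma tends_cst a : tends (fun=> a) a.
Proof. by move=> e e0; exists 0 => n _; rewrite subrr nrm0. Qed.

Lemma tends_unique u a b : tends u a -> tends u b -> a = b.
Proof.
move=> ha hb; apply/eqP; rewrite -subr_eq0; apply/eqP/nrm_le_eps => e e0.
have e2 : 0 < e / 2 by rewrite divr_gt0.
have [N1 h1] := ha _ e2; have [N2 h2] := hb _ e2.
have := h1 (maxn N1 N2) (leq_maxl _ _); have := h2 (maxn N1 N2) (leq_maxr _ _).
rewrite nrmBC => H1 H2.
by rewrite (le_lt_trans (nrm_dist_triangle a (u (maxn N1 N2)) b))// (splitr e) ltrD.
Qed.

Lemma tendsD u v a b : tends u a -> tends v b -> tends (fun n => u n + v n) (a + b).
Proof.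
move=> ha hb e e0.
have e2 : 0 < e / 2 by rewrite divr_gt0.
have [N1 h1] := ha _ e2; have [N2 h2] := hb _ e2.
exists (maxn N1 N2) => n; rewrite geq_max => /andP[n1 n2].
rewrite opprD addrACA (le_lt_trans (nrm_triangle _ _))// (splitr e).
by rewrite ltrD ?h1 ?h2.
Qed.

Lemma tendsZ u a (c : C) : tends u a -> tends (fun n => c *: u n) (c *: a).
Proof.
move=> ha e e0.
have c0 : 0 < 1 + nrm (c : C^o) by rewrite ltr_pwDl ?nrm_ge0.
have [N hN] := ha (e / (1 + nrm (c : C^o))) (divr_gt0 e0 c0).
exists N => n /hN; rewrite ltr_pdivlMr// => h.
rewrite -scalerBr nrmZ; apply: le_lt_trans h.
by rewrite mulrC ler_wpM2l ?nrm_ge0// lerDr.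
Qed.

Lemma tends_shift u a : tends u a -> tends (fun n => u n.+1) a.
Proof. by move=> h e /h[N hN]; exists N => n Nn; rewrite hN// leqW. Qed.

Lemma tends_nrm_le u a (M : R) : tends u a -> (forall n, nrm (u n) <= M) -> nrm a <= M.
Proof.
move=> h hu; apply/ler_addgt0Pr => e /h [N hN].
have := hN N (leqnn _) => hlt.
rewrite -[a](subrK (u N)) (le_trans (nrm_triangle _ _))// addrC lerD//.
exact: ltW.
Qed.

Lemma tends_bounded u a : tends u a -> exists N (M : R),
  0 < M /\ forall n, (N <= n)%N -> nrm (u n) <= M.
Proof.
move=> /(_ 1 ltr01)[N hN]; exists N, (1 + nrm a); split.
  by rewrite ltr_pwDl ?nrm_ge0.
move=> n Nn; rewrite -[u n](subrK a) (le_trans (nrm_triangle _ _))// lerD2r.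
by rewrite nrmBC ltW// hN.
Qed.

Lemma tendsZZ (t : nat -> C^o) u (c : C^o) a :
  tends t c -> tends u a -> tends (fun n => t n *: u n) (c *: a).
Proof.
move=> ht hu e e0.
have [N0 [M [M0 hM]]] := tends_bounded hu.
have cp : 0 < 1 + nrm c by rewrite ltr_pwDl ?nrm_ge0.
have e2 : 0 < e / 2 by rewrite divr_gt0.
have [N1 h1] := ht (e / 2 / M) (divr_gt0 e2 M0).
have [N2 h2] := hu (e / 2 / (1 + nrm c)) (divr_gt0 e2 cp).
exists (maxn N0 (maxn N1 N2)) => n; rewrite !geq_max => /and3P[n0 n1 n2].
have -> : c *: a - t n *: u n = (c - t n) *: u n + c *: (a - u n).
  by rewrite scalerBl scalerBr [RHS]addrC subrKA.
rewrite (le_lt_trans (nrm_triangle _ _))// (splitr e) ltrD// nrmZ.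
  have := h1 n n1; rewrite ltr_pdivlMr//; apply: le_lt_trans.
  by rewrite ler_wpM2l ?nrm_ge0 ?hM.
have := h2 n n2; rewrite ltr_pdivlMr//; apply: le_lt_trans.
by rewrite mulrC ler_wpM2l ?nrm_ge0// lerDr.
Qed.

End NormedModule.

Section Cstar.
Variable A : cstarAlgType R.
Implicit Types a b c : A.

Lemma cmul0l a : cmul 0 a = 0.
Proof. by rewrite -[X in cmul X _](scale0r (0 : A)) cmulZl scale0r. Qed.

Lemma cmul0r a : cmul a 0 = 0.
Proof. by rewrite -[X in cmul _ X](scale0r (0 : A)) cmulZr scale0r. Qed.

Lemma cmulNl a b : cmul (- a) b = - cmul a b.
Proof. by rewrite -scaleN1r cmulZl scaleN1r. Qed.

Lemma cmulNr a b : cmul a (- b) = - cmul a b.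
Proof. by rewrite -scaleN1r cmulZr scaleN1r. Qed.

Lemma cmulBl a b c : cmul (a - b) c = cmul a c - cmul b c.
Proof. by rewrite cmulDl cmulNl. Qed.

Lemma cmulBr a b c : cmul a (b - c) = cmul a b - cmul a c.
Proof. by rewrite cmulDr cmulNr. Qed.

Lemma cstarZc (c : C) a : cstar (c *: a) = (c^*)%C *: cstar a.
Proof. exact: cstarZ. Qed.

Lemma cstarZreal (t : R) a : cstar (t%:C *: a) = t%:C *: cstar a.
Proof. by rewrite cstarZc conjc_real. Qed.

Lemma cstarN a : cstar (- a) = - cstar a.
Proof. by rewrite -scaleN1r cstarZ rmorphN1 scaleN1r. Qed.

Lemma cstar0 : cstar (0 : A) = 0.
Proof. by have := cstarZc 0 (0 : A); rewrite conjc0 !scale0r. Qed.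

Lemma cstarB a b : cstar (a - b) = cstar a - cstar b.
Proof. by rewrite cstarD cstarN. Qed.

Lemma nrm_cmul a b : nrm (cmul a b) <= nrm a * nrm b.
Proof. by rewrite -lecR rmorphM /= -!nrmE cnormM. Qed.

Lemma nrm_cstar_cmul a : nrm (cmul (cstar a) a) = nrm a ^+ 2.
Proof. by apply: complexI; rewrite rmorphXn /= -!nrmE cnorm_star. Qed.

Lemma nrm_cstar a : nrm (cstar a) = nrm a.
Proof.
suff h b : nrm b <= nrm (cstar b) by apply/eqP; rewrite eq_le h andbT -{2}(cstarK a) h.
have [->|b0] := eqVneq (nrm b) 0; first exact: nrm_ge0.
have bp : 0 < nrm b by rewrite lt_def b0 nrm_ge0.
by rewrite -(ler_pM2r bp) -expr2 -nrm_cstar_cmul nrm_cmul.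
Qed.

Lemma tends_cstar (u : nat -> A) a : tends u a -> tends (fun n => cstar (u n)) (cstar a).
Proof. by move=> h e /h[N hN]; exists N => n /hN; rewrite -cstarB nrm_cstar. Qed.

Lemma tends_cmul (u v : nat -> A) a b :
  tends u a -> tends v b -> tends (fun n => cmul (u n) (v n)) (cmul a b).
Proof.
move=> ha hb e e0.
have [N0 [M [M0 hM]]] := tends_bounded hb.
have ap : 0 < 1 + nrm a by rewrite ltr_pwDl ?nrm_ge0.
have e2 : 0 < e / 2 by rewrite divr_gt0.
have [N1 h1] := ha (e / 2 / M) (divr_gt0 e2 M0).
have [N2 h2] := hb (e / 2 / (1 + nrm a)) (divr_gt0 e2 ap).
exists (maxn N0 (maxn N1 N2)) => n; rewrite !geq_max => /and3P[n0 n1 n2].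
have -> : cmul a b - cmul (u n) (v n) = cmul (a - u n) (v n) + cmul a (b - v n).
  by rewrite cmulBl cmulBr [RHS]addrC subrKA.
rewrite (le_lt_trans (nrm_triangle _ _))// (splitr e) ltrD//.
  have := h1 n n1; rewrite ltr_pdivlMr//; apply: le_lt_trans.
  by rewrite (le_trans (nrm_cmul _ _))// ler_wpM2l ?nrm_ge0 ?hM.
have := h2 n n2; rewrite ltr_pdivlMr//; apply: le_lt_trans.
by rewrite (le_trans (nrm_cmul _ _))// mulrC ler_wpM2l ?nrm_ge0// lerDr.
Qed.

End Cstar.
End Tends.

(** * Square roots and absolute values in a C*-algebra *)

Section SquareRoot.
Variables (R : realType) (A : cstarAlgType R).
Local Notation C := R[i].
Implicit Types (a b x w : A) (k : R).

(* The iteration [root_iter] below for the scalar [1]; it increases to [1] and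
   dominates the general one, so that no functional calculus is needed. *)
Definition half_iter (n : nat) : R := iter n (fun t => (1 + t ^+ 2) / 2) 0.

Lemma half_iterS n : half_iter n.+1 = (1 + half_iter n ^+ 2) / 2.
Proof. by []. Qed.

Lemma half_iter_ge0 n : 0 <= half_iter n.
Proof. by case: n => // n; rewrite half_iterS divr_ge0// addr_ge0// sqr_ge0. Qed.

(** The error [e] evolves by [e -> e (1 - e / 2)], a map increasing on [[0, 1]]. It sends
    [d = 2 / (n + 2)] below [2 / (n + 3)] because [(n + 1) (n + 3) <= (n + 2) ^ 2]. *)
Lemma half_iter_rate n : 0 <= 1 - half_iter n <= 2 / n.+2%:R.
Proof.
elim: n => [|n /andP[h1 h2]]; first by rewrite [half_iter 0]/half_iter /= subr0 ler01 divff ?lexx ?pnatr_eq0.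
set e := 1 - half_iter n in h1 h2.
have -> : 1 - half_iter n.+1 = e * (1 - e / 2).
  by rewrite half_iterS /e; field.
have e1 : e <= 1 by rewrite gerBl half_iter_ge0.
apply/andP; split.
  by rewrite mulr_ge0// subr_ge0 ler_pdivrMr// mul1r (le_trans e1)// ler1n.
set d : R := 2 / n.+2%:R in h2.
have n2 : (0 : R) < n.+2%:R by rewrite ltr0n.
have n3 : (0 : R) < n.+3%:R by rewrite ltr0n.
have d1 : d <= 1 by rewrite ler_pdivrMr// mul1r ler_nat.
apply: (@le_trans _ _ (d * (1 - d / 2))).
  have -> : d * (1 - d / 2) = e * (1 - e / 2) + (d - e) * (1 - (d + e) / 2) by field.
  rewrite lerDl mulr_ge0 ?subr_ge0// ler_pdivrMr// mul1r.
  by rewrite (_ : 2 = 1 + 1)// lerD.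
have -> : d * (1 - d / 2) = 2 * (n.+1%:R / n.+2%:R ^+ 2).
  have m0 : n.+1%:R + 1 != 0 :> R by rewrite natr1 pnatr_eq0.
  rewrite /d -(natr1 n.+1); move: (n.+1%:R : R) m0 => m m0.
  by field; rewrite m0.
rewrite ler_pM2l// ler_pdivrMr ?exprn_gt0// mulrC ler_pdivlMr//.
by rewrite -(natr1 n.+2) -(natr1 n.+1); have := ler0n R n.+1; nra.
Qed.

Lemma half_iter_le n m : (n <= m)%N -> half_iter n <= half_iter m.
Proof.
move/subnK <-; elim: (m - n)%N => // k; rewrite addSn; move/le_trans; apply.
rewrite half_iterS -subr_ge0.
have -> : (1 + half_iter (k + n) ^+ 2) / 2 - half_iter (k + n) =
  (1 - half_iter (k + n)) ^+ 2 / 2 by field.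
by rewrite divr_ge0// sqr_ge0.
Qed.

(* A pair [(k, x)] stands for the element [k + x] of the unitization, acting on [A]. *)
Definition uact k x b : A := k%:C *: b + cmul x b.

(* [W n = k * half_iter n + root_iter k x n] satisfies [2 W (n+1) = (k + x) + (W n)^2],
   so its limit [w] solves [(1 - w)^2 = 1 - (k + x)]. *)
Fixpoint root_iter k x (n : nat) : A :=
  if n is m.+1 then
    let w := root_iter k x m in
    (2^-1)%:C *: (x + (2 * k * half_iter m)%:C *: w + cmul w w)
  else 0.

Lemma uactD k l x y b : uact (k + l) (x + y) b = uact k x b + uact l y b.
Proof. by rewrite /uact rmorphD /= scalerDl cmulDl addrACA. Qed.

Lemma uactBr k x b c : uact k x (b - c) = uact k x b - uact k x c.
Proof. by rewrite /uact scalerBr cmulBr opprD addrACA. Qed.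

Lemma uactM k l x y b :
  uact k x (uact l y b) = uact (k * l) (k%:C *: y + l%:C *: x + cmul x y) b.
Proof.
rewrite /uact rmorphM /= scalerDr scalerA cmulDr cmulZr !cmulDl !cmulZl cmulA.
by rewrite !addrA.
Qed.

Lemma uact_root_iterS k x n b : k ^+ 2 = k ->
  uact (k * half_iter n.+1) (root_iter k x n.+1) b =
  (2^-1)%:C *: (uact k x b +
    uact (k * half_iter n) (root_iter k x n)
      (uact (k * half_iter n) (root_iter k x n) b)).
Proof.
move=> kk; rewrite uactM -uactD half_iterS /uact scalerDr scalerA -rmorphM /=.
congr (_%:C *: b + _); last first.
  rewrite -cmulZl -addrA; congr (cmul (_ *: (_ + _)) b).
  by rewrite -scalerDl -rmorphD /=; congr (_%:C *: _ + _); ring.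
by rewrite -[in RHS]expr2 exprMn kk; field.
Qed.

Section Iterate.
Variables (k : R) (x : A).
Hypotheses (kk : k ^+ 2 = k) (k0 : 0 <= k <= 1).
Hypothesis hx : forall b, nrm (uact k x b) <= nrm b.

Local Notation W n := (uact (k * half_iter n) (root_iter k x n)).

Let half_ge0 : `|2^-1 : R| = 2^-1. Proof. by rewrite ger0_norm// invr_ge0. Qed.

Lemma nrm_root_iter n b : nrm (W n b) <= half_iter n * nrm b.
Proof.
elim: n b => [|n ih] b.
  by rewrite /uact mulr0 scale0r cmul0l addr0 nrm0 mul0r.
rewrite uact_root_iterS// nrm_Zreal half_ge0 half_iterS [_ / 2]mulrC -mulrA.
rewrite ler_pM2l ?invr_gt0// mulrDl mul1r (le_trans (nrm_triangle _ _))// lerD//.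
by rewrite (le_trans (ih _))// expr2 -mulrA ler_wpM2l ?half_iter_ge0.
Qed.

Lemma uactB j l y z b : uact j y b - uact l z b = uact (j - l) (y - z) b.
Proof. by rewrite /uact rmorphB /= scalerBl cmulBl opprD addrACA. Qed.

(** [W (n+2) - W (n+1)] is half of [W (n+1) (W (n+1) - W n) + (W (n+1) - W n) W n]. Inserting the
    scalar bounds gives half of [half_iter (n+1) ^ 2 - half_iter n ^ 2], which is exactly the next
    scalar increment. *)
Lemma nrm_root_iter_step n b :
  nrm (W n.+1 b - W n b) <= (half_iter n.+1 - half_iter n) * nrm b.
Proof.
elim: n b => [|n ih] b.
  have W0 c : W 0 c = 0 by rewrite /uact mulr0 scale0r cmul0l addr0.
  rewrite uact_root_iterS// !W0 addr0 subr0 nrm_Zreal half_ge0 half_iterS /=.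
  by rewrite expr0n addr0 subr0 mul1r ler_pM2l// invr_gt0.
rewrite [W n.+2 b]uact_root_iterS// [X in _ - X]uact_root_iterS//.
rewrite -scalerBr nrm_Zreal half_ge0 opprD addrACA subrr add0r.
have -> : W n.+1 (W n.+1 b) - W n (W n b) =
    W n.+1 (W n.+1 b - W n b) + (W n.+1 (W n b) - W n (W n b)).
  by rewrite uactBr subrKA.
have -> : (half_iter n.+2 - half_iter n.+1) * nrm b = 2^-1 *
  (half_iter n.+1 * ((half_iter n.+1 - half_iter n) * nrm b) +
   (half_iter n.+1 - half_iter n) * (half_iter n * nrm b)).
  by rewrite (half_iterS n.+1) {2}(half_iterS n) (half_iterS n); field.
rewrite ler_pM2l ?invr_gt0// (le_trans (nrm_triangle _ _))// lerD//.
  by rewrite (le_trans (nrm_root_iter _ _))// ler_wpM2l ?half_iter_ge0.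
rewrite (le_trans (ih _))// ler_wpM2l ?nrm_root_iter// subr_ge0.
exact: half_iter_le.
Qed.

Lemma nrm_root_iter_dist n m b : (n <= m)%N ->
  nrm (W m b - W n b) <= (half_iter m - half_iter n) * nrm b.
Proof.
move/subnK <-; elim: (m - n)%N => [|j ih]; first by rewrite !subrr nrm0 mul0r.
rewrite addSn (le_trans (nrm_dist_triangle _ (W (j + n)%N b) _))//.
rewrite (le_trans (lerD (nrm_root_iter_step _ _) ih))// -mulrDl.
by rewrite addrA subrK.
Qed.

(** Testing on [b = cstar a], the C*-identity gives [nrm a ^ 2 <= M * nrm a]. Thus estimates on the
    action [uact] become norm estimates in the algebra. *)
Lemma nrm_le_of_act (a : A) (M : R) : 0 <= M ->
  (forall b, nrm (cmul a b) <= M * nrm b) -> nrm a <= M.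
Proof.
move=> M0 h; have [->//|a0] := eqVneq (nrm a) 0.
have ap : 0 < nrm a by rewrite lt_def a0 nrm_ge0.
have := h (cstar a); rewrite -{1}(cstarK a) nrm_cstar_cmul nrm_cstar expr2.
by rewrite ler_pM2r.
Qed.

Lemma root_iter_cvg : exists w : A, tends (root_iter k x) w.
Proof.
apply: cauchy_nrm_cvg => e e0.
have hd n m : (n <= m)%N -> nrm (root_iter k x m - root_iter k x n) <= 4 / n.+2%:R.
  move=> nm.
  have hh : half_iter m - half_iter n <= 2 / n.+2%:R.
    have /andP[_] := half_iter_rate n; have /andP[h _] := half_iter_rate m.
    by apply: le_trans; rewrite lerD2r -subr_ge0.
  have hh0 : 0 <= half_iter m - half_iter n by rewrite subr_ge0 half_iter_le.
  apply: nrm_le_of_act => [|b]; first by rewrite divr_ge0.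
  (* The scalar parts of [W m] and [W n] are taken off again; each of the two pieces is at most
     [2 / (n + 2)], whence the 4. *)
  have -> : cmul (root_iter k x m - root_iter k x n) b =
     (W m b - W n b) - (k * (half_iter m - half_iter n))%:C *: b.
    by rewrite uactB /uact -mulrBr addrAC subrr add0r.
  rewrite (le_trans (nrm_triangle _ _))// nrmN.
  have -> : 4 / n.+2%:R * nrm b = 2 / n.+2%:R * nrm b + 2 / n.+2%:R * nrm b.
    by rewrite -mulrDl -mulrDl -natrD.
  rewrite lerD//.
    by rewrite (le_trans (nrm_root_iter_dist _ nm))// ler_wpM2r ?nrm_ge0.
  move/andP: k0 => [k0' k1]; rewrite nrm_Zreal ler_wpM2r ?nrm_ge0//.
  by rewrite ger0_norm ?mulr_ge0// (le_trans _ hh)// ler_piMl.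
have [N hN] : exists N : nat, forall n, (N <= n)%N -> 4 / n.+2%:R < e.
  exists (Num.bound (4 / e)) => n Nn.
  rewrite ltr_pdivrMr ?ltr0n// mulrC -ltr_pdivrMr//.
  have := archi_boundP (divr_ge0 (ler0n R 4) (ltW e0)).
  by move/lt_le_trans; apply; rewrite ler_nat ltnW// ltnW.
exists N => m n Nm Nn; case/orP: (leq_total n m) => h.
  exact: le_lt_trans (hd _ _ h) (hN _ Nn).
by rewrite nrmBC; exact: le_lt_trans (hd _ _ h) (hN _ Nm).
Qed.

Lemma half_iter_tends : tends (fun n => (half_iter n)%:C : C^o) 1.
Proof.
move=> e e0; exists (Num.bound (2 / e)) => n Nn.
have /andP[h0 h1] := half_iter_rate n.
rewrite -(rmorph1 (real_complex R)) -rmorphB nrm_real ger0_norm//.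
apply: le_lt_trans h1 _.
rewrite ltr_pdivrMr ?ltr0n// mulrC -ltr_pdivrMr//.
have := archi_boundP (divr_ge0 (ler0n R 2) (ltW e0)).
by move/lt_le_trans; apply; rewrite ler_nat ltnW// ltnW.
Qed.

(** Each property passes from the iterates to their limit. For [k = 0] the equation reads
    [(1 - w) ^ 2 = 1 - x]; for [k = 1] it reads [w ^ 2 = - x]. *)
Lemma uact_sqrt : cstar x = x -> exists w,
  [/\ cstar w = w, 2%:C *: w = x + (2 * k)%:C *: w + cmul w w,
      forall b, nrm (uact k w b) <= nrm b &
      forall c, cmul c x = cmul x c -> cmul c w = cmul w c].
Proof.
move=> xs; have [w hw] := root_iter_cvg; exists w.
have hkh : tends (fun n => (k * half_iter n)%:C : C^o) k%:C.
  rewrite -[k%:C]mulr1 (_ : (fun n => _) = fun n => k%:C *: ((half_iter n)%:C : C^o)).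
    exact: tendsZ half_iter_tends.
  by apply/funext => n; rewrite rmorphM.
split.
- have sa n : cstar (root_iter k x n) = root_iter k x n.
    elim: n => [|n ih] /=; first exact: cstar0.
    by rewrite cstarZreal !cstarD cstarZreal cstarM ih xs.
  apply: tends_unique (tends_cstar hw) _.
  by rewrite (funext sa).
- have h1 : tends (fun n => root_iter k x n.+1)
      ((2^-1)%:C *: (x + (2 * k)%:C *: w + cmul w w)).
    apply: tendsZ; apply: tendsD (tends_cmul hw hw); apply: tendsD (tends_cst x) _.
    rewrite rmorphM /= -scalerA.
    rewrite (_ : (fun n => _) = fun n => 2%:C *: ((k * half_iter n)%:C *: root_iter k x n)).
      exact: tendsZ (tendsZZ hkh hw).
    by apply/funext => n; rewrite scalerA -rmorphM mulrA.
  rewrite (tends_unique (tends_shift hw) h1) scalerA -rmorphM mulfV ?pnatr_eq0//.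
  by rewrite scale1r -(tends_unique (tends_shift hw) h1).
- move=> b; apply: (tends_nrm_le (u := fun n => W n b)).
    exact: tendsD (tendsZZ hkh (tends_cst b)) (tends_cmul hw (tends_cst b)).
  move=> n; rewrite (le_trans (nrm_root_iter _ _))// ler_piMl ?nrm_ge0//.
  by have /andP[h _] := half_iter_rate n; rewrite -subr_ge0.
- move=> c cx.
  have cn n : cmul c (root_iter k x n) = cmul (root_iter k x n) c.
    elim: n => [|n ih] /=; first by rewrite cmul0l cmul0r.
    by rewrite cmulZl cmulZr !cmulDl !cmulDr cmulZl cmulZr cx ih cmulA ih -cmulA ih cmulA.
  apply: tends_unique (tends_cmul (tends_cst c) hw) _.
  by rewrite (funext cn); exact: tends_cmul hw (tends_cst c).
Qed.

End Iterate.

(** The hypothesis says that [1 + v] is an isometry of the unitization: its adjoint times itself is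
    1. *)
Lemma nrm_one_plus_unitary v b :
  v + cstar v + cmul (cstar v) v = 0 -> nrm (b + cmul v b) = nrm b.
Proof.
move=> hv; apply/eqP; rewrite -(eqrXn2 (n := 2)) ?nrm_ge0//; apply/eqP.
rewrite -!nrm_cstar_cmul; congr nrm.
have -> : cmul (cstar (b + cmul v b)) (b + cmul v b) = cmul (cstar b) b +
    cmul (cstar b) (cmul (v + cstar v + cmul (cstar v) v) b).
  by rewrite cstarD cstarM !cmulDl !cmulDr !cmulA !addrA.
by rewrite hv cmul0l cmul0r addr0.
Qed.

Lemma two_complex : (2 : R)%:C = 2 :> C.
Proof. exact: (rmorph_nat (real_complex R) 2). Qed.

(** With [1 - w] a square root of [1 - y ^ 2], the elements [1 - w + i y] and [1 - w - i y] are
    isometric and have mean [1 - w]. So [1 - w] contracts, and with it its square. The conclusion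
    takes the place of the statement that [y ^ 2] is positive. *)
Lemma nrm_sub_sqr y : cstar y = y -> nrm y <= 1 ->
  forall b, nrm (b - cmul (cmul y y) b) <= nrm b.
Proof.
move=> ys y1.
have u0 x b : uact 0 x b = cmul x b by rewrite /uact scale0r add0r.
have [] := @uact_sqrt 0 (cmul y y).
- by rewrite expr0n.
- by rewrite lexx ler01.
- move=> b; rewrite u0 (le_trans (nrm_cmul _ _))// ler_piMl ?nrm_ge0//.
  by rewrite (le_trans (nrm_cmul _ _))// mulr_ile1 ?nrm_ge0.
- by rewrite cstarM ys.
move=> w [ws + _ /(_ y)]; rewrite mulr0 scale0r addr0 => w2 yw.
have {}yw : cmul y w = cmul w y by apply: yw; rewrite cmulA.
have hU z : cstar z = z -> cmul z w = cmul w z -> cmul z z = cmul y y ->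
    forall b, nrm (b + cmul ('i *: z - w) b) = nrm b.
  move=> zs zw zz b; apply: nrm_one_plus_unitary.
  have -> : cstar ('i *: z - w) = - 'i *: z - w.
    by rewrite cstarB cstarZc ws zs; congr (_ *: _ - _); apply/eqP; rewrite eq_complex /= oppr0 !eqxx.
  have -> : cmul (- 'i *: z - w) ('i *: z - w) = cmul y y + cmul w w.
    rewrite cmulBl !cmulBr !cmulZl !cmulZr zw zz scalerA.
    have -> : - 'i * 'i = 1 :> C by rewrite mulNr -expr2 sqr_i opprK.
    by rewrite scale1r scaleNr opprK opprB -addrA subrKC.
  rewrite -w2 addrACA scaleNr subrr add0r -opprD -mulr2n -scaler_nat.
  by rewrite two_complex addNr.
have hW b : nrm (b - cmul w b) <= nrm b.
  have -> : b - cmul w b = (2^-1)%:C *: ((b + cmul ('i *: y - w) b) +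
      (b + cmul ('i *: (- y) - w) b)).
    rewrite addrACA -cmulDl addrACA scalerN subrr add0r -opprD cmulNl cmulDl.
    have -> : b + b - (cmul w b + cmul w b) = 2%:C *: (b - cmul w b).
      by rewrite two_complex scaler_nat mulr2n addrACA -opprD.
    by rewrite scalerA -rmorphM mulVf ?pnatr_eq0// scale1r.
  rewrite nrm_Zreal ger0_norm ?invr_ge0// ler_pdivrMl//.
  rewrite (le_trans (nrm_triangle _ _))// !hU//.
  - by rewrite -mulr2n mulr_natl.
  - by rewrite cstarN ys.
  - by rewrite cmulNl cmulNr yw.
  - by rewrite cmulNl cmulNr opprK.
move=> b; apply: le_trans (hW b); apply: le_trans (hW _).
rewrite le_eqVlt; apply/orP; left; apply/eqP; congr nrm.
rewrite cmulBr opprB cmulA -addrA; congr (_ + _).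
have -> : cmul (cmul y y) b = cmul w b + cmul w b - cmul (cmul w w) b.
  have -> : cmul y y = 2%:C *: w - cmul w w by rewrite w2 addrK.
  rewrite cmulBl cmulZl two_complex.
  by rewrite scaler_nat mulr2n.
by rewrite opprB opprD [RHS]addrCA.
Qed.

(** The bound on [1 - q] plays the part of positivity. The case [k = 1] of the iteration solves
    [w ^ 2 = q], and [s = - w] inherits the same kind of bound, so that a second root can be
    extracted from [s]. *)
Lemma cstar_sqrt q : cstar q = q -> (forall b, nrm (b - cmul q b) <= nrm b) ->
  exists s, [/\ cstar s = s, cmul s s = q, forall b, nrm (b - cmul s b) <= nrm b &
    forall c, cmul c q = cmul q c -> cmul c s = cmul s c].
Proof.
move=> qs hq; have [] := @uact_sqrt 1 (- q).
- by rewrite expr1n.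
- by rewrite lexx ler01.
- by move=> b; rewrite /uact scale1r cmulNl.
- by rewrite cstarN qs.
move=> w [ws w2 wb wc]; exists (- w); split.
- by rewrite cstarN ws.
- rewrite cmulNl cmulNr opprK; move: w2.
  rewrite mulr1 addrAC -[X in X = _]add0r => /addIr/esym/eqP.
  by rewrite addrC subr_eq0 => /eqP.
- by move=> b; have := wb b; rewrite /uact scale1r cmulNl opprK.
- by move=> c cq; rewrite cmulNl cmulNr wc// cmulNl cmulNr cq.
Qed.

(* With [s = |y|] and [p = sqrt s], the element [x = p (s - y)] lives on the
   negative part of [y], and [x y x = - z ^ 2] for [z = s (s - y)]. *)
Lemma cstar_abs y : cstar y = y -> exists p s : A,
  [/\ cstar p = p, cstar s = s, cmul p p = s, cmul s s = cmul y y &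
      cmul (cmul (cstar (cmul p (s - y))) y) (cmul p (s - y)) =
      - cmul (cstar (cmul s (s - y))) (cmul s (s - y))].
Proof.
move=> ys.
have N0 : 0 < 1 + nrm y by rewrite ltr_pwDl ?nrm_ge0.
(* The roots are available for contractions, so [y] is rescaled; the summand 1 keeps [N] positive
   when [y = 0]. Below, [s'] is the root of [y' ^ 2] and [p'] that of [s']. *)
set N := 1 + nrm y in N0.
have rN : N = Num.sqrt N * Num.sqrt N by rewrite -expr2 sqr_sqrtr// ltW.
pose y' := N^-1%:C *: y.
have ys' : cstar y' = y' by rewrite cstarZreal ys.
have y'1 : nrm y' <= 1.
  rewrite nrm_Zreal ger0_norm ?invr_ge0 ?(ltW N0)// ler_pdivrMl// mulr1.
  by rewrite lerDr.
have yN : y = N%:C *: y' by rewrite scalerA -rmorphM mulfV ?gt_eqF// scale1r.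
clearbody y'.
have [|s' [ss' s'2 s'b s'c]] := cstar_sqrt _ (nrm_sub_sqr ys' y'1).
  by rewrite cstarM ys'.
have [p' [ps' p'2 _ p'c]] := cstar_sqrt ss' s'b.
have y's' : cmul y' s' = cmul s' y' by apply: s'c; rewrite cmulA.
have y'p' : cmul y' p' = cmul p' y' by exact: p'c.
have p's' : cmul p' s' = cmul s' p' by rewrite -p'2 cmulA.
pose p := (Num.sqrt N)%:C *: p'; pose s := N%:C *: s'.
have pp : cmul p p = s by rewrite cmulZl cmulZr scalerA -rmorphM -rN p'2.
have ss : cmul s s = cmul y y.
  by rewrite /s cmulZl cmulZr s'2 yN !cmulZl !cmulZr.
have ps : cmul p s = cmul s p by rewrite -pp cmulA.
have yp : cmul y p = cmul p y.
  by rewrite yN cmulZl !cmulZr cmulZl y'p' scalerA mulrC -scalerA.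
have ysc : cmul y s = cmul s y.
  by rewrite yN cmulZl !cmulZr cmulZl y's'.
have sps : cstar p = p by rewrite cstarZreal ps'.
have sss : cstar s = s by rewrite cstarZreal ss'.
exists p, s; split => //.
have gs : cstar (s - y) = s - y by rewrite cstarB sss ys.
have pg : cmul p (s - y) = cmul (s - y) p by rewrite cmulBl cmulBr ps yp.
have yg : cmul y (s - y) = cmul (s - y) y by rewrite cmulBl cmulBr ysc.
have sg : cmul s (s - y) = cmul (s - y) s by rewrite cmulBl cmulBr ysc.
have -> : cstar (cmul p (s - y)) = cmul p (s - y) by rewrite cstarM sps gs pg.
have -> : cstar (cmul s (s - y)) = cmul s (s - y) by rewrite cstarM sss gs sg.
(* Since [s ^ 2 = y ^ 2] and the two commute, [y] acts on [s - y] as [- s]: the origin of the minus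
   sign in the conclusion. *)
have sy : cmul s (s - y) = - cmul y (s - y) by rewrite !cmulBr ss ysc opprB.
rewrite {2}sy cmulNr opprK -!cmulA (cmulA y p) yp -(cmulA p y).
by rewrite (cmulA (s - y) p) -pg -(cmulA p (s - y)) (cmulA p p) pp.
Qed.

End SquareRoot.

(** * The Hilbert space of square summable functions *)

Section DotForm.
Variables (R : realType).
Local Notation C := R[i].
Variables (U : lmodType C) (f : {dot U for @Num.conj C}).

Lemma dot_realE u : f u u = (complex.Re (f u u))%:C.
Proof. by rewrite RRe_real// ger0_real// dnorm_ge0. Qed.

Lemma Re_dot_ge0 u : 0 <= complex.Re (f u u).
Proof. by rewrite -ler0c -dot_realE dnorm_ge0. Qed.

Lemma dot_cauchy_schwarz u v :
  nrm (f u v : C^o) <= Num.sqrt (complex.Re (f u u)) * Num.sqrt (complex.Re (f v v)).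
Proof.

suff : ((nrm (f u v : C^o)) ^+ 2)%:C <= f u u * f v v.
  rewrite (dot_realE u) (dot_realE v) -rmorphM lecR => h.
  by rewrite -sqrtrM ?Re_dot_ge0// -[nrm _]ger0_norm ?nrm_ge0// -sqrtr_sqr ler_wsqrtr.
rewrite nrm_sqr.
have [->|v0] := eqVneq v 0.
  by rewrite linear0r mul0r linear0r mulr0.
have b0 : 0 < f v v by rewrite dnorm_gt0.
have bn : f v v != 0 by rewrite gt_eqF.
set t := f u v / f v v.
have : 0 <= f (u - t *: v) (u - t *: v) by rewrite dnorm_ge0.
have bc : ((f v v)^*)%C = f v v by rewrite dot_realE conjc_real.
have tc : (t^*)%C = ((f u v)^*)%C / f v v by rewrite conjcM conjc_inv bc.
have tE : t = f u v / f v v by [].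
clearbody t; rewrite dnormB dnormZ linearZr_LR /= (sqr_normc t) !conjcE conjcM conjcK tc.
have -> : f u u + t * (((f u v)^*)%C / f v v) * f v v -
    (((f u v)^*)%C / f v v * f u v + t * ((f u v)^*)%C) =
    (f u u * f v v - f u v * ((f u v)^*)%C) / f v v.
  by rewrite tE; field.
by rewrite pmulr_lge0 ?invr_gt0// subr_ge0.
Qed.

Definition dnrm u : R := Num.sqrt (complex.Re (f u u)).

Lemma dnrm_sqr u : (dnrm u ^+ 2)%:C = f u u.
Proof. by rewrite sqr_sqrtr ?Re_dot_ge0// -dot_realE. Qed.

Lemma dnrm_triangle u v : dnrm (u + v) <= dnrm u + dnrm v.
Proof.
rewrite -(@ler_pXn2r _ 2) ?nnegrE ?addr_ge0 ?sqrtr_ge0//.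
rewrite -lecR dnrm_sqr dnormD conjcE addcJ sqrrD !rmorphD /= !dnrm_sqr.
rewrite [leRHS]addrAC lerD2l mulr_natl.
rewrite mulr2n lerD// lecR.
all: by rewrite (le_trans (ler_norm _))// (le_trans (Re_le_nrm _))// dot_cauchy_schwarz.
Qed.

Lemma dnrmZ c u : dnrm (c *: u) = nrm (c : C^o) * dnrm u.
Proof.
apply/eqP; rewrite -(@eqrXn2 _ 2) ?mulr_ge0 ?sqrtr_ge0 ?nrm_ge0//; apply/eqP.
by apply: complexI; rewrite dnrm_sqr dnormZ exprMn rmorphM /= dnrm_sqr nrm_sqr sqr_normc.
Qed.

Lemma dnrm_eq0 u : dnrm u = 0 -> u = 0.
Proof.
move=> u0; apply/eqP; rewrite -(dnorm_eq0 f) -dnrm_sqr u0.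
by rewrite expr0n.
Qed.

End DotForm.

Section UnconditionalSums.
Variables (R : realType) (I : choiceType).
Local Notation C := R[i].
Implicit Types (S T : {fset I}).

Lemma sum_fset_sub (V : zmodType) (f : I -> V) S T : (S `<=` T)%fset ->
  \sum_(i <- T) f i = \sum_(i <- S) f i + \sum_(i <- T | i \notin S) f i.
Proof.
move=> ST; rewrite (bigID (mem S)) /=; congr (_ + _).
rewrite -big_filter; apply: perm_big; apply: uniq_perm; rewrite ?filter_uniq ?fset_uniq//.
move=> i; rewrite mem_filter; apply: andb_idr; exact: (fsubsetP ST).
Qed.

Lemma ler_sum_fset (f : I -> R) S T : (forall i, 0 <= f i) -> (S `<=` T)%fset ->
  \sum_(i <- S) f i <= \sum_(i <- T) f i.
Proof. by move=> f0 /(sum_fset_sub f)->; rewrite lerDl sumr_ge0. Qed.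

(** Convergence along the directed set of finite subsets, because the index set will be all of [G],
    which need not be countable. *)
Definition has_usum (f : I -> C^o) (l : C^o) := forall e : R, 0 < e ->
  exists S : {fset I}, forall T, (S `<=` T)%fset -> nrm (l - \sum_(i <- T) f i) < e.

Lemma has_usum_unique f l m : has_usum f l -> has_usum f m -> l = m.
Proof.
move=> hl hm; apply/eqP; rewrite -subr_eq0; apply/eqP/nrm_le_eps => e e0.
have e2 : 0 < e / 2 by rewrite divr_gt0.
have [S h1] := hl _ e2; have [T h2] := hm _ e2.
have H1 := h1 (S `|` T)%fset (fsubsetUl _ _); have H2 := h2 (S `|` T)%fset (fsubsetUr _ _).
rewrite (le_lt_trans (nrm_dist_triangle _ (\sum_(i <- (S `|` T)%fset) f i) _))//.
by rewrite (splitr e) ltrD// nrmBC.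
Qed.

Lemma has_usumD f g l m : has_usum f l -> has_usum g m ->
  has_usum (fun i => f i + g i) (l + m).
Proof.
move=> hl hm e e0.
have e2 : 0 < e / 2 by rewrite divr_gt0.
have [S h1] := hl _ e2; have [T h2] := hm _ e2.
exists (S `|` T)%fset => U; rewrite fsubUset => /andP[SU TU].
rewrite big_split /= opprD addrACA (le_lt_trans (nrm_triangle _ _))//.
by rewrite (splitr e) ltrD ?h1 ?h2.
Qed.

Lemma has_usumZ f l (c : C) : has_usum f l -> has_usum (fun i => c * f i) (c * l).
Proof.
move=> hl e e0.
have c0 : 0 < 1 + nrm (c : C^o) by rewrite ltr_pwDl ?nrm_ge0.
have [S hS] := hl (e / (1 + nrm (c : C^o))) (divr_gt0 e0 c0).
exists S => T /hS; rewrite ltr_pdivlMr// => h.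
rewrite -mulr_sumr -mulrBr nrm_mul; apply: le_lt_trans h.
by rewrite mulrC ler_wpM2l ?nrm_ge0// lerDr.
Qed.

Lemma has_usum_conj f l : has_usum f l -> has_usum (fun i => ((f i)^*)%C) (l^*)%C.
Proof.
move=> hl e /hl[S hS]; exists S => T /hS.
by rewrite -[X in X < _ -> _]nrm_conj rmorphB rmorph_sum.
Qed.

Lemma has_usum_ge0 (f : I -> R) (M : R) : (forall i, 0 <= f i) ->
  (forall S, \sum_(i <- S) f i <= M) ->
  exists2 l : R, has_usum (fun i => (f i)%:C) l%:C &
    (forall S, \sum_(i <- S) f i <= l) /\ l <= M.
Proof.
move=> f0 fM; pose X := [set \sum_(i <- S) f i | S in [set: {fset I}]].
have hX : has_sup X.
  split; first by exists (\sum_(i <- fset0%fset) f i); exists fset0%fset.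
  by exists M => _ [S _ <-].
have ubX S : \sum_(i <- S) f i <= sup X by apply: sup_upper_bound => //; exists S.
exists (sup X); last first.
  by split=> //; apply: ge_sup; [case: hX | move=> _ [S _ <-]].
move=> e e0; have [_ [S _ <-] hS] := sup_adherent e0 hX.
exists S => T ST; rewrite -rmorph_sum -rmorphB nrm_real ger0_norm ?subr_ge0//.
rewrite ltrBlDl -ltrBlDr (lt_le_trans hS)//.
exact: ler_sum_fset.
Qed.

Lemma has_usum1 (f : I -> C^o) j : (forall i, i != j -> f i = 0) -> has_usum f (f j).
Proof.
move=> fj e e0; exists [fset j]%fset => T jT.
rewrite (sum_fset_sub _ jT) big_seq_fset1 big_seq_cond big1 ?addr0 ?subrr ?nrm0//.
by move=> i /andP[_]; rewrite inE => /fj.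
Qed.

End UnconditionalSums.

Section L2.
Variables (R : realType) (I : choiceType).
Local Notation C := R[i].

Definition sq_sum (f : I -> C^o) (S : {fset I}) : R := \sum_(i <- S) nrm (f i) ^+ 2.

Definition sq_summable (f : I -> C^o) := exists M, forall S, sq_sum f S <= M.

Definition l2pred : {pred I -> C^o} := fun f => `[< sq_summable f >].

Lemma nrm_sqrD (a b : C^o) : nrm (a + b) ^+ 2 <= 2 * (nrm a ^+ 2 + nrm b ^+ 2).
Proof.
apply: (@le_trans _ _ ((nrm a + nrm b) ^+ 2)).
  by rewrite lerXn2r ?nnegrE ?addr_ge0 ?nrm_ge0// nrm_triangle.
have := sqr_ge0 (nrm a - nrm b); nra.
Qed.

Lemma l2pred_submod : GRing.submod_closed l2pred.
Proof.
split.
  apply/asboolP; exists 0 => S; rewrite /sq_sum big1// => i _.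
  by rewrite nrm0 expr0n.
move=> c f g /asboolP[M hM] /asboolP[N hN]; apply/asboolP.
exists (2 * (nrm (c : C^o) ^+ 2 * M + N)) => S.
apply: (@le_trans _ _ (2 * (nrm (c : C^o) ^+ 2 * sq_sum f S + sq_sum g S))).
  rewrite /sq_sum mulr_sumr -big_split mulr_sumr /=; apply: ler_sum => i _.
  rewrite (le_trans (nrm_sqrD _ _))// ler_pM2l// lerD2r.
  by rewrite -exprMn -nrm_mul.
by rewrite ler_pM2l// lerD// ler_wpM2l// sqr_ge0.
Qed.

HB.instance Definition _ := GRing.isSubmodClosed.Build C (I -> C^o) l2pred l2pred_submod.

Record l2 := L2 { l2fun :> I -> C^o; l2P : l2fun \in l2pred }.

HB.instance Definition _ := [isSub for l2fun].
HB.instance Definition _ := [Choice of l2 by <:].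
HB.instance Definition _ := [SubChoice_isSubLmodule of l2 by <:].

Implicit Types x y z : l2.

Lemma l2_ext x y : (x : I -> C^o) =1 y -> x = y.
Proof. by move=> h; apply: val_inj; apply/funext. Qed.

(** Reduces the convergence of an inner product series to that of four sums of squares, for which
    bounded partial sums suffice. *)
Lemma polarization (a b : C) : a * (b^*)%C = 4^-1 *
  (((nrm ((a + b : C) : C^o)) ^+ 2)%:C - ((nrm ((a - b : C) : C^o)) ^+ 2)%:C +
   'i%C * ((nrm ((a + 'i%C * b : C) : C^o)) ^+ 2)%:C - 'i%C * ((nrm ((a - 'i%C * b : C) : C^o)) ^+ 2)%:C).
Proof.
have cN u : ((- u)^*)%C = - (u^*)%C :> C by exact: rmorphN.
have cD u v : ((u + v)^*)%C = (u^*)%C + (v^*)%C :> C by exact: rmorphD.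
have cM u : (('i%C * u)%R^*)%C = - 'i%C * (u^*)%C :> C.
  have -> : - 'i%C = (('i%C : C)^*)%C :> C by apply/eqP; rewrite eq_complex /= oppr0 !eqxx.
  exact: rmorphM.
rewrite !nrm_sqr !(cD, cN, cM).
have ii : ('i%C : C) * 'i%C = -1 by rewrite -expr2 sqr_i.
have f4 : (4 : C) != 0 by rewrite pnatr_eq0.
apply: (mulfI f4); rewrite [RHS]mulrA mulfV// mul1r.
have -> : 4 * (a * (b^*)%C) = 2 * (a * (b^*)%C + b * (a^*)%C) -
    2 * ('i%C * 'i%C) * (a * (b^*)%C - b * (a^*)%C) by rewrite ii; ring.
ring.
Qed.

Lemma sq_summable_has_usum (f : I -> C^o) : sq_summable f ->
  exists l : R, has_usum (fun i => (nrm (f i) ^+ 2)%:C) l%:C.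
Proof.
move=> [M hM]; have [|l h _] := has_usum_ge0 _ hM; last by exists l.
by move=> i; rewrite sqr_ge0.
Qed.

Lemma l2_dot_ex x y : exists l, has_usum (fun i => x i * ((y i)^*)%C) l.
Proof.
have sm z : exists l : R, has_usum (fun i => (nrm (z i) ^+ 2)%:C) l%:C.
  by apply: sq_summable_has_usum; exact/asboolP/(l2P z).
have [l1 h1] := sm (x + y); have [l2 h2] := sm (x - y).
have [l3 h3] := sm (x + ('i%C : C) *: y); have [l4 h4] := sm (x - ('i%C : C) *: y).
have := has_usumZ 4^-1 (has_usumD (has_usumD (has_usumD h1
  (has_usumZ (-1) h2)) (has_usumZ 'i h3)) (has_usumZ (- 'i%C) h4)).
set l := (X in has_usum _ X); move=> h; exists l.
congr (has_usum _ _): h; apply/funext => i /=.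
by rewrite [RHS]polarization mulN1r mulNr.
Qed.

Definition l2dot x y : C := projT1 (cid (l2_dot_ex x y)).

Lemma l2dotP x y : has_usum (fun i => x i * ((y i)^*)%C) (l2dot x y).
Proof. by rewrite /l2dot; case: cid. Qed.

Lemma l2dotE x y l : has_usum (fun i => x i * ((y i)^*)%C) l -> l2dot x y = l.
Proof. exact: has_usum_unique (l2dotP x y). Qed.

Lemma l2dotDl x y z : l2dot (x + y) z = l2dot x z + l2dot y z.
Proof.
apply: l2dotE; have := has_usumD (l2dotP x z) (l2dotP y z).
by congr (has_usum _ _); apply/funext => i; rewrite -mulrDl.
Qed.

Lemma l2dotZl c x z : l2dot (c *: x) z = c * l2dot x z.
Proof.
apply: l2dotE; have := has_usumZ c (l2dotP x z).
by congr (has_usum _ _); apply/funext => i; rewrite mulrA.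
Qed.

Lemma l2dotC x y : l2dot x y = ((l2dot y x)^*)%C.
Proof.
apply: l2dotE; have := has_usum_conj (l2dotP y x).
by congr (has_usum _ _); apply/funext => i; rewrite conjcM conjcK mulrC.
Qed.

Lemma l2dotDr x y z : l2dot z (x + y) = l2dot z x + l2dot z y.
Proof. by rewrite l2dotC l2dotDl conjcD -!l2dotC. Qed.

Lemma l2dotZr c x z : l2dot z (c *: x) = (c^*)%C * l2dot z x.
Proof. by rewrite l2dotC l2dotZl conjcM -l2dotC. Qed.

Lemma l2dot_sq x : exists2 l : R, l2dot x x = l%:C & forall S, sq_sum x S <= l.
Proof.
have /asboolP[M hM] := l2P x.
have [|l hl [lS _]] := has_usum_ge0 _ hM; first by move=> i; rewrite sqr_ge0.
exists l => //; apply: l2dotE.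
by congr (has_usum _ _): hl; apply/funext => i; rewrite nrm_sqr.
Qed.

Lemma l2dot_sq_le x (M : R) : (forall S, sq_sum x S <= M) -> l2dot x x <= M%:C.
Proof.
move=> hM; have [|l hl [_ lM]] := has_usum_ge0 _ hM; first by move=> i; rewrite sqr_ge0.
rewrite (_ : l2dot x x = l%:C) ?lecR//; apply: l2dotE.
by congr (has_usum _ _): hl; apply/funext => i; rewrite nrm_sqr.
Qed.

Lemma l2dot_gt0 x : x != 0 -> 0 < l2dot x x.
Proof.
have [l -> hl] := l2dot_sq x; rewrite ltcR; apply: contraNT.
rewrite -leNgt => l0; apply/eqP/l2_ext => i.
have := le_trans (hl [fset i]%fset) l0; rewrite /sq_sum big_seq_fset1 => h.
by apply: nrm_eq0; apply/eqP; rewrite -sqrf_eq0 eq_le h sqr_ge0.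
Qed.

Lemma l2dot_bilinear : bilinear_for (GRing.Scale.Law.clone _ _ ( *%R ) _)
  (GRing.Scale.Law.clone _ _ (@Num.conj C \; *%R) _) (l2dot : l2 -> l2 -> C).
Proof.
split=> z c x y /=; first by rewrite l2dotDl l2dotZl.
by rewrite l2dotDr l2dotZr.
Qed.

HB.instance Definition _ := bilinear_isBilinear.Build C l2 l2 C
  _ _ l2dot l2dot_bilinear.

Lemma l2dot_hermitian x y : l2dot x y = (-1) ^+ false * Num.conj (l2dot y x).
Proof. by rewrite expr0 mul1r l2dotC. Qed.

HB.instance Definition _ := isHermitianSesquilinear.Build C l2 false (@Num.conj C)
  l2dot l2dot_hermitian.

HB.instance Definition _ := isDotProduct.Build C l2 l2dot l2dot_gt0.

Definition l2form : {dot l2 for @Num.conj C} := l2dot.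

Definition l2norm x : C := (dnrm l2form x)%:C.

Lemma l2norm_triangle x y : l2norm (x + y) <= l2norm x + l2norm y.
Proof. by rewrite -rmorphD lecR dnrm_triangle. Qed.

Lemma l2normZ (c : C) x : l2norm (c *: x) = `|c| * l2norm x.
Proof. by rewrite /l2norm dnrmZ rmorphM /= -nrmE. Qed.

Lemma l2norm_eq0 x : l2norm x = 0 -> x = 0.
Proof. by move=> /complexI/dnrm_eq0. Qed.

HB.instance Definition _ := Lmodule_isNormed.Build C l2
  l2norm_triangle l2normZ l2norm_eq0.

Lemma nrm_l2E x : nrm x = dnrm l2form x.
Proof. by []. Qed.

Lemma l2dot_nrm x : l2dot x x = (nrm x ^+ 2)%:C.
Proof. by rewrite nrm_l2E dnrm_sqr. Qed.

Lemma sq_sum_le_nrm x S : sq_sum x S <= nrm x ^+ 2.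
Proof.
have [l lE hS] := l2dot_sq x; apply: le_trans (hS S) _.
by rewrite -lecR -lE l2dot_nrm.
Qed.

Lemma nrm_le_sq_sum x (M : R) : 0 <= M -> (forall S, sq_sum x S <= M ^+ 2) -> nrm x <= M.
Proof.
move=> M0 h; rewrite -(@ler_pXn2r _ 2) ?nnegrE ?nrm_ge0//.
by rewrite -lecR -l2dot_nrm; exact: l2dot_sq_le.
Qed.

Lemma nrm_coord_le x i : nrm (x i : C^o) <= nrm x.
Proof.
rewrite -(@ler_pXn2r _ 2) ?nnegrE ?nrm_ge0//.
by have := sq_sum_le_nrm x [fset i]%fset; rewrite /sq_sum big_seq_fset1.
Qed.

(** The limit is taken coordinatewise. Coordinatewise convergence is uniform on finite sets only, so
    the error is bounded on each finite [S] by a constant that does not depend on [S]. *)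
Lemma l2_cauchy_cvg (u : nat -> l2) :
  (forall e, 0 < e -> exists N, forall m n, (N <= m)%N -> (N <= n)%N ->
     nrm (u m - u n) < e) ->
  exists a, tends u a.
Proof.
move=> cu.
have hc i : exists l : C^o, tends (fun n => u n i : C^o) l.
  apply: cauchy_complex_cvg => e /cu[N hN]; exists N => m n Nm Nn.
  by apply: le_lt_trans (hN _ _ Nm Nn); apply: (nrm_coord_le (u m - u n)).
pose a i : C^o := projT1 (cid (hc i)).
have ha i : tends (fun n => u n i : C^o) (a i) by rewrite /a; case: cid.
have key e : 0 < e -> exists N, forall n, (N <= n)%N ->
    forall S, sq_sum (fun i => a i - u n i) S <= (2 * e) ^+ 2.
  move=> e0; have [N hN] := cu e e0; exists N => n Nn S.
  (* The squared coordinate errors over [S] then add up to at most [e ^ 2], and the total is at most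
     [2 (e ^ 2 + e ^ 2)]. *)
  pose d := e / (1 + #|` S|%:R).
  have s0 : 0 < 1 + #|` S|%:R :> R by rewrite ltr_pwDl.
  have d0 : 0 < d by rewrite divr_gt0.
  have [M hM] : exists M, forall m, (M <= m)%N -> forall i, i \in S -> nrm (a i - u m i) < d.
    have hex i : exists M, forall m, (M <= m)%N -> nrm (a i - u m i) < d by exact: ha.
    exists (\max_(i <- S) projT1 (cid (hex i))) => m Mm i iS.
    have := projT2 (cid (hex i)); apply; apply: leq_trans Mm.
    by rewrite (big_fsetD1 i)//= leq_maxl.
  pose m := maxn M N.
  have hm : sq_sum (u m - u n) S <= e ^+ 2.
    rewrite (le_trans (sq_sum_le_nrm _ _))// lerXn2r ?nnegrE ?nrm_ge0 ?(ltW e0)//.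
    by rewrite ltW// hN// leq_maxr.
  apply: (@le_trans _ _ (2 * (#|` S|%:R * d ^+ 2 + e ^+ 2))).
    apply: (@le_trans _ _ (2 * (\sum_(i <- S) d ^+ 2 + sq_sum (u m - u n) S))).
      rewrite /sq_sum -big_split mulr_sumr /= big_seq [leRHS]big_seq.
      apply: ler_sum => i iS; rewrite -(subrKA (u m i)).
      rewrite (le_trans (nrm_sqrD _ _))// ler_pM2l// lerD2r.
      by rewrite lerXn2r ?nnegrE ?nrm_ge0 ?(ltW d0)// ltW// hM// leq_maxl.
    rewrite ler_pM2l// lerD// big_const_seq count_predT iter_addr_0.
    by rewrite mulr_natl.
  have : #|` S|%:R * d ^+ 2 <= e ^+ 2.
    rewrite /d expr_div_n mulrCA ler_piMr ?sqr_ge0// ler_pdivrMr ?exprn_gt0//.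
    by have := ler0n R #|` S|; nra.
  by nra.
have aP : a \in l2pred.
  have [N hN] := key 1 ltr01; have /asboolP[K hK] := l2P (u N).
  apply/asboolP; exists (2 * ((2 * 1) ^+ 2 + K)) => S.
  apply: (@le_trans _ _ (2 * (sq_sum (fun i => a i - u N i) S + sq_sum (u N) S))).
    rewrite /sq_sum -big_split mulr_sumr /=; apply: ler_sum => i _.
    by rewrite -{1}(subrK (u N i) (a i)) nrm_sqrD.
  by rewrite ler_pM2l// lerD// hN.
exists (L2 aP) => e e0.
have e4 : 0 < e / 4 by rewrite divr_gt0.
have [N hN] := key _ e4; exists N => n /hN h.
apply: (@le_lt_trans _ _ (2 * (e / 4))); last by lra.
by apply: nrm_le_sq_sum => //; rewrite mulr_ge0// ltW.
Qed.

End L2.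

(** A Cauchy filter contains a ball of radius [1 / (n + 1)] for each [n]; the centres form a Cauchy
    sequence, and the filter converges to its limit. *)
Lemma seq_complete_cvg (R : realType) (V : normedModType R[i]) :
  (forall u : nat -> V, (forall e, 0 < e -> exists N, forall m n, (N <= m)%N ->
     (N <= n)%N -> nrm (u m - u n) < e) -> exists a, tends u a) ->
  forall F : set_system V, ProperFilter F -> cauchy F -> cvg F.
Proof.
move=> sc F FF /cauchyP cF.
have hx n : exists x : V, F (ball x (n.+1%:R^-1)).
  by apply: cF; rewrite invr_gt0 ltr0n.
pose x n : V := projT1 (cid (hx n)).
have Fx n : F (ball (x n) (n.+1%:R^-1)) by rewrite /x; case: cid.
have bE n y : ball (x n) (n.+1%:R^-1) y -> nrm (x n - y) < n.+1%:R^-1.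
  rewrite -ball_normE /= nrmE -(rmorph_nat (real_complex R)) -fmorphV ltcR.
  exact.
have xx m n : nrm (x m - x n) < m.+1%:R^-1 + n.+1%:R^-1.
  have [y [/bE ym /bE yn]] := filter_ex (filterI (Fx m) (Fx n)).
  rewrite (le_lt_trans (nrm_dist_triangle _ y _))// ltrD//.
  by rewrite nrmBC.
have small e : 0 < e -> exists N, forall n, (N <= n)%N -> n.+1%:R^-1 < e :> R.
  move=> e0; exists (Num.bound e^-1) => n Nn.
  rewrite invf_plt ?posrE//; apply: lt_le_trans (archi_boundP _) _.
    by rewrite invr_ge0 ltW.
  by rewrite ler_nat ltnW.
have [|a ha] := sc x.
  move=> e e0; have [N hN] := small (e / 2) (divr_gt0 e0 (ltr0n _ 2)).
  exists N => m n Nm Nn; rewrite (lt_trans (xx m n))// (splitr e) ltrD// hN//.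
apply/cvg_ex; exists a; apply/cvgrPdist_lt => e e0.
have eR : e = (complex.Re e)%:C by rewrite RRe_real// gtr0_real.
have e2 : 0 < complex.Re e / 2 by rewrite divr_gt0// -ltcR -eR.
have [N1 h1] := ha _ e2; have [N2 h2] := small _ e2.
apply: filterS (Fx (maxn N1 N2)) => y /bE hy.
rewrite nrmE eR ltcR (le_lt_trans (nrm_dist_triangle _ (x (maxn N1 N2)) _))//.
rewrite (splitr (complex.Re e)) ltrD//; first by rewrite h1// leq_maxl.
by rewrite (lt_trans hy)// h2// leq_maxr.
Qed.

HB.instance Definition _ (R : realType) (I : choiceType) :=
  Uniform_isComplete.Build (l2 R I) (seq_complete_cvg (@l2_cauchy_cvg R I)).

Lemma l2formE (R : realType) (I : choiceType) (x : l2 R I) : l2form R I x x = `|x| ^+ 2.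
Proof. by rewrite [LHS]l2dot_nrm nrmE rmorphXn. Qed.

Definition l2hilbert (R : realType) (I : choiceType) : hilbertSpace R :=
  HilbertSpace (@l2formE R I).

(** * Étale groupoids and their convolution algebra *)

Section GroupoidAlgebra.
Variable G : topGroupoidType.
Implicit Types a b c u : G.

Lemma gmul_invl a b : gsrc a = grng b -> gmul (ginv a) (gmul a b) = b.
Proof. by move=> ab; rewrite gmulA ?gsrc_inv// gmulVr ab gmul_rng. Qed.

Lemma gmul_invr a b : grng a = grng b -> gmul a (gmul (ginv a) b) = b.
Proof. by move=> ab; rewrite gmulA ?gsrc_inv ?grng_inv// gmulV ab gmul_rng. Qed.

Lemma ginvK a : ginv (ginv a) = a.
Proof.
rewrite -[LHS]gmul_src gsrc_inv grng_inv -gmulVr.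
by rewrite gmul_invl// gsrc_inv.
Qed.

Lemma gmul_injl a b c : gsrc a = grng b -> gsrc a = grng c -> gmul a b = gmul a c -> b = c.
Proof. by move=> ab ac h; rewrite -(gmul_invl ab) h gmul_invl. Qed.

Lemma gmul_invK a b : gsrc a = grng b -> gmul (gmul a b) (ginv b) = a.
Proof. by move=> ab; rewrite -gmulA ?grng_inv// gmulV -ab gmul_src. Qed.

Lemma ginv_mul a b : gsrc a = grng b -> ginv (gmul a b) = gmul (ginv b) (ginv a).
Proof.
move=> ab; have h : gsrc (ginv b) = grng (ginv a) by rewrite gsrc_inv grng_inv ab.
have hab : gsrc (gmul a b) = gsrc b by rewrite gsrc_mul.
apply: (@gmul_injl (gmul a b)).
- by rewrite grng_inv.
- by rewrite grng_mul// grng_inv.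
by rewrite gmulV gmulA ?h ?grng_inv ?gsrc_mul// gmul_invK// gmulV grng_mul.
Qed.

Lemma units_rng a : units (grng a).
Proof. exact: gsrc_rng. Qed.

Lemma unit_src u : units u -> gsrc u = u.
Proof. by []. Qed.

Lemma unit_rng u : units u -> grng u = u.
Proof. by move=> uu; rewrite -{1}(unit_src uu) grng_src. Qed.

Lemma unit_inv u : units u -> ginv u = u.
Proof.
move=> uu; have := gmulV u; rewrite unit_rng//.
have := gmul_rng (ginv u); rewrite grng_inv unit_src// => -> h.
by rewrite h.
Qed.

End GroupoidAlgebra.

Section EtaleTopology.
Variable G : topGroupoidType.
Hypothesis Get : etale G.

Lemma gsrc_continuous : continuous (@gsrc G).
Proof. by have [[]] := Get. Qed.

Lemma grng_continuous : continuous (@grng G).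
Proof. by have [_ []] := Get. Qed.

Lemma open_preimage (f : G -> G) (U : set G) : continuous f -> open U -> open (f @^-1` U).
Proof. by move=> cf oU; apply: open_comp => // x _; exact: cf. Qed.

(** Near a unit, both [w] and [gsrc w] lie in a set on which [gsrc] is injective. They have the same
    source, so they coincide. *)
Lemma open_units : open (@units G).
Proof.
rewrite openE => u uu; have [[_ _ /(_ u)[U [oU Uu iU _]]] _] := Get.
rewrite /interior nbhsE /=; exists (U `&` gsrc @^-1` U).
  split; first by apply: openI => //; exact: open_preimage gsrc_continuous oU.
  by split => //=; rewrite unit_src.
move=> w [Uw Usw]; rewrite /units /=; apply: iU; rewrite ?inE//.
by rewrite gsrc_src.
Qed.

Lemma local_homeo_open (f : G -> G) (W : set G) :
  local_homeo f (@units G) -> open W -> open (f @` W).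
Proof.
move=> [fu cf hf] oW; rewrite openE => _ [w Ww <-].
have [U [oU Uw iU imU]] := hf w.
have [|V oV fV] := imU (W `&` U) (openI oW oU); first exact: subIsetr.
rewrite /interior nbhsE /=; exists (f @` (W `&` U)).
  by split; [rewrite fV; exact: openI oV open_units | exists w].
by move=> _ [x [Wx _] <-]; exists x.
Qed.

Lemma open_rng (W : set G) : open W -> open (@grng G @` W).
Proof. by apply: local_homeo_open; have [] := Get. Qed.

Definition bisection (B : set G) :=
  [/\ open B, set_inj B (@gsrc G) & set_inj B (@grng G)].

Lemma bisection_inj_src B a b : bisection B -> B a -> B b -> gsrc a = gsrc b -> a = b.
Proof. by move=> [_ h _] Ba Bb; apply: h; rewrite inE. Qed.

Lemma bisection_inj_rng B a b : bisection B -> B a -> B b -> grng a = grng b -> a = b.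
Proof. by move=> [_ _ h] Ba Bb; apply: h; rewrite inE. Qed.

Lemma bisection_nbhs (g : G) (O : set G) : open O -> O g ->
  exists B, [/\ bisection B, B g & B `<=` O].
Proof.
move=> oO Og; have [[_ _ /(_ g)[U [oU Ug iU _]]] [_ _ /(_ g)[V [oV Vg iV _]]]] := Get.
exists (O `&` (U `&` V)); split.
- split; first exact: openI oO (openI oU oV).
    by move=> a b; rewrite !inE => -[_ [Ua _]] [_ [Ub _]]; apply: iU; rewrite inE.
  by move=> a b; rewrite !inE => -[_ [_ Va]] [_ [_ Vb]]; apply: iV; rewrite inE.
- by [].
- by move=> x [].
Qed.

Lemma bisection_units : bisection (@units G).
Proof.
split; first exact: open_units.
  by move=> a b; rewrite !inE => ua ub; rewrite !unit_src.
by move=> a b; rewrite !inE => ua ub; rewrite !unit_rng.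
Qed.

Lemma bisection_inv B : bisection B -> bisection (@ginv G @^-1` B).
Proof.
move=> bB; have [oB _ _] := bB; split.
- exact: open_preimage (@ginv_continuous G) oB.
- move=> a b; rewrite !inE /= => Ba Bb sab; rewrite -(ginvK a) -(ginvK b).
  by congr ginv; apply: (bisection_inj_rng bB) => //; rewrite !grng_inv.
- move=> a b; rewrite !inE /= => Ba Bb sab; rewrite -(ginvK a) -(ginvK b).
  by congr ginv; apply: (bisection_inj_src bB) => //; rewrite !gsrc_inv.
Qed.

(* The inverse of the range map on a bisection; junk value off [grng @` B]. *)
Definition section_of (B : set G) (v : G) : G := xget v [set b | B b /\ grng b = v].

Lemma section_ofP B v : (@grng G @` B) v -> B (section_of B v) /\ grng (section_of B v) = v.
Proof.
move=> [b Bb <-]; rewrite /section_of; case: xgetP => [_ -> //|/(_ b)].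
by case; split.
Qed.

Lemma section_of_rng B b : bisection B -> B b -> section_of B (grng b) = b.
Proof.
move=> bB Bb; have [|Bs rs] := @section_ofP B (grng b); first by exists b.
exact: (bisection_inj_rng bB).
Qed.

Lemma section_of_continuous B v : bisection B -> (@grng G @` B) v ->
  {for v, continuous (section_of B)}.
Proof.
move=> bB Bv; have [Bs rs] := section_ofP Bv.
move=> N; rewrite nbhsE => -[W [oW Ws] WN].
have [oB _ _] := bB.
have oWB := open_rng (openI oW oB).
suff : nbhs v (section_of B @^-1` N) by [].
apply: (@filterS _ _ _ (@grng G @` (W `&` B))).
  by move=> _ [w [Ww Bw] <-]; apply: WN; rewrite /= section_of_rng.
by apply: open_nbhs_nbhs; split => //; exists (section_of B v).
Qed.

(** The product is continuous relative to composable pairs, so composability is demanded in a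
    neighbourhood of [t] and not just at [t]. *)
Lemma gmul_continuous_at (T : topologicalType) (f g : T -> G) (t : T) :
  {for t, continuous f} -> {for t, continuous g} ->
  (\forall x \near t, gsrc (f x) = grng (g x)) ->
  {for t, continuous (fun x => gmul (f x) (g x))}.
Proof.
move=> cf cg fg; have fgt : gsrc (f t) = grng (g t) by exact: nbhs_singleton fg.
have h := iffLR (subspace_continuousP _ _) (@gmul_continuous G) (f t, g t) fgt.
move=> N /h; rewrite /= nbhs_simpl /= => hN.
have hc : (f x, g x) @[x --> t] --> (f t, g t) by exact: cvg_pair.
have hn := hc _ hN; suff : nbhs t [set x | N (gmul (f x) (g x))] by [].
by apply: filterS2 fg hn => x e /= /(_ e).
Qed.

End EtaleTopology.

Lemma real_complex_continuous (R : realType) (T : topologicalType) (h : T -> R) :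
  continuous h -> continuous (fun x => (h x)%:C : R[i]^o).
Proof.
move=> ch x; apply/cvgrPdist_lt => e e0.
have eR : e = (complex.Re e)%:C by rewrite RRe_real// gtr0_real.
have e1 : 0 < complex.Re e by rewrite -ltcR -eR.
have /cvgrPdist_lt /(_ _ e1) := ch x; apply: filterS => y.
by rewrite nrmE -rmorphB nrm_real eR ltcR.
Qed.

(** * Compactly supported functions and bumps *)

Section CompactSupport.
Variables (R : realType) (G : topGroupoidType).
Local Notation C := R[i].
Hypothesis Ghaus : hausdorff_space G.
Hypothesis Glc : locally_compact [set: G].
Implicit Types (U V H K : set G) (f g : G -> C^o).

Lemma compact_cover_seq (K : set G) (U : G -> set G) : compact K ->
  (forall x, K x -> open (U x) /\ U x x) ->
  exists2 s : seq G, (forall x, x \in s -> K x) & forall y, K y -> exists2 x, x \in s & U x y.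
Proof.
move=> cK hU.
(* The filter of all lists containing a given list. Fed to the near-covering form of compactness, it
   yields a finite subcover that remembers its centres. *)
pose F : set_system (seq G) :=
  [set A | exists t : seq G, forall s : seq G, {subset t <= s} -> A s].
have FF : Filter F.
  split; first by exists [::].
    move=> A B [t hA] [t' hB]; exists (t ++ t') => s ts; split.
      by apply: hA => x xt; apply: ts; rewrite mem_cat xt.
    by apply: hB => x xt; apply: ts; rewrite mem_cat xt orbT.
  by move=> A B AB [t hA]; exists t => s /hA/AB.
have := iffLR (compact_near_coveringP K) cK (seq G) F
  (fun s y => exists2 x, x \in s & K x /\ U x y) FF.
case.
  move=> x Kx; have [oU Ux] := hU x Kx.
  exists (U x, [set s : seq G | x \in s]) => /=.
    by split; [apply: open_nbhs_nbhs | exists [:: x] => s; apply; rewrite inE].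
  by move=> [y s] [/= Uy xs]; exists x.
move=> t /(_ t (fun x h => h)) h; exists [seq x <- t | `[< K x >]].
  by move=> x; rewrite mem_filter => /andP[/asboolP].
move=> y /h[x xt [Kx Uxy]]; exists x => //.
by rewrite mem_filter xt andbT; apply/asboolP.
Qed.

Lemma CcI H K f : continuous f -> compact K -> K `<=` H ->
  (forall x, ~ K x -> f x = 0) -> Cc H f.
Proof.
move=> cf cK KH f0.
have h : closure [set x | f x != 0] `<=` K.
  have -> : K = closure K by apply/closure_id; exact: compact_closed.
  apply: closure_subset => x /= fx; apply: contrapT => /f0 h.
  by rewrite h eqxx in fx.
split => //; last exact: subset_trans KH.
by apply: subclosed_compact h => //; exact: closed_closure.
Qed.

Lemma CcE H f : Cc H f -> [/\ continuous f & exists K,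
  [/\ compact K, K `<=` H & forall x, ~ K x -> f x = 0]].
Proof.
move=> [cf cK KH]; split=> //; exists (closure [set x | f x != 0]); split=> // x.
move=> h; apply/eqP; apply: contra_notT h => fx; exact: subset_closure.
Qed.

Lemma Cc_continuous H f : Cc H f -> continuous f.
Proof. by case. Qed.

Lemma Cc_off H f x : Cc H f -> ~ H x -> f x = 0.
Proof. by move=> /CcE[_ [K [_ KH h]]] Hx; apply: h => /KH. Qed.

Lemma Cc_sub H H' f : H `<=` H' -> Cc H f -> Cc H' f.
Proof. by move=> HH [? ? h]; split=> //; exact: subset_trans HH. Qed.

Lemma Cc0 H : Cc H (0 : G -> C^o).
Proof.
apply: (@CcI _ set0) => //; [exact: cst_continuous | exact: compact0].
Qed.

Lemma CcD H f g : Cc H f -> Cc H g -> Cc H (f + g).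
Proof.
move=> /CcE[cf [K [cK KH fK]]] /CcE[cg [L [cL LH gL]]].
apply: (@CcI _ (K `|` L)).
- by move=> x; apply: continuousD; [exact: cf | exact: cg].
- exact: compactU.
- by move=> x [/KH|/LH].
- by move=> x h; rewrite /GRing.add /= fK ?gL ?addr0// => h'; apply: h; [right|left].
Qed.

Lemma Cc_mull H f g : continuous g -> Cc H f -> Cc H (fun x => g x * f x).
Proof.
move=> cg /CcE[cf [K [cK KH fK]]]; apply: (CcI _ cK KH) => [x|x /fK ->].
  by apply: continuousM; [exact: cg | exact: cf].
by rewrite mulr0.
Qed.

Lemma CcZ H (c : C) f : Cc H f -> Cc H (c *: f).
Proof. by move=> hf; apply: Cc_mull hf; exact: cst_continuous. Qed.

Lemma CcN H f : Cc H f -> Cc H (- f).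
Proof. by move=> hf; rewrite -scaleN1r; exact: CcZ. Qed.

Lemma CcB H f g : Cc H f -> Cc H g -> Cc H (f - g).
Proof. by move=> hf hg; apply: CcD => //; exact: CcN. Qed.

Lemma Cc_bounded H f : Cc H f -> exists M : R, 0 <= M /\ forall x, nrm (f x) <= M.
Proof.
move=> /CcE[cf [K [cK KH fK]]].
have hU x : K x -> open (f @^-1` ball (f x) (1 : C)) /\ (f @^-1` ball (f x) (1 : C)) x.
  move=> Kx; split; last by apply: ballxx.
  by apply: open_comp => [y _|]; [exact: cf | exact: ball_open].
have [s sK sU] := compact_cover_seq cK hU.
have M0 : 0 <= \sum_(x <- s) (1 + nrm (f x)).
  by apply: sumr_ge0 => x _; rewrite addr_ge0 ?nrm_ge0.
exists (\sum_(x <- s) (1 + nrm (f x))); split => // x.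
have [Kx|/fK ->] := pselect (K x); last by rewrite nrm0.
have [y ys] := sU x Kx; rewrite /= -ball_normE /= nrmE ltcR => h.
rewrite (big_rem y)//= (@le_trans _ _ (1 + nrm (f y)))//.
  rewrite -(subrK (f y) (f x)) (le_trans (nrm_triangle _ _))// lerD2r ltW//.
  by rewrite nrmBC.
by rewrite lerDl sumr_ge0// => z _; rewrite addr_ge0 ?nrm_ge0.
Qed.

Lemma Cc_bump U x : open U -> U x -> exists phi : G -> R,
  [/\ Cc U (fun y => (phi y)%:C : C^o), continuous phi, (forall y, 0 <= phi y <= 1) &
      exists V, [/\ open V, V x & forall y, V y -> phi y = 1]].
Proof.
move=> oU Ux.
have [V [oV Vx cV]] : exists V, [/\ open V, V x & compact (closure V)].
  have [B wB [cB clB]] := Glc (I : [set: G] x).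
  have : nbhs x B by apply: (@filterS _ (nbhs x) _ _ _ _ (wB : nbhs x [set t | setT t -> B t])) => t; apply.
  rewrite nbhsE => -[V [oV Vx] VB]; exists V; split=> //.
  apply: (subclosed_compact (@closed_closure _ V) cB).
  by have -> : B = closure B by [apply/closure_id]; exact: closure_subset.
pose W := U `&` V; have oW : open W by exact: openI.
have sep : uniform_separator [set x] (~` W).
  apply: (locally_compact_completely_regular (R := R) Glc Ghaus).
    exact: open_closedC.
  by apply; split.
have [h [ch h01 h0 h1]] := iffLR (@uniform_separatorP _ R _ _) sep.
have hx : h x = 0 by apply: h0; exists x.
have h01' y : 0 <= h y <= 1 by have := h01 (h y) (ex_intro2 _ _ y I erefl); rewrite /= in_itv.
have hW y : ~ W y -> h y = 1 by move=> Wy; apply: h1; exists y.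
(* A clamp equal to 1 where [h <= 1/3], a neighbourhood of [x], and to 0 where [h >= 2/3]. The
   support thus lies in a closed set inside [U], and not merely in the closure of [U]. *)
pose phi y := Num.max 0 (Num.min 1 (2 - 3 * h y)).
have cphi : continuous phi.
  have c0 (r : R) : continuous (fun _ : G => r : R^o) by exact: cst_continuous.
  move=> y; apply: (@continuous_max R G (fun=> 0) (fun y => Num.min 1 (2 - 3 * h y))).
    exact: c0.
  apply: (@continuous_min R G (fun=> 1) (fun y => 2 - 3 * h y)); first exact: c0.
  apply: (@continuousB R R^o G (fun=> 2) (fun y => 3 * h y)); first exact: c0.
  by apply: (@continuousM R G (fun=> 3) h); [exact: c0 | exact: ch].
exists phi; split => //.
- apply: (@CcI _ (closure V `&` h @^-1` [set t | t <= 2 / 3])).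
  + exact: real_complex_continuous.
  + apply: compact_closedI => //.
    by apply: closed_comp => [y _|]; [exact: ch | exact: closed_le].
  + move=> y [_ /= hy]; apply: contrapT => Uy.
    have hy1 : h y = 1 by apply: hW => -[].
    by move: hy; rewrite hy1; lra.
  + move=> y hy; have hy2 : 2 / 3 <= h y.
      have [hle|/ltW//] := leP (h y) (2 / 3).
      case: (pselect (closure V y)) => [cVy|nV].
        by exfalso; apply: hy.
      rewrite hW; first by lra.
      by move=> [_ /subset_closure].
    by rewrite /phi max_l// ge_min; apply/orP; right; lra.
- move=> y; rewrite /phi le_max lexx /= ge_max ler01 /= ge_min lexx//.
- exists (h @^-1` [set t | t < 1 / 3]); split.
  + by apply: open_comp => [y _|]; [exact: ch | exact: open_lt].
  + by rewrite /= hx; lra.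
  + by move=> y /= hy; rewrite /phi min_l ?max_r//; lra.
Qed.

End CompactSupport.

(** * Decomposition over bisections; local sections of the range map *)

Section Decomposition.
Variables (R : realType) (G : topGroupoidType).
Local Notation C := R[i].
Hypothesis Ghaus : hausdorff_space G.
Hypothesis Glc : locally_compact [set: G].
Hypothesis Get : etale G.
Implicit Types (U V H K B : set G) (f g : G -> C^o).

(** Finitely many bumps supported in bisections cover the support of [f]. The induction reduces
    statements on [Cc H] to one bisection, where convolution sums have at most one term. [Z] records
    prescribed zeros, which survive because every piece is a multiple of [f]. *)
Lemma Cc_ind (H Z : set G) (P : (G -> C^o) -> Prop) : open H -> P 0 ->
  (forall f g, Cc H f -> Cc H g -> P f -> P g -> P (f + g)) ->
  (forall B f, bisection B -> B `<=` H -> Cc B f -> (forall z, Z z -> f z = 0) -> P f) ->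
  forall f, Cc H f -> (forall z, Z z -> f z = 0) -> P f.
Proof.
move=> oH P0 PD Pb f hf fZ; have [_ [K [cK KH fK]]] := CcE hf.
pose good V := exists B (phi : G -> R), [/\ bisection B, B `<=` H,
  Cc B (fun y => (phi y)%:C : C^o), continuous phi & forall y, V y -> phi y = 1].
have hV x : exists V, K x -> [/\ open V, V x & good V].
  have [Kx|nK] := pselect (K x); last by exists set0.
  have [B [bB Bx BH]] := bisection_nbhs Get oH (KH _ Kx).
  have [oB _ _] := bB.
  have [phi [Cphi cphi _ [V [oV Vx V1]]]] := Cc_bump R Ghaus Glc oB Bx.
  by exists V; split => //; exists B, phi.
pose W x := projT1 (cid (hV x)).
have WP x : K x -> [/\ open (W x), W x x & good (W x)] by rewrite /W; case: cid.
have [x Kx|s sK sV] := compact_cover_seq (U := W) cK; first by have [] := WP x Kx.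
have sg x : x \in s -> good (W x) by move=> /sK/WP[].
have fs y : f y != 0 -> exists2 x, x \in s & W x y.
  by move=> fy; apply: sV; apply: contrapT => /fK h; rewrite h eqxx in fy.
clearbody W; clear hV WP sV.
elim: s f hf fZ sg fs {K cK KH fK sK} => [|x s ih] f hf fZ sg fs.
  rewrite (_ : f = 0)//; apply/funext => y; apply/eqP; apply: contraT => /fs.
  by case.
have [B [phi [bB BH Cphi cphi phi1]]] := sg x (mem_head _ _).
have cphiC : continuous (fun y => (phi y)%:C : C^o) by exact: real_complex_continuous.
(* The first summand lives on the bisection [B]; the second vanishes where [phi = 1], so the rest of
   the cover suffices for it. *)
have fE : f = (fun y => f y * (phi y)%:C) + (fun y => (1 - (phi y)%:C) * f y).
  apply/funext => y.
  by rewrite -[LHS]mul1r -[X in X * _](subrKC (phi y)%:C) mulrDl [X in X + _]mulrC.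
have C1 : Cc B (fun y => f y * (phi y)%:C : C^o) := Cc_mull Ghaus (Cc_continuous hf) Cphi.
have C2 : Cc H (fun y => (1 - (phi y)%:C) * f y : C^o).
  apply: (@Cc_mull R G Ghaus H f (fun y => 1 - (phi y)%:C) _ hf) => y.
  apply: (@continuousB C C^o G (fun=> 1) (fun y => (phi y)%:C)); last exact: cphiC.
  exact: cst_continuous.
rewrite fE; apply: (PD _ _ (Cc_sub BH C1) C2).
  by apply: (Pb B) => // z /fZ ->; rewrite mul0r.
apply: ih => //.
- by move=> z /fZ ->; rewrite mulr0.
- by move=> z zs; apply: sg; rewrite inE zs orbT.
- move=> y; rewrite mulf_eq0 => /norP[p1 /fs[z]].
  rewrite inE => /orP[/eqP-> /phi1 h|zs Wz]; last by exists z.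
  by rewrite h subrr eqxx in p1.
Qed.

Lemma continuous_glue V L f : open V -> closed L -> L `<=` V ->
  (forall x, V x -> {for x, continuous f}) -> (forall x, ~ L x -> f x = 0) ->
  continuous f.
Proof.
move=> oV cL LV cf fL x; have [/cf//|nV] := pselect (V x).
have nL : ~ L x by move=> /LV.
rewrite /continuous_at fL//; apply: cvg_near_cst.
have : nbhs x (~` L) by apply: open_nbhs_nbhs; split => //; exact: closed_openC.
by apply: filterS => y; exact: fL.
Qed.

Lemma continuous_at_eq (T : topologicalType) (f1 f2 : G -> T) V x : open V -> V x ->
  (forall y, V y -> f1 y = f2 y) -> {for x, continuous f1} -> {for x, continuous f2}.
Proof.
move=> oV Vx e h; suff : f2 @ x --> f1 x by rewrite e.
apply: cvg_trans h; apply: near_eq_cvg.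
have : nbhs x V by apply: open_nbhs_nbhs.
by apply: filterS => y Vy; rewrite e.
Qed.

Definition pull (tau : G -> G) V f : G -> C^o := fun v => if `[< V v >] then f (tau v) else 0.

Lemma pullE tau V f v : V v -> pull tau V f v = f (tau v).
Proof. by move=> Vv; rewrite /pull asboolT. Qed.

Lemma pull_off tau V f v : ~ V v -> pull tau V f v = 0.
Proof. by move=> Vv; rewrite /pull asboolF. Qed.

Lemma pull_Cc B f : bisection B -> Cc B f ->
  Cc (@grng G @` B) (pull (section_of B) (@grng G @` B) f).
Proof.
move=> bB /CcE[cf [K [cK KB fK]]]; have [oB _ _] := bB.
have oV := open_rng Get oB.
have cL : compact (@grng G @` K).
  apply: continuous_compact => //; apply: continuous_subspaceT.
  exact: grng_continuous.
have LV : @grng G @` K `<=` @grng G @` B by move=> _ [k /KB Bk <-]; exists k.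
have L0 v : ~ (@grng G @` K) v -> pull (section_of B) (@grng G @` B) f v = 0.
  move=> nv; have [Bv|/pull_off//] := pselect ((@grng G @` B) v).
  rewrite pullE//; apply: fK => Kv; apply: nv; exists (section_of B v) => //.
  by have [] := section_ofP Bv.
apply: (CcI Ghaus _ cL LV L0).
apply: (continuous_glue oV _ LV _ L0); first exact: compact_closed.
move=> v Vv; apply: (@continuous_at_eq _ (f \o section_of B) _ _ _ oV Vv).
  by move=> y Vy; rewrite pullE.
by apply: continuous_comp; [exact: section_of_continuous | exact: cf].
Qed.

(** Sections are used besides bisections because a conjugate [a b a^-1] is a formula in its base
    point, and because restriction to a smaller neighbourhood leaves the map unchanged. *)
Definition local_section V (tau : G -> G) := [/\ open V, V `<=` @units G,
  forall v, V v -> grng (tau v) = v & forall v, V v -> {for v, continuous tau}].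

Lemma local_section_sub V W tau : local_section V tau -> open W -> W `<=` V ->
  local_section W tau.
Proof.
move=> [oV Vu tr tc] oW WV; split=> // [w /WV/Vu//|w /WV/tr//|w /WV/tc//].
Qed.

(** Around [tau v] choose a bisection [B]. For [w] near [v], an arrow of [B] with range [w] must be
    [tau w], which lies in [B] too. *)
Lemma local_section_open V tau : local_section V tau -> open (tau @` V).
Proof.
move=> [oV Vu tr tc]; rewrite openE => _ [v Vv <-].
have [B [bB Bv _]] := bisection_nbhs Get (@openT G) (I : [set: G] (tau v)).
have [oB _ _] := bB.
have hn : nbhs v (V `&` tau @^-1` B).
  apply: filterI; first exact: open_nbhs_nbhs.
  by apply: (tc v Vv); exact: open_nbhs_nbhs.
move: hn; rewrite nbhsE => -[W [oW Wv] WV].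
rewrite /interior nbhsE /=; exists (B `&` @grng G @^-1` W).
  split; last by split => //=; rewrite tr.
  by apply: openI => //; apply: open_preimage oW; exact: grng_continuous.
move=> g [Bg /= /WV[Vg Btg]]; exists (grng g) => //.
by apply: (bisection_inj_rng bB) => //; rewrite tr.
Qed.

Definition push (tau : G -> G) f : G -> C^o :=
  fun a => if `[< a = tau (grng a) >] then f (grng a) else 0.

Lemma push_Cc V tau f : local_section V tau -> Cc V f -> Cc (tau @` V) (push tau f).
Proof.
move=> ls hf; have oT := local_section_open ls; have [oV Vu tr tc] := ls.
have [cf [K [cK KV fK]]] := CcE hf.
have cL : compact (tau @` K).
  by apply: continuous_compact => //; apply: continuous_in_subspaceT => v; rewrite inE => /KV/tc.
have LV : tau @` K `<=` tau @` V by move=> _ [k /KV Bk <-]; exists k.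
have L0 a : ~ (tau @` K) a -> push tau f a = 0.
  rewrite /push; case: asboolP => // ge ng; apply: fK => Kg; apply: ng.
  by exists (grng a).
apply: (CcI Ghaus _ cL LV L0).
apply: (continuous_glue oT _ LV _ L0); first exact: compact_closed.
move=> g Vg; apply: (@continuous_at_eq _ (f \o @grng G) _ _ _ oT Vg).
  by move=> _ [v Vv <-]; rewrite /push /= tr// asboolT.
by apply: continuous_comp; [exact: (grng_continuous Get) | exact: cf].
Qed.

Lemma finite_fibre H f v : open H -> Cc H f ->
  finite_set [set a | f a != 0 /\ grng a = v].
Proof.
move=> oH hf.
apply: (Cc_ind (Z := set0) (P := fun f => finite_set [set a | f a != 0 /\ grng a = v]) oH _ _ _ hf) => //.
- by apply: (sub_finite_set _ (@finite_set0 G)) => a [] /=; rewrite eqxx.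
- move=> f1 f2 _ _ h1 h2; apply: (@sub_finite_set _ _ _ _ (_ : finite_set (_ `|` _))); last first.
    by rewrite finite_setU; split; [exact: h1 | exact: h2].
  move=> a [/= + av]; have [e1|e1] := eqVneq (f1 a) 0; last by left.
  have [e2|e2] := eqVneq (f2 a) 0; last by right.
  by rewrite /GRing.add /= e1 e2 addr0 eqxx.
- move=> B f1 bB _ hB _.
  have hb a : f1 a != 0 -> B a by move=> h; apply: contrapT => /(Cc_off hB) e; rewrite e eqxx in h.
  have [[a [fa ra]]|no] := pselect (exists a, f1 a != 0 /\ grng a = v).
    apply: (sub_finite_set _ (finite_set1 a)) => b [/hb Bb rb].
    by apply: (bisection_inj_rng bB) => //; [exact: hb | rewrite ra].
  by apply: (sub_finite_set _ (@finite_set0 G)) => b hb'; apply: no; exists b.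
Qed.

End Decomposition.

(** * Convolution as a sum with finitely many terms *)

Section Convolution.
Variables (R : realType) (G : topGroupoidType).
Local Notation C := R[i].
Implicit Types (U V H K B : set G) (f g : G -> C^o).

(** A factorization of [c] is determined by its first factor, so only one term can survive, whatever
    the support of [g]. *)
Lemma conv_eq1 f g a c : grng a = grng c -> (forall b, f b != 0 -> grng b = grng c -> b = a) ->
  conv f g c = f a * g (gmul (ginv a) c).
Proof.
move=> ac h; rewrite /conv.
transitivity (\sum_(p \in [set (a, gmul (ginv a) c)]) (f p.1 * g p.2)); last first.
  by rewrite fsbig_set1.
apply/esym/fsbig_widen.
  by move=> _ ->; split; rewrite /= ?grng_mul ?gsrc_inv ?grng_inv// gmul_invr.
move=> [p q] [[/= pq pqc] ne]; apply/eqP; rewrite /= mulf_eq0; apply/orP.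
have [/eqP p0|p0] := boolP (f p == 0); [by left; apply/eqP | exfalso; apply: ne].
have pa : p = a by apply: h => //; rewrite -pqc grng_mul.
by congr (_, _) => //; rewrite -pqc -pa gmul_invl.
Qed.

Lemma conv_bisection f g B a c : set_inj B (@grng G) -> (forall b, f b != 0 -> B b) ->
  B a -> grng a = grng c -> conv f g c = f a * g (gmul (ginv a) c).
Proof.
move=> iB fB Ba ac; apply: conv_eq1 => // b /fB Bb bc.
by apply: iB; rewrite ?inE// ac.
Qed.

Lemma conv_eq0 f g c : (forall a, grng a = grng c -> f a = 0) -> conv f g c = 0.
Proof.
move=> h; rewrite /conv fsbig1// => -[p q] /= [pq pqc].
by rewrite h ?mul0r// -pqc grng_mul.
Qed.

Lemma conv_finite f g c : finite_set [set a | f a != 0 /\ grng a = grng c] ->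
  finite_set ([set p : G * G | gsrc p.1 = grng p.2 /\ gmul p.1 p.2 = c] `&`
    [set p | f p.1 != 0]).
Proof.
move=> fin; apply: (sub_finite_set _ (finite_image (fun a => (a, gmul (ginv a) c)) fin)).
move=> [p q] [[/= pq pqc] fp]; exists p; first by split => //; rewrite -pqc grng_mul.
by rewrite -pqc gmul_invl.
Qed.

Lemma conv_restrict f g c (D : set (G * G)) :
  (forall p, gsrc p.1 = grng p.2 -> gmul p.1 p.2 = c -> ~ D p -> f p.1 * g p.2 = 0) ->
  conv f g c = \sum_(p \in [set p : G * G | gsrc p.1 = grng p.2 /\ gmul p.1 p.2 = c] `&` D)
    (f p.1 * g p.2).
Proof.
move=> h; apply/esym/fsbig_widen; first by move=> p [].
by move=> p [[pq pqc] np] /=; apply: h => // Dp; apply: np.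
Qed.

(** A sum with infinite support is 0 by default, so additivity requires finiteness. The left factor
    alone provides it, since the right one will also be an arbitrary vector of [l2]. *)
Lemma convDl f1 f2 g c : finite_set [set a | f1 a != 0 /\ grng a = grng c] ->
  finite_set [set a | f2 a != 0 /\ grng a = grng c] ->
  conv (f1 + f2) g c = conv f1 g c + conv f2 g c.
Proof.
move=> fin1 fin2; pose D := [set p : G * G | f1 p.1 != 0] `|` [set p | f2 p.1 != 0].
have D1 p : ~ D p -> f1 p.1 = 0.
  by move=> nD; apply/eqP; apply: contra_notT nD => h; left.
have D2 p : ~ D p -> f2 p.1 = 0.
  by move=> nD; apply/eqP; apply: contra_notT nD => h; right.
rewrite (@conv_restrict _ _ _ D); last first.
  by move=> p _ _ nD; rewrite /GRing.add /= D1// D2// addr0 mul0r.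
rewrite (@conv_restrict f1 _ _ D); last by move=> p _ _ nD; rewrite D1// mul0r.
rewrite (@conv_restrict f2 _ _ D); last by move=> p _ _ nD; rewrite D2// mul0r.
rewrite -fsbig_split; first by apply: eq_fsbigr => p _; exact: mulrDl.
by rewrite setIUr finite_setU; split; exact: conv_finite.
Qed.

Lemma convDr f g1 g2 c : finite_set [set a | f a != 0 /\ grng a = grng c] ->
  conv f (g1 + g2) c = conv f g1 c + conv f g2 c.
Proof.
move=> fin; pose D := [set p : G * G | f p.1 != 0].
have D1 p : ~ D p -> f p.1 = 0.
  by move=> nD; apply/eqP; apply: contra_notT nD => h.
rewrite !(@conv_restrict f _ _ D);
  try by move=> p _ _ nD; rewrite D1// mul0r.
rewrite -fsbig_split; first by apply: eq_fsbigr => p _; exact: mulrDr.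
exact: conv_finite.
Qed.

Lemma convZl (k : C) f g c : conv (k *: f) g c = k * conv f g c.
Proof.
rewrite /conv mulr_fsumr; apply: eq_fsbigr => p _; exact/esym/mulrA.
Qed.

Lemma convZr (k : C) f g c : conv f (k *: g) c = k * conv f g c.
Proof.
rewrite /conv mulr_fsumr; apply: eq_fsbigr => p _; exact: mulrCA.
Qed.

Lemma conv0l g : conv 0 g = (0 : G -> C^o).
Proof. by apply/funext => c; rewrite conv_eq0. Qed.

End Convolution.

Lemma closed_eq_continuous (X Y : topologicalType) (f g : X -> Y) : hausdorff_space Y ->
  continuous f -> continuous g -> closed [set x | f x = g x].
Proof.
rewrite open_hausdorff => hY cf cg; rewrite -openC openE => x /= /eqP /hY.
move=> [[A B] [/= /set_mem Ax /set_mem Bx] [oA oB /eqP AB]].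
apply: (@filterS _ _ _ (f @^-1` A `&` g @^-1` B)).
  move=> y [/= Ay By] e; have : (A `&` B) (g y) by split => //; rewrite -e.
  by rewrite AB.
apply: filterI; [exact: cf _ (open_nbhs_nbhs _) | exact: cg _ (open_nbhs_nbhs _)].
Qed.

Lemma conjc_continuous (R : realType) (T : topologicalType) (f : T -> R[i]^o) :
  continuous f -> continuous (fun z => ((f z)^*)%C : R[i]^o).
Proof.
move=> cf x; apply/cvgrPdist_lt => e e0.
have /cvgrPdist_lt/(_ e e0) := cf x; apply: filterS => y.
by rewrite -conjcB normcJ.
Qed.

Lemma conv0r (R : realType) (G : topGroupoidType) (f : G -> R[i]^o) :
  conv f (0 : G -> R[i]^o) = 0.
Proof. by apply/funext => c; rewrite /conv fsbig1// => p _; rewrite mulr0. Qed.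

Section ConvolutionAlgebra.
Variables (R : realType) (G : topGroupoidType).
Local Notation C := R[i].
Hypothesis Ghaus : hausdorff_space G.
Hypothesis Glc : locally_compact [set: G].
Hypothesis Get : etale G.
Implicit Types (U V H K B : set G) (f g : G -> C^o).

Definition open_subgroupoid H := [/\ open H, @units G `<=` H,
  (forall a b, H a -> H b -> gsrc a = grng b -> H (gmul a b)) &
  (forall a, H a -> H (ginv a))].

Lemma open_subgroupoidT : open_subgroupoid [set: G].
Proof. by split=> //; exact: openT. Qed.

Lemma left_quotient_continuous B c : bisection B -> (@grng G @` B) (grng c) ->
  {for c, continuous (fun x => gmul (ginv (section_of B (grng x))) x)}.
Proof.
move=> bB Bc; have [oB _ _] := bB.
apply: gmul_continuous_at; last first.
- have : nbhs c (@grng G @^-1` (@grng G @` B)).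
    apply: open_nbhs_nbhs; split => //; apply: open_preimage (open_rng Get oB).
    exact: grng_continuous.
  by apply: filterS => x Bx; rewrite gsrc_inv; have [] := section_ofP Bx.
- by [].
- apply: (@continuous_comp _ _ _ (section_of B \o @grng G) (@ginv G)).
    apply: continuous_comp; first exact: (grng_continuous Get).
    exact: section_of_continuous.
  exact: ginv_continuous.
Qed.

(** The main point is stability under products. With [B] a bisection inside [IntIso] through [a], an
    arrow [x] near [a b] is [b' (b'^-1 x)] with [b'] in [B] and the second factor near [b], so both
    factors are isotropic and [x] is too. *)
Lemma IntIso_subgroupoid : open_subgroupoid (@IntIso G).
Proof.
have oI : open (@IntIso G) by exact: open_interior.
have II a : @IntIso G a -> grng a = gsrc a by move=> /interior_subset.
split => //.
- rewrite /IntIso -open_subsetE; last exact: open_units.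
  move=> u uu.
  by rewrite /Iso /= unit_src// unit_rng.
- move=> a b Ia Ib ab.
  have [B [bB Ba BI]] := bisection_nbhs Get oI Ia.
  have [oB _ _] := bB.
  have Bra : (@grng G @` B) (grng (gmul a b)) by rewrite grng_mul//; exists a.
  have sa : section_of B (grng (gmul a b)) = a by rewrite grng_mul// section_of_rng.
  have cq := left_quotient_continuous bB Bra.
  have n1 : nbhs (gmul a b) [set x | IntIso (gmul (ginv (section_of B (grng x))) x)].
    by apply: cq; rewrite sa gmul_invl//; exact: open_nbhs_nbhs.
  have n2 : nbhs (gmul a b) (@grng G @^-1` (@grng G @` B)).
    apply: open_nbhs_nbhs; split => //; apply: open_preimage (open_rng Get oB).
    exact: grng_continuous.
  rewrite /IntIso /interior /=; apply: filterS2 n1 n2 => x /= Ix Bx.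
  have [Bs rs] := section_ofP Bx.
  have [/BI/II hs /II] := (Bs, Ix).
  rewrite grng_mul ?gsrc_mul ?gsrc_inv ?grng_inv// => h.
  by rewrite /Iso /= -rs hs.
- move=> a Ia; have : nbhs (ginv a) (@ginv G @^-1` (@IntIso G)).
    by apply: (@ginv_continuous G); rewrite ginvK; exact: open_nbhs_nbhs.
  rewrite /IntIso /interior /=; apply: filterS => x /II /=.
  by rewrite /Iso /= grng_inv gsrc_inv => ->.
Qed.

Lemma fibreP H f v : open H -> Cc H f -> finite_set [set a | f a != 0 /\ grng a = v].
Proof. exact: finite_fibre. Qed.

(** For [f] on a bisection, the value at [c] is [f(b) g(b^-1 c)] with [b] depending continuously on
    [c]. The support lies in the image of the composable part of [K x L], which is compact since
    composability is a closed condition in a Hausdorff groupoid. *)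
Lemma Cc_conv H f g : open_subgroupoid H -> Cc H f -> Cc H g -> Cc H (conv f g).
Proof.
move=> [oH _ Hm _] hf hg.
apply: (Cc_ind (Z := set0) (P := fun f => Cc H (conv f g)) Ghaus Glc Get oH _ _ _ hf) => //.
- by rewrite conv0l; exact: Cc0.
- move=> f1 f2 h1 h2 c1 c2.
  rewrite (_ : conv (f1 + f2) g = conv f1 g + conv f2 g); first exact: CcD.
  apply/funext => c; apply: convDl; exact: (fibreP _ oH).
- move=> B f1 bB BH hB _; have [oB _ iB] := bB.
  have [cf [K [cK KB fK]]] := CcE hB.
  have [cg [L [cL LH gL]]] := CcE hg.
  have fB b : f1 b != 0 -> B b.
    by move=> h; apply: contrapT => /(Cc_off hB) e; rewrite e eqxx in h.
  have oV := open_rng Get oB.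
  pose V := @grng G @^-1` (@grng G @` B).
  have oVV : open V by apply: open_preimage oV; exact: grng_continuous.
  have cont : continuous (conv f1 g).
    have crK : compact (@grng G @` K).
      apply: continuous_compact => //; apply: continuous_subspaceT.
      exact: grng_continuous.
    apply: (@continuous_glue _ _ V (@grng G @^-1` (@grng G @` K))) => //.
    + apply: closed_comp => [c _|]; first exact: grng_continuous.
      exact: compact_closed.
    + by move=> c [k /KB Bk kc]; exists k.
    + move=> c Vc.
      apply: (@continuous_at_eq _ _
        (fun c => f1 (section_of B (grng c)) * g (gmul (ginv (section_of B (grng c))) c)) _ V) => //.
        move=> y Vy; have [Bs rs] := section_ofP Vy.
        by rewrite (conv_bisection g iB fB Bs).
      apply: continuousM; last first.
        apply: (@continuous_comp _ _ _ (fun x => gmul (ginv (section_of B (grng x))) x) g).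
          exact: left_quotient_continuous.
        exact: cg.
      apply: (@continuous_comp _ _ _ (section_of B \o @grng G) f1); last exact: cf.
      apply: continuous_comp; first exact: (grng_continuous Get).
      exact: section_of_continuous.
    + move=> c nc; apply: conv_eq0 => a ac; apply: fK => Ka; apply: nc.
      by exists a.
  pose D := (K `*` L) `&` [set p : G * G | gsrc p.1 = grng p.2].
  have cD : compact D.
    apply: compact_closedI; first exact: compact_setX.
    apply: closed_eq_continuous => //.
      by move=> p; apply: continuous_comp; [exact: cvg_fst | exact: gsrc_continuous].
    by move=> p; apply: continuous_comp; [exact: cvg_snd | exact: grng_continuous].
  apply: (@CcI _ _ Ghaus _ ((fun p : G * G => gmul p.1 p.2) @` D)) => //.
  + apply: continuous_compact => //.
    by apply: continuous_subspaceW (@gmul_continuous G) => p [].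
  + by move=> _ [p [[/KB/BH Hp1 /LH Hp2] p12] <-]; exact: Hm.
  + move=> c nc; have [Vc|nV] := pselect (V c); last first.
      by apply: conv_eq0 => a ac; apply: fK => /KB Ba; apply: nV; exists a.
    have [Bs rs] := section_ofP Vc.
    rewrite (conv_bisection g iB fB Bs)//; set b := section_of _ _ in Bs rs *.
    have [Kb|/fK->] := pselect (K b); last by rewrite mul0r.
    have [Lb|/gL->] := pselect (L (gmul (ginv b) c)); last by rewrite mulr0.
    exfalso; apply: nc; exists (b, gmul (ginv b) c); last by rewrite /= gmul_invr.
    by split => //=; rewrite grng_mul ?gsrc_inv ?grng_inv.
Qed.

Lemma Cc_fstar H f : open_subgroupoid H -> Cc H f -> Cc H (fstar f).
Proof.
move=> [oH _ _ Hi] /CcE[cf [K [cK KH fK]]].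
apply: (@CcI _ _ Ghaus _ (@ginv G @` K)).
- apply: (@conjc_continuous R G (f \o @ginv G)) => x.
  by apply: continuous_comp; [exact: ginv_continuous | exact: cf].
- apply: continuous_compact => //; apply: continuous_subspaceT; exact: ginv_continuous.
- by move=> _ [k /KH Hk <-]; exact: Hi.
- move=> x nx; rewrite /fstar fK ?conjc0// => Kx; apply: nx.
  by exists (ginv x); rewrite ?ginvK.
Qed.

Lemma fstarK f : fstar (fstar f) = f.
Proof. by apply/funext => c; rewrite /fstar ginvK conjcK. Qed.

(** [xi] is an arbitrary function, so this also gives multiplicativity of the action on [l2]. With
    [f] and [g] on bisections, every sum has at most one term. *)
Lemma conv_assoc H f g xi : open_subgroupoid H -> Cc H f -> Cc H g ->
  conv (conv f g) xi = conv f (conv g xi).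
Proof.
move=> sH hf hg; have [oH _ Hm _] := sH.
apply: (Cc_ind (Z := set0) (P := fun f => conv (conv f g) xi = conv f (conv g xi))
  Ghaus Glc Get oH _ _ _ hf) => //.
- by rewrite !conv0l.
- move=> f1 f2 h1 h2 e1 e2; apply/funext => c.
  rewrite [RHS]convDl; [|exact: (fibreP _ oH)..].
  rewrite -e1 -e2 -convDl; [|exact: (fibreP _ oH (Cc_conv sH _ hg))..].
  congr (conv _ xi c); apply/funext => d; apply: convDl; exact: (fibreP _ oH).
- move=> B f1 bB BH hB _; have [oB _ iB] := bB.
  have h1 : Cc H f1 by exact: Cc_sub hB.
  have fB b : f1 b != 0 -> B b.
    by move=> h; apply: contrapT => /(Cc_off hB) e; rewrite e eqxx in h.
  apply: (Cc_ind (Z := set0) (P := fun g => conv (conv f1 g) xi = conv f1 (conv g xi))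
    Ghaus Glc Get oH _ _ _ hg) => //.
  + by rewrite conv0r !conv0l conv0r.
  + move=> g1 g2 k1 k2 e1 e2; apply/funext => c.
    have -> : conv (g1 + g2) xi = conv g1 xi + conv g2 xi.
      apply/funext => d; apply: convDl; exact: (fibreP _ oH).
    have -> : conv f1 (g1 + g2) = conv f1 g1 + conv f1 g2.
      apply/funext => d; apply: convDr; exact: (fibreP _ oH).
    rewrite [RHS]convDr; last exact: (fibreP _ oH).
    rewrite convDl; [|exact: (fibreP _ oH (Cc_conv sH _ _))..].
    by rewrite e1 e2.
  + move=> B' g1 bB' BH' hB' _; have [oB' _ iB'] := bB'.
    have gB b : g1 b != 0 -> B' b.
      by move=> h; apply: contrapT => /(Cc_off hB') e; rewrite e eqxx in h.
    apply/funext => c.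
    have [[a [Ba ac]]|no] := pselect (exists a, B a /\ grng a = grng c); last first.
      rewrite [RHS]conv_eq0; last first.
        move=> a ac; apply/eqP; apply: contra_notT no => /fB Ba; by exists a.
      apply: conv_eq0 => a ac; apply: conv_eq0 => b ba.
      apply/eqP; apply: contra_notT no => /fB Bb; exists b; by rewrite ba.
    rewrite (conv_bisection _ iB fB Ba ac).
    have [[b [Bb bac]]|no] := pselect (exists b, B' b /\ grng b = gsrc a); last first.
      rewrite [X in _ * X]conv_eq0 ?mulr0; last first.
        move=> b; rewrite grng_mul ?gsrc_inv// grng_inv => bas.
        apply/eqP; apply: contra_notT no => /gB Bb; by exists b.
      apply: conv_eq0 => d dc; rewrite (conv_bisection _ iB fB Ba) ?dc//.
      have [->|/gB Bd] := eqVneq (g1 (gmul (ginv a) d)) 0; first by rewrite mulr0.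
      exfalso; apply: no; exists (gmul (ginv a) d); split => //.
      by rewrite grng_mul ?gsrc_inv ?grng_inv// ac dc.
    rewrite (conv_bisection _ iB' gB Bb); last first.
      by rewrite grng_mul ?gsrc_inv// grng_inv.
    rewrite (@conv_eq1 _ _ _ _ (gmul a b)).
    * rewrite (conv_bisection _ iB fB Ba); last by rewrite grng_mul.
      rewrite gmul_invl// ginv_mul// -mulrA -gmulA ?gsrc_inv ?grng_inv//.
    * by rewrite grng_mul.
    * move=> d + dc; rewrite (conv_bisection _ iB fB Ba) ?dc// mulf_eq0 => /norP[_ /gB Bd].
      rewrite -[d](@gmul_invr _ a) ?ac ?dc//; congr gmul.
      apply: (bisection_inj_rng bB') => //.
      by rewrite grng_mul ?gsrc_inv ?grng_inv// ac dc.
Qed.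

End ConvolutionAlgebra.

(** * The regular representation *)

Section L2Tools.
Variables (R : realType) (I : choiceType).
Local Notation C := R[i].
Local Notation l2 := (l2 R I).
Implicit Types (x y : l2) (S : {fset I}).

Lemma l2_of_bound (h : I -> C^o) (M : R) : 0 <= M -> (forall S, sq_sum h S <= M ^+ 2) ->
  exists2 y : l2, y =1 h & nrm y <= M.
Proof.
move=> M0 hM; have hP : h \in @l2pred R I by apply/asboolP; exists (M ^+ 2).
by exists (L2 hP) => //; apply: nrm_le_sq_sum.
Qed.

Lemma sq_sum_transport (h : I -> C^o) x (D : set I) (m : I -> I) (M : R) S :
  (forall c, h c != 0 -> D c) -> (forall c, D c -> nrm (h c) <= M * nrm (x (m c) : C^o)) ->
  (forall c d, D c -> D d -> m c = m d -> c = d) -> 0 <= M ->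
  sq_sum h S <= (M * nrm x) ^+ 2.
Proof.
move=> hD hM mi M0; pose s := [seq c <- S | `[< D c >]].
have -> : sq_sum h S = \sum_(c <- s) nrm (h c) ^+ 2.
  rewrite /sq_sum big_filter [RHS]big_mkcond /=; apply: eq_bigr => c _.
  case: asboolP => // nD; have -> : h c = 0.
    by apply/eqP; apply: contra_notT nD => /hD.
  by rewrite nrm0 expr0n.
apply: (@le_trans _ _ (M ^+ 2 * sq_sum x [fset d in map m s]%fset)); last first.
  by rewrite exprMn ler_wpM2l ?sqr_ge0// sq_sum_le_nrm.
have us : uniq (map m s).
  have us0 : uniq s by apply: filter_uniq; exact: fset_uniq.
  rewrite map_inj_in_uniq; [exact: us0 | move=> c d].
  by rewrite !mem_filter => /andP[/asboolP Dc _] /andP[/asboolP Dd _]; exact: mi.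
rewrite /sq_sum [X in _ <= _ * X](perm_big (map m s)) /=; last first.
  by apply: uniq_perm; [exact: fset_uniq | exact: us | move=> i; rewrite !inE].
rewrite big_map mulr_sumr big_seq [leRHS]big_seq; apply: ler_sum => c.
rewrite mem_filter => /andP[/asboolP Dc _].
by rewrite -exprMn lerXn2r ?nnegrE ?mulr_ge0 ?nrm_ge0// hM.
Qed.

Lemma l2_transport (h : I -> C^o) x (D : set I) (m : I -> I) (M : R) :
  (forall c, h c != 0 -> D c) -> (forall c, D c -> nrm (h c) <= M * nrm (x (m c) : C^o)) ->
  (forall c d, D c -> D d -> m c = m d -> c = d) -> 0 <= M ->
  exists2 y : l2, y =1 h & nrm y <= M * nrm x.
Proof.
move=> hD hM mi M0; apply: l2_of_bound => [|S]; first by rewrite mulr_ge0 ?nrm_ge0.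
exact: sq_sum_transport hD hM mi M0.
Qed.

Lemma delta_subproof (b : I) : (fun c => (c == b)%:R : C^o) \in @l2pred R I.
Proof.
apply/asboolP; exists 1 => S; rewrite /sq_sum.
have e0 c : c != b -> nrm ((c == b)%:R : C^o) ^+ 2 = 0.
  by move=> /negbTE ->; rewrite nrm0 expr0n.
have [bS|bS] := boolP (b \in S).
  rewrite (big_fsetD1 b)//= eqxx nrm1 expr1n big_seq big1 ?addr0// => c.
  by rewrite !inE => /andP[/e0].
rewrite big_seq big1// => c cS; apply: e0; by apply: contraNneq bS => <-.
Qed.

Definition delta b : l2 := L2 (delta_subproof b).

Lemma deltaE b c : delta b c = (c == b)%:R.
Proof. by []. Qed.

Lemma l2dot_delta x b : l2dot x (delta b) = x b.
Proof.
apply: l2dotE; have -> : x b = x b * ((delta b b)^*)%C.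
  by rewrite deltaE eqxx conjc1 mulr1.
by apply: has_usum1 => i /negbTE ib; rewrite deltaE ib conjc0 mulr0.
Qed.

(** [T] is additive only, with all multiples of basis vectors listed, because it is applied to a
    conjugate-linear map. It vanishes on the finite part [xS S] of [x], and [S] is chosen to leave a
    remainder of norm at most [d]. *)
Lemma l2_dense_ind (T : l2 -> C^o) (K : R) : (forall x y, T (x + y) = T x + T y) ->
  (forall (c : C) b, T (c *: delta b) = 0) -> (forall x, nrm (T x) <= K * nrm x) ->
  forall x, T x = 0.
Proof.
move=> TD Td TK x; apply: nrm_le_eps => e e0.
have T0 : T 0 = 0 by apply: (addrI (T 0)); rewrite -TD !addr0.
pose xS S : l2 := \sum_(b <- S) x b *: delta b.
have TxS S : T (xS S) = 0.
  rewrite /xS; elim/big_rec : _ => // i y _ hy; by rewrite TD Td hy addr0.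
have xSE S c : xS S c = if c \in S then x c else 0.
  have -> : xS S c = \sum_(b <- S) x b * (c == b)%:R.
    rewrite /xS; elim/big_rec2 : _ => // i y1 y2 _ <-.
    by [].
  case: ifPn => cS.
    rewrite (big_fsetD1 c)//= eqxx mulr1 big_seq big1 ?addr0// => b.
    by rewrite !inE => /andP[/negbTE bc _]; rewrite eq_sym bc mulr0.
  rewrite big_seq big1// => b bS; rewrite (_ : c == b = false) ?mulr0//.
  by apply: contraNF cS => /eqP ->.
have K1 : 0 < 1 + `|K| by rewrite ltr_pwDl.
pose d := e / (1 + `|K|); have d0 : 0 < d by rewrite divr_gt0.
have [S hS] : exists S, nrm x ^+ 2 - sq_sum x S < d ^+ 2.
  have h := l2dotP x x; have /h[S hS] : 0 < d ^+ 2 by rewrite exprn_gt0.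
  exists S; have := hS S (fsubset_refl _).
  rewrite l2dot_nrm (_ : \sum_(i <- S) _ = (sq_sum x S)%:C); last first.
    by rewrite /sq_sum rmorph_sum; apply: eq_bigr => i _; exact/esym/nrm_sqr.
  by rewrite -rmorphB nrm_real; apply: le_lt_trans; exact: ler_norm.
have hn : nrm (x - xS S) <= d.
  apply: nrm_le_sq_sum => [|U]; first exact: ltW.
  apply: le_trans (ltW hS); rewrite lerBrDr.
  apply: le_trans (sq_sum_le_nrm x (U `|` S)%fset).
  rewrite {3}/sq_sum (sum_fset_sub _ (fsubsetUr U S)) addrC lerD2l.
  rewrite /sq_sum [leRHS]big_mkcond /=.
  apply: (@le_trans _ _ (\sum_(i <- U) (if i \notin S then nrm (x i : C^o) ^+ 2 else 0))).
    apply: ler_sum => i _.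
    suff : nrm (x i - xS S i : C^o) ^+ 2 <= (if i \notin S then nrm (x i : C^o) ^+ 2 else 0) by [].
    by rewrite xSE; case: ifP => _ /=; rewrite ?subrr ?nrm0 ?expr0n ?subr0.
  apply: ler_sum_fset (fsubsetUl U S) => i.
  by case: ifP => // _; rewrite sqr_ge0.
have -> : T x = T (x - xS S) by have := TD (x - xS S) (xS S); rewrite subrK TxS addr0.
apply: le_lt_trans (TK _) _; apply: (@le_lt_trans _ _ (`|K| * d)).
  by rewrite (le_trans (ler_wpM2r (nrm_ge0 _) (ler_norm K)))// ler_wpM2l.
by rewrite /d mulrCA gtr_pMr// ltr_pdivrMr// mul1r ltrDr.
Qed.

End L2Tools.

Lemma bounded_linear_continuous (R : realType) (V W : normedModType R[i])
  (T : {linear V -> W}) (K : R) : 0 <= K ->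
  (forall x, nrm (T x) <= K * nrm x) -> continuous T.
Proof.
move=> K0 hK x; apply/cvgrPdist_lt => e e0.
have eR : e = (complex.Re e)%:C by rewrite RRe_real// gtr0_real.
have e1 : 0 < complex.Re e by rewrite -ltcR -eR.
have d0 : 0 < complex.Re e / (1 + K) by rewrite divr_gt0// ltr_pwDl.
have dC : 0 < (complex.Re e / (1 + K))%:C :> R[i] by rewrite ltcR.
have : nbhs (x : V) (ball (x : V) (complex.Re e / (1 + K))%:C) by exact: nbhsx_ballx.
apply: filterS => y; rewrite -ball_normE /=.
rewrite !nrmE eR !ltcR -linearB => h; apply: le_lt_trans (hK _) _.
rewrite mulrC; apply: (@le_lt_trans _ _ (nrm (x - y) * (1 + K))).
  by rewrite ler_wpM2l ?nrm_ge0// lerDr.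
by rewrite -ltr_pdivlMr// ltr_pwDl.
Qed.

Lemma opnorm_bound (R : realType) (K : hilbertSpace R) (T : {linear K -> K}) (M : R) : 0 <= M ->
  (forall x, nrm (T x) <= M * nrm x) -> opnorm T <= M.
Proof.
move=> M0 hM; apply: ge_sup.
  by exists (nrm (T 0)); exists 0 => //=; rewrite nrm0 ler01.
move=> _ [x /= x1 <-]; rewrite (le_trans (hM x))// ler_piMr//.
Qed.

(** [opnorm] is a real supremum, meaningful for bounded sets; the a priori bound [M] guarantees
    this. *)
Lemma nrm_le_opnorm (R : realType) (K : hilbertSpace R) (T : {linear K -> K}) (M : R) :
  (forall x, nrm (T x) <= M * nrm x) -> forall x, nrm (T x) <= opnorm T * nrm x.
Proof.
move=> hM x; have [x0|x0] := eqVneq (nrm x) 0.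
  by rewrite (nrm_eq0 x0) linear0 !nrm0 mulr0.
have xp : 0 < nrm x by rewrite lt_def x0 nrm_ge0.
pose u := (nrm x)^-1%:C *: x.
have u1 : nrm u = 1 by rewrite nrm_Zreal ger0_norm ?invr_ge0 ?(ltW xp)// mulVf.
have -> : T x = (nrm x)%:C *: T u by rewrite -linearZ scalerA -rmorphM mulfV// scale1r.
rewrite nrm_Zreal ger0_norm ?(ltW xp)// mulrC ler_wpM2r ?(ltW xp)//.
apply: sup_upper_bound; last by exists u => //=; rewrite u1.
split; first by exists (nrm (T u)), u => //=; rewrite u1.
exists `|M| => _ [z /= z1 <-]; rewrite (le_trans (hM z))//.
by rewrite (le_trans (ler_wpM2r (nrm_ge0 _) (ler_norm M)))// ler_piMr.
Qed.

Section RegularRepresentation.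
Variables (R : realType) (G : topGroupoidType).
Local Notation C := R[i].
Local Notation l2 := (l2 R G).
Hypothesis Ghaus : hausdorff_space G.
Hypothesis Glc : locally_compact [set: G].
Hypothesis Get : etale G.
Implicit Types (U V H K B : set G) (f g : G -> C^o) (x y : l2).

Lemma Cc_nz B f b : Cc B f -> f b != 0 -> B b.
Proof. by move=> hB h; apply: contrapT => /(Cc_off hB) e; rewrite e eqxx in h. Qed.

Let sT := open_subgroupoidT G.

(** On a bisection the operator takes [x] to [c -> f(b) x(b^-1 c)]. The map [c -> b^-1 c] is
    injective: its value has range [gsrc b], which determines [b] and then [c]. So a bound for [f]
    bounds the operator. *)
Lemma conv_l2 f : Cc [set: G] f -> exists2 K : R, 0 <= K &
  forall x, exists2 y : l2, y =1 conv f x & nrm y <= K * nrm x.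
Proof.
move=> hf; apply: (Cc_ind (Z := set0) (P := fun f => exists2 K : R, 0 <= K &
  forall x, exists2 y : l2, y =1 conv f x & nrm y <= K * nrm x)
  Ghaus Glc Get openT _ _ _ hf) => //.
- by exists 0 => // x; exists 0; rewrite ?nrm0 ?mul0r// conv0l.
- move=> f1 f2 h1 h2 [K1 K10 hK1] [K2 K20 hK2]; exists (K1 + K2); first exact: addr_ge0.
  move=> x; have [y1 e1 n1] := hK1 x; have [y2 e2 n2] := hK2 x.
  exists (y1 + y2).
    move=> c; rewrite convDl; [|exact: (fibreP Ghaus Glc Get _ openT)..].
    by rewrite -e1 -e2.
  by rewrite (le_trans (nrm_triangle _ _))// mulrDl lerD.
- move=> B f1 bB _ hB _; have [M [M0 hM]] := Cc_bounded hB.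
  have [_ _ iB] := bB; exists M => // x.
  apply: (@l2_transport _ _ _ _ (@grng G @^-1` (@grng G @` B))
    (fun c => gmul (ginv (section_of B (grng c))) c)) => //.
  + move=> c; apply: contra_neqP => nc; apply: conv_eq0 => a ac.
    apply/eqP; apply: contra_notT nc => /(Cc_nz hB) Ba; by exists a.
  + move=> c Vc; have [Bs rs] := section_ofP Vc.
    rewrite (conv_bisection _ iB _ Bs)//; last by move=> ?; exact: (Cc_nz hB).
    by rewrite nrm_mul ler_wpM2r ?nrm_ge0.
  + move=> c d Vc Vd; have [Bs rs] := section_ofP Vc; have [Bs' rs'] := section_ofP Vd.
    move=> e; have : section_of B (grng c) = section_of B (grng d).
      apply: (bisection_inj_src bB) => //.
      have := congr1 (@grng G) e.
      by rewrite !grng_mul ?gsrc_inv ?grng_inv ?rs ?rs'.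
    move=> se; rewrite -[c](@gmul_invr _ (section_of B (grng c)) c rs) e se.
    by rewrite (gmul_invr rs').
Qed.

(** The direct sum of the regular representations on the source fibres, which left multiplication
    preserves. The default 0 makes [lam f] a linear operator for every [f], as the type of
    [star_rep] demands. *)
Definition lam_fun f x : l2 :=
  if `[< Cc [set: G] f >] then xget 0 [set y : l2 | y =1 conv f x] else 0.

Lemma lam_funE f x : Cc [set: G] f -> lam_fun f x =1 conv f x.
Proof.
move=> hf; rewrite /lam_fun asboolT//; have [K _ /(_ x)[y hy _]] := conv_l2 hf.
by case: xgetP => [z _ //|/(_ y)].
Qed.

Lemma lam_fun_linear f : linear (lam_fun f).
Proof.
move=> c x y; have [hf|nf] := pselect (Cc [set: G] f); last first.
  by rewrite /lam_fun asboolF// scaler0 addr0.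
apply: l2_ext => a.
rewrite lam_funE// (_ : l2fun (c *: x + y) = c *: (x : G -> C^o) + (y : G -> C^o))//.
rewrite convDr; last exact: (fibreP Ghaus Glc Get _ openT).
by rewrite convZr -!lam_funE.
Qed.

Definition lam f : {linear l2 -> l2} :=
  HB.pack (lam_fun f) (GRing.isLinear.Build C l2 l2 _ (lam_fun f) (lam_fun_linear f)).

Lemma lamE f x : Cc [set: G] f -> lam f x =1 conv f x.
Proof. exact: lam_funE. Qed.

Lemma lam_bounded f : Cc [set: G] f -> exists2 K : R, 0 <= K &
  forall x, nrm (lam f x) <= K * nrm x.
Proof.
move=> hf; have [K K0 hK] := conv_l2 hf; exists K => // x.
have [y hy ny] := hK x; rewrite (_ : lam f x = y)//.
by apply: l2_ext => c; rewrite lamE.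
Qed.

Lemma lam_linear (c : C) f g x : Cc [set: G] f -> Cc [set: G] g ->
  lam (c *: f + g) x = c *: lam f x + lam g x.
Proof.
move=> hf hg; apply: l2_ext => a.
rewrite lamE; last by apply: CcD => //; exact: CcZ.
rewrite convDl; [|exact: (fibreP Ghaus Glc Get _ openT (CcZ Ghaus _ _))
                 |exact: (fibreP Ghaus Glc Get _ openT)].
by rewrite convZl -!lamE.
Qed.

Lemma lam_conv f g x : Cc [set: G] f -> Cc [set: G] g ->
  lam (conv f g) x = lam f (lam g x).
Proof.
move=> hf hg; apply: l2_ext => a.
rewrite lamE; last exact: Cc_conv.
rewrite (conv_assoc Ghaus Glc Get _ sT)// lamE//; congr (conv f _ a).
by apply/funext => c; rewrite lamE.
Qed.

Lemma l2dot0r x : l2dot x 0 = 0.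
Proof. by have := l2dotZr 0 0 x; rewrite scale0r conjc0 mul0r. Qed.

Lemma fstarD f g : fstar (f + g) = fstar f + fstar g.
Proof. by apply/funext => c; rewrite /fstar; exact: conjcD. Qed.

(** On a bisection, [lam f] takes the basis vector at [b] to [f a] times the one at [a b], where [a]
    is the arrow with source [grng b]; if there is none, both sides vanish. *)
Lemma lam_fstar_delta f x b : Cc [set: G] f ->
  lam (fstar f) x b = l2dot x (lam f (delta R b)).
Proof.
move=> hf; apply: (Cc_ind (Z := set0) (P := fun f =>
  lam (fstar f) x b = l2dot x (lam f (delta R b))) Ghaus Glc Get openT _ _ _ hf) => //.
- have Z0 := Cc0 R Ghaus [set: G].
  have -> : fstar 0 = 0 :> (G -> C^o) by apply/funext => c; exact: conjc0.
  have -> : lam 0 (delta R b) = 0 by apply: l2_ext => c; rewrite lamE// conv0l.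
  have -> : lam 0 x = 0 by apply: l2_ext => c; rewrite lamE// conv0l.
  by rewrite l2dot0r.
- move=> f1 f2 h1 h2 e1 e2; rewrite fstarD.
  have D k1 k2 z : Cc [set: G] k1 -> Cc [set: G] k2 -> lam (k1 + k2) z = lam k1 z + lam k2 z.
    by move=> c1 c2; have := lam_linear 1 z c1 c2; rewrite !scale1r.
  by rewrite !D ?l2dotDr -?e1 -?e2//; exact: Cc_fstar.
- move=> B f1 bB _ hB _; have [_ _ iB] := bB.
  have hT : Cc [set: G] f1 by exact: Cc_sub hB.
  have [_ _ iB'] := bisection_inv bB.
  have sB' c : fstar f1 c != 0 -> (@ginv G @^-1` B) c.
    by rewrite /fstar conjc_eq0 => /(Cc_nz hB).
  have [[a [Ba ab]]|no] := pselect (exists a, B a /\ gsrc a = grng b).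
    have -> : lam f1 (delta R b) = f1 a *: delta R (gmul a b).
      apply: l2_ext => c; rewrite lamE//.
      transitivity ((f1 a : C) * (c == gmul a b)%:R); last by [].
      have [[d [Bd dc]]|nd] := pselect (exists d, B d /\ grng d = grng c); last first.
        rewrite conv_eq0; last first.
          by move=> d dc; apply/eqP; apply: contra_notT nd => /(Cc_nz hB) Bd; exists d.
        rewrite (_ : (c == gmul a b) = false) ?mulr0n ?mulr0//; apply/eqP => cab; apply: nd.
        by exists a; rewrite cab grng_mul.
      rewrite (conv_bisection _ iB _ Bd dc); last by move=> ?; exact: (Cc_nz hB).
      rewrite deltaE; have [e|ne] := eqVneq (gmul (ginv d) c) b.
        have da : d = a.
          apply: (bisection_inj_src bB) => //.
          by rewrite ab -e grng_mul ?gsrc_inv ?grng_inv.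
        by rewrite -da -e gmul_invr ?eqxx.
      rewrite mulr0n mulr0 (_ : (c == gmul a b) = false) ?mulr0n ?mulr0//; apply/eqP => cab.
      move/eqP: ne; apply; have -> : d = a.
        by apply: (bisection_inj_rng bB) => //; rewrite dc cab grng_mul.
      by rewrite cab gmul_invl.
    rewrite l2dotZr l2dot_delta lamE; last exact: Cc_fstar.
    rewrite (@conv_bisection _ _ _ _ _ (ginv a) b iB')//.
    + by rewrite /fstar ginvK.
    + by rewrite /= ginvK.
    + by rewrite grng_inv.
  have -> : lam f1 (delta R b) = 0.
    apply: l2_ext => c; rewrite lamE//.
    have [[d [Bd dc]]|nd] := pselect (exists d, B d /\ grng d = grng c); last first.
      apply: conv_eq0 => d dc.
      by apply/eqP; apply: contra_notT nd => /(Cc_nz hB) Bd; exists d.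
    rewrite (conv_bisection _ iB _ Bd dc); last by move=> ?; exact: (Cc_nz hB).
    rewrite deltaE (_ : (gmul (ginv d) c == b) = false) ?mulr0n ?mulr0//; apply/eqP => e; apply: no.
    by exists d; rewrite -e grng_mul ?gsrc_inv ?grng_inv.
  rewrite lamE; last exact: Cc_fstar.
  rewrite l2dot0r conv_eq0// => a ab.
  apply/eqP; apply: contra_notT no => /sB' Ba; exists (ginv a).
  by rewrite gsrc_inv.
Qed.

Lemma l2dot_nrm_le x y : nrm (l2dot x y : C^o) <= nrm x * nrm y.
Proof. exact: (dot_cauchy_schwarz (l2form R G)). Qed.

Lemma lam_adjoint f x y : Cc [set: G] f ->
  l2dot (lam (fstar f) x) y = l2dot x (lam f y).
Proof.
move=> hf; have hs : Cc [set: G] (fstar f) by exact: Cc_fstar.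
have [K K0 hK] := lam_bounded hf; have [L L0 hL] := lam_bounded hs.
apply/eqP; rewrite -subr_eq0; apply/eqP.
apply: (@l2_dense_ind _ _ (fun y => l2dot (lam (fstar f) x) y - l2dot x (lam f y))
  (nrm (lam (fstar f) x) + nrm x * K)).
- by move=> y1 y2; rewrite linearD !l2dotDr opprD addrACA.
- by move=> c b; rewrite linearZ !l2dotZr l2dot_delta -lam_fstar_delta// subrr.
- move=> z; rewrite (le_trans (nrm_triangle (V := C^o) _ _))// nrmN mulrDl.
  rewrite lerD ?l2dot_nrm_le// (le_trans (l2dot_nrm_le _ _))// -mulrA.
  by rewrite ler_wpM2l ?nrm_ge0.
Qed.

Lemma lam_star_rep H : star_rep H (K := l2hilbert R G) lam.
Proof.
have HT f : Cc H f -> Cc [set: G] f by exact: Cc_sub.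
split.
- move=> f /HT hf; have [K K0 hK] := lam_bounded hf.
  exact: (bounded_linear_continuous K0 hK).
- by move=> c f g x /HT hf /HT hg; exact: lam_linear.
- by move=> f g x /HT hf /HT hg; exact: lam_conv.
- by move=> f x y /HT hf; exact: lam_adjoint.
Qed.

Lemma nrm_lam_le H (A : fullCstar R H) f x : Cc H f ->
  nrm (lam f x) <= nrm (femb A f) * nrm x.
Proof.
move=> hf; have hT : Cc [set: G] f by exact: Cc_sub hf.
have [K K0 hK] := lam_bounded hT.
have h := @nrm_le_opnorm R (l2hilbert R G) (lam f) K hK x; apply: (le_trans h).
rewrite ler_wpM2r ?nrm_ge0// -lee_fin femb_norm//.
apply: ereal_sup_ubound; exists (l2hilbert R G), lam; split => //.
exact: lam_star_rep.
Qed.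

End RegularRepresentation.

(** * The conditional expectation and the reduced algebra *)

Section DenseExtension.
Variable R : realType.
Local Notation C := R[i].

Lemma tends_ext (V : normedModType C) (u w : nat -> V) a : (forall n, u n = w n) ->
  tends u a -> tends w a.
Proof. by move=> /funext->. Qed.

Lemma tends_nrm_lip (V : normedModType C) (T : V -> C^o) (M : R) (u : nat -> V) a :
  (forall x y, nrm (T x - T y) <= M * nrm (x - y)) -> tends u a ->
  tends (fun n => T (u n)) (T a).
Proof.
move=> hT hu e e0; have M1 : 0 < 1 + `|M| by rewrite ltr_pwDl.
have [N hN] := hu _ (divr_gt0 e0 M1); exists N => n /hN.
rewrite ltr_pdivlMr//; apply: le_lt_trans; apply: le_trans (hT _ _) _.
rewrite mulrC ler_wpM2l ?nrm_ge0// (le_trans (ler_norm M))// lerDr.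
by [].
Qed.

Lemma nrm_dist_nrm (V : normedModType C) (x y : V) : `|nrm x - nrm y| <= nrm (x - y).
Proof.
rewrite ler_norml lerBrDr lerBlDr; apply/andP; split.
  rewrite addrC lerBlDr addrC nrmBC -[X in nrm X <= _](subrK x y).
  by rewrite (le_trans (nrm_triangle _ _))// addrC.
by rewrite -[X in nrm X <= _](subrK y x) (le_trans (nrm_triangle _ _)).
Qed.

Lemma tends_ge0 (u : nat -> C^o) (c : C^o) : (forall n, 0 <= (u n : C)) -> tends u c ->
  0 <= (c : C).
Proof.
move=> u0 hu; suff -> : c = (nrm c)%:C by rewrite ler0c nrm_ge0.
apply: (tends_unique hu) => e /hu[N hN]; exists N => n /hN.
have e1 : u n = (nrm (u n))%:C by rewrite -nrmE ger0_norm.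
by apply: le_lt_trans; rewrite {1}e1 -rmorphB nrm_real; exact: nrm_dist_nrm.
Qed.

(** The value [c] at [a] is specified by [nrm (c - T x) <= M * nrm (a - i x)] for all [x] in [D]. A
    limit along one approximating sequence satisfies this, and both conclusions follow from it. *)
Lemma dense_extension (V : normedModType C) (X : Type) (D : set X) (i : X -> V)
  (T : X -> C^o) (M : R) : 0 <= M ->
  (forall a e, 0 < e -> exists2 x, D x & nrm (a - i x) < e) ->
  (forall x y, D x -> D y -> nrm (T x - T y) <= M * nrm (i x - i y)) ->
  exists F : V -> C^o, (forall x, D x -> F (i x) = T x) /\
    forall a b, nrm (F a - F b) <= M * nrm (a - b).
Proof.
move=> M0 hd hT.
have hex a : exists c : C^o, forall x, D x -> nrm (c - T x) <= M * nrm (a - i x).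
  have hs n : exists x, D x /\ nrm (a - i x) < n.+1%:R^-1.
    by have [|x Dx hx] := hd a n.+1%:R^-1; [rewrite invr_gt0 ltr0n | exists x].
  pose s n := projT1 (cid (hs n)).
  have [Ds hs'] : (forall n, D (s n)) /\ (forall n, nrm (a - i (s n)) < n.+1%:R^-1).
    by split=> n; rewrite /s; case: cid => x [].
  have ts : tends (fun n => i (s n)) a.
    move=> e e0; exists (Num.bound e^-1) => n Nn; apply: lt_trans (hs' n) _.
    rewrite invf_plt ?posrE//; apply: lt_le_trans (archi_boundP _) _.
      by rewrite invr_ge0 ltW.
    by rewrite ler_nat ltnW.
  have [|c hc] := @cauchy_complex_cvg R (fun n => T (s n)).
    move=> e e0; have M1 : 0 < 1 + M by rewrite ltr_pwDl.
    have [N hN] := ts (e / (1 + M) / 2) (divr_gt0 (divr_gt0 e0 M1) (ltr0n _ 2)).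
    exists N => m n /hN hm /hN hn; apply: le_lt_trans (hT _ _ (Ds m) (Ds n)) _.
    have h : nrm (i (s m) - i (s n)) < e / (1 + M).
      rewrite (le_lt_trans (nrm_dist_triangle _ a _))// (splitr (e / (1 + M))) ltrD//.
      by rewrite nrmBC.
    move: h; rewrite ltr_pdivlMr//; apply: le_lt_trans.
    by rewrite mulrC ler_wpM2l ?nrm_ge0// lerDr.
  exists c => x Dx; apply/ler_addgt0Pr => e e0.
  have M1 : 0 < 1 + M by rewrite ltr_pwDl.
  have [N1 h1] := hc (e / 2) (divr_gt0 e0 (ltr0n _ 2)).
  have [N2 h2] := ts (e / 2 / (1 + M)) (divr_gt0 (divr_gt0 e0 (ltr0n _ 2)) M1).
  pose n := maxn N1 N2.
  have hn1 := h1 n (leq_maxl _ _); have hn2 := h2 n (leq_maxr _ _).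
  rewrite (le_trans (nrm_dist_triangle _ (T (s n)) _))//.
  have : nrm (T (s n) - T x) <= M * nrm (a - i x) + e / 2.
    apply: le_trans (hT _ _ (Ds n) Dx) _.
    apply: (@le_trans _ _ (M * (nrm (i (s n) - a) + nrm (a - i x)))).
      by rewrite ler_wpM2l// nrm_dist_triangle.
    rewrite mulrDr addrC lerD2l nrmBC.
    move: hn2; rewrite ltr_pdivlMr// => /ltW; apply: le_trans.
    by rewrite mulrC ler_wpM2l ?nrm_ge0// lerDr.
  move=> h; have := lerD (ltW hn1) h; rewrite addrCA -splitr//.
pose F a := projT1 (cid (hex a)).
have FP a x : D x -> nrm (F a - T x) <= M * nrm (a - i x) by rewrite /F; case: cid => c; exact.
exists F; split.
  move=> x Dx; apply/eqP; rewrite -subr_eq0; apply/eqP/nrm_eq0/eqP.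
  by rewrite eq_le nrm_ge0 andbT (le_trans (FP _ _ Dx))// subrr nrm0 mulr0.
move=> a b; apply/ler_addgt0Pr => e e0.
have M1 : 0 < 1 + 2 * M by rewrite ltr_pwDl// mulr_ge0.
have [x Dx hx] := hd b (e / (1 + 2 * M)) (divr_gt0 e0 M1).
rewrite (le_trans (nrm_dist_triangle _ (T x) _))//.
have h1 := FP a x Dx; have h2 := FP b x Dx; rewrite nrmBC in h2.
apply: le_trans (lerD h1 h2) _.
have h3 : nrm (a - i x) <= nrm (a - b) + nrm (b - i x) by exact: nrm_dist_triangle.
move: hx; rewrite ltr_pdivlMr// => hx.
have := ler_wpM2l M0 h3; have := nrm_ge0 (b - i x); nra.
Qed.

End DenseExtension.

Section ConditionalExpectation.
Variables (R : realType) (G : topGroupoidType).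
Local Notation C := R[i].
Hypothesis Ghaus : hausdorff_space G.
Hypothesis Glc : locally_compact [set: G].
Hypothesis Get : etale G.
Variable H : set G.
Hypothesis sH : open_subgroupoid H.
Implicit Types (f g x y : G -> C^o) (v : G).

Local Notation lam := (lam Ghaus Glc Get).
Local Notation delta := (delta R).

Let oH : open H. Proof. by case: sH. Qed.

Lemma CcT f : Cc H f -> Cc [set: G] f.
Proof. exact: Cc_sub. Qed.

(** Evaluation at a unit is a diagonal coefficient of [lam], hence contractive for the full norm;
    this is what makes the conditional expectation exist. *)
Lemma lam_delta f v : Cc [set: G] f -> units v -> lam f (delta v) v = f v.
Proof.
move=> hf uv; rewrite lamE// (@conv_restrict _ _ _ _ _ [set (v, v)]).
  rewrite (_ : _ `&` _ = [set (v, v)]) ?fsbig_set1 ?deltaE ?eqxx ?mulr1//.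
  apply/seteqP; split => [p []//|_ ->]; split => //=.
  by split; [rewrite unit_rng | rewrite -{2}(unit_src uv) gmul_src].
move=> [p q] /= pq pqv np; have [qv|/eqP/negbTE qv] := pselect (q = v).
  exfalso; apply: np; rewrite qv; congr (_, _).
  by rewrite -[p]gmul_src pq qv unit_rng// -[X in gmul p X]qv.
by rewrite /= qv mulr0n mulr0.
Qed.

Lemma nrm_delta v : nrm (delta v) = 1.
Proof.
apply/eqP; rewrite -(@eqrXn2 _ 2) ?nrm_ge0// expr1n; apply/eqP/complexI.
by rewrite -l2dot_nrm l2dot_delta deltaE eqxx.
Qed.

Section Full.
Variable A : fullCstar R H.
Implicit Types a b c : A.

Lemma femb0 : femb A 0 = 0.
Proof.
have h := Cc0 R Ghaus H.
have := femb_linear A 1 h h; rewrite !scale1r addr0 => /eqP.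
by rewrite eq_sym -subr_eq0 addrK => /eqP.
Qed.

Lemma fembD f g : Cc H f -> Cc H g -> femb A (f + g) = femb A f + femb A g.
Proof. by move=> hf hg; have := femb_linear A 1 hf hg; rewrite !scale1r. Qed.

Lemma fembZ (c : C) f : Cc H f -> femb A (c *: f) = c *: femb A f.
Proof.
by move=> hf; have := femb_linear A c hf (Cc0 R Ghaus H); rewrite !addr0 femb0 addr0.
Qed.

Lemma fembB f g : Cc H f -> Cc H g -> femb A (f - g) = femb A f - femb A g.
Proof.
move=> hf hg; rewrite fembD//; last exact: CcN.
by rewrite -scaleN1r fembZ// scaleN1r.
Qed.

Lemma femb_approx a (e : R) : 0 < e -> exists2 f, Cc H f & nrm (a - femb A f) < e.
Proof.
move=> e0; have eC : 0 < e%:C :> C by rewrite ltcR.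
have D : dense (@femb R G H A @` @Cc R G H) by exact: femb_dense.
have [|a' [/= hb [f hf fa]]] := D (ball a e%:C) _ (ball_open a _).
  by exists a; exact: ballxx.
exists f => //; move: hb; rewrite -fa -ball_normE /= nrmE ltcR.
exact.
Qed.

Lemma nrm_eval_le f v : Cc H f -> units v -> nrm (f v) <= nrm (femb A f).
Proof.
move=> hf uv; rewrite -lam_delta//; last exact: CcT.
apply: le_trans (nrm_coord_le _ _) _.
by have := nrm_lam_le Ghaus Glc Get A (delta v) hf; rewrite nrm_delta mulr1.
Qed.

Lemma cond_exp_ex : exists F : A -> G -> C^o,
  [/\ forall f v, Cc H f -> units v -> F (femb A f) v = f v,
      forall a b v, units v -> nrm (F a v - F b v) <= nrm (a - b) &
      forall a v, ~ units v -> F a v = 0].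
Proof.
have hex v : exists F : A -> C^o, units v -> (forall f, Cc H f -> F (femb A f) = f v) /\
    forall a b, nrm (F a - F b) <= nrm (a - b).
  have [uv|nv] := pselect (units v); last by exists (fun=> 0).
  have [||F [F1 F2]] := @dense_extension R A _ (Cc H) (femb A) (fun f => f v) 1 ler01.
  - by move=> a e /femb_approx.
  - by move=> f g hf hg; rewrite mul1r -fembB//; apply: nrm_eval_le => //; exact: CcB.
  by exists F => _; split=> // a b; rewrite -[leRHS]mul1r.
exists (fun a v => if `[< units v >] then projT1 (cid (hex v)) a else 0); split.
- by move=> f v hf uv; rewrite asboolT//; case: cid => F /= /(_ uv)[->].
- by move=> a b v uv; rewrite asboolT//; case: cid => F /= /(_ uv)[].
- by move=> a v nv; rewrite asboolF.
Qed.

(** [cond_exp] is a choice under a condition. The contractive extension [F] meets the condition, and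
    any solution is within every [e] of [F], so the choice is [F]. *)
Lemma cond_expP : [/\ forall f v, Cc H f -> units v -> cond_exp (femb A f) v = f v,
      forall a b v, units v -> nrm (cond_exp a v - cond_exp b v) <= nrm (a - b) &
      forall a v, ~ units v -> cond_exp a v = 0].
Proof.
have [F [F1 F2 F3]] := cond_exp_ex.
suff -> : (@cond_exp R G H A) = F by [].
apply/funext => a; rewrite /cond_exp; apply: xget_unique.
  split; first exact: F3.
  move=> e e0; have [f hf h] := femb_approx a e0; exists f => //; split => // u uu.
  by rewrite -(F1 f u)//; apply: le_lt_trans h; exact: F2.
move=> g [g0 gP]; apply/funext => u; have [uu|nu] := pselect (units u); last first.
  by rewrite g0// F3.
apply/eqP; rewrite -subr_eq0; apply/eqP/nrm_le_eps => e e0.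
have [f hf [h1 h2]] := gP (e / 2) (divr_gt0 e0 (ltr0n _ 2)).
rewrite (le_lt_trans (nrm_dist_triangle _ (f u) _))// (splitr e) ltrD ?h2//.
by rewrite -(F1 f u)// nrmBC; apply: le_lt_trans h1; exact: F2.
Qed.

Lemma cond_exp_femb f v : Cc H f -> units v -> cond_exp (femb A f) v = f v.
Proof. by have [h _ _] := cond_expP; exact: h. Qed.

Lemma tends_cond_exp v (u : nat -> A) a : units v -> tends u a ->
  tends (fun n => cond_exp (u n) v) (cond_exp a v).
Proof.
move=> uv; apply: (@tends_nrm_lip _ _ (fun a => cond_exp a v) 1) => b c.
by rewrite mul1r; have [_ h _] := cond_expP; exact: h.
Qed.

Lemma femb_seq a : exists2 f : nat -> (G -> C^o), (forall n, Cc H (f n)) &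
  tends (fun n => femb A (f n)) a.
Proof.
have hs n : exists x, Cc H x /\ nrm (a - femb A x) < n.+1%:R^-1.
  have [|x Dx hx] := @femb_approx a n.+1%:R^-1; [by rewrite invr_gt0 ltr0n | by exists x].
exists (fun n => projT1 (cid (hs n))) => [n|e e0]; first by case: cid => x [].
exists (Num.bound e^-1) => n Nn; case: cid => x [_ /= hx]; apply: lt_trans hx _.
rewrite invf_plt ?posrE//; apply: lt_le_trans (archi_boundP _) _.
  by rewrite invr_ge0 ltW.
by rewrite ler_nat ltnW.
Qed.

Lemma cond_expD a b v : units v -> cond_exp (a + b) v = cond_exp a v + cond_exp b v.
Proof.
move=> uv; have [f hf fa] := femb_seq a; have [g hg gb] := femb_seq b.
have h1 := tends_cond_exp uv (tendsD fa gb).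
have h2 := tendsD (tends_cond_exp uv fa) (tends_cond_exp uv gb).
apply: tends_unique h1 _; apply: tends_ext h2 => n.
rewrite -fembD// !cond_exp_femb//; exact: CcD.
Qed.

Lemma cond_expZ (c : C) a v : units v -> cond_exp (c *: a) v = c * cond_exp a v.
Proof.
move=> uv; have [f hf fa] := femb_seq a.
have h1 := tends_cond_exp uv (tendsZ c fa).
have h2 := tendsZ c (tends_cond_exp uv fa).
apply: tends_unique h1 _; apply: tends_ext h2 => n.
rewrite -fembZ// !cond_exp_femb//; exact: CcZ.
Qed.

(** The link between the definition of [K_E] and operators: sandwiched expectations are coefficients
    of [lam]. *)
Lemma eval_sandwich f x y v : Cc H f -> Cc H x -> Cc H y -> units v ->
  cond_exp (cmul (cmul (cstar (femb A x)) (femb A f)) (femb A y)) v =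
  l2dot (lam f (lam y (delta v))) (lam x (delta v)).
Proof.
move=> hf hx hy uv; have hs := Cc_fstar Ghaus sH hx.
have h1 := Cc_conv Ghaus Glc Get sH hs hf.
rewrite -femb_star// -femb_conv// -femb_conv// cond_exp_femb//; last exact: Cc_conv.
rewrite -lam_delta//; last exact/CcT/Cc_conv.
rewrite lam_conv; [|exact: CcT..].
rewrite lam_conv; [|exact: CcT..].
by rewrite -(l2dot_delta (lam _ _)) lam_adjoint//; exact: CcT.
Qed.

(** By density, from [eval_sandwich]. General [a] are required because it will be applied to a
    function perturbed by an element of [K_E], which need not come from [Cc H]. *)
Lemma nrm_cond_exp_sandwich a x y v : Cc H x -> Cc H y -> units v ->
  nrm (cond_exp (cmul (cmul (cstar (femb A x)) a) (femb A y)) v) <=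
  nrm a * (nrm (lam y (delta v)) * nrm (lam x (delta v))).
Proof.
move=> hx hy uv; have [f hf fa] := femb_seq a.
have h := tends_cond_exp uv (tends_cmul (tends_cmul (tends_cst (cstar (femb A x))) fa)
  (tends_cst (femb A y))).
apply/ler_addgt0Pr => e e0; set K := nrm (lam y _) * _.
have K0 : 0 <= K by rewrite mulr_ge0 ?nrm_ge0.
have K1 : 0 < 1 + K by rewrite ltr_pwDl.
have [N1 h1] := h (e / 2) (divr_gt0 e0 (ltr0n _ 2)).
have [N2 h2] := fa (e / 2 / (1 + K)) (divr_gt0 (divr_gt0 e0 (ltr0n _ 2)) K1).
have := h1 (maxn N1 N2) (leq_maxl _ _); have := h2 (maxn N1 N2) (leq_maxr _ _).
set n := maxn _ _ => H2 H1.
rewrite -[X in nrm X](subrK (cond_exp (cmul (cmul (cstar (femb A x)) (femb A (f n))) (femb A y)) v)).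
rewrite (le_trans (nrm_triangle _ _))// addrC (splitr e) addrA lerD ?(ltW H1)//.
rewrite eval_sandwich// (le_trans (l2dot_nrm_le _ _))//.
apply: (@le_trans _ _ (nrm (femb A (f n)) * K)).
  by rewrite /K mulrA ler_wpM2r ?nrm_ge0// nrm_lam_le.
have h3 : nrm (femb A (f n)) <= nrm a + e / 2 / (1 + K).
  rewrite -[femb A (f n)](subrK a) (le_trans (nrm_triangle _ _))// addrC lerD2l.
  by rewrite nrmBC ltW.
apply: le_trans (ler_wpM2r K0 h3) _; rewrite mulrDl lerD2l.
by rewrite mulrAC ler_pdivrMr// ler_wpM2l ?divr_ge0 ?(ltW e0)// lerDr.
Qed.

Lemma cond_exp_ge0 a v : units v -> 0 <= (cond_exp (cmul (cstar a) a) v : C).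
Proof.
move=> uv; have [f hf fa] := femb_seq a.
have h := tends_cond_exp uv (tends_cmul (tends_cstar fa) fa).
apply: tends_ge0 h => n.
have hs := Cc_fstar Ghaus sH (hf n).
rewrite -femb_star// -femb_conv// cond_exp_femb//; last exact: Cc_conv.
rewrite -lam_delta//; last exact/CcT/Cc_conv.
rewrite lam_conv; [|exact: CcT..].
rewrite -(l2dot_delta (lam _ _)) lam_adjoint//; last exact: CcT.
by rewrite l2dot_nrm ler0c sqr_ge0.
Qed.

End Full.

Section Reduced.
Variable B : redCstar R H.
Local Notation A := (rfull B).
Local Notation q := (rquo (r := B)).
Implicit Types a b : A.

Lemma rquo_linear (c : C) a b : q (c *: a + b) = c *: q a + q b.
Proof. by have [h _ _ _ _] := rquoP B; exact: h. Qed.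

Lemma rquo0 : q 0 = 0.
Proof.
have := rquo_linear 1 0 0; rewrite !scale1r addr0 => /eqP.
by rewrite eq_sym -subr_eq0 addrK => /eqP.
Qed.

Lemma rquoD a b : q (a + b) = q a + q b.
Proof. by have := rquo_linear 1 a b; rewrite !scale1r. Qed.

Lemma rquoZ (c : C) a : q (c *: a) = c *: q a.
Proof. by have := rquo_linear c a 0; rewrite !addr0 rquo0 addr0. Qed.

Lemma rquoN a : q (- a) = - q a.
Proof. by rewrite -scaleN1r rquoZ scaleN1r. Qed.

Lemma rquoB a b : q (a - b) = q a - q b.
Proof. by rewrite rquoD rquoN. Qed.

Lemma rquoM a b : q (cmul a b) = cmul (q a) (q b).
Proof. by have [_ h _ _ _] := rquoP B; exact: h. Qed.

Lemma rquo_star a : q (cstar a) = cstar (q a).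
Proof. by have [_ _ h _ _] := rquoP B; exact: h. Qed.

Lemma rquo_surj (b : B) : exists a, q a = b.
Proof. by have [_ _ _ h _] := rquoP B; have [a _ <-] := h b I; exists a. Qed.

Lemma rquo_eq0 a : q a = 0 <-> K_E a.
Proof. by have [_ _ _ _ [h _]] := rquoP B; exact: h. Qed.

Lemma K_E_cond_exp a v : K_E a -> forall x y : A, cond_exp (cmul (cmul x a) y) v = 0.
Proof. by move=> h x y; rewrite h. Qed.

Lemma nrm_rquo_lt a (e : R) : nrm (q a) < e -> exists2 k, K_E k & nrm (a + k) < e.
Proof.
have [_ _ _ _ [_ ->]] := rquoP B; rewrite /quotient_norm => h.
have hi : has_inf [set nrm (a + k) | k in @K_E R G H A].
  split; last by exists 0 => _ [k _ <-]; exact: nrm_ge0.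
  by exists (nrm (a + 0)), 0 => //; apply/rquo_eq0; exact: rquo0.
have [|_ [k Kk <-] hk] := inf_adherent _ hi (eps := e - inf [set nrm (a + k) | k in @K_E R G H A]).
  by rewrite subr_gt0.
by exists k => //; rewrite subrKC in hk.
Qed.

Lemma nrm_rquo_le a : nrm (q a) <= nrm a.
Proof.
have [_ _ _ _ [_ ->]] := rquoP B; rewrite /quotient_norm.
apply: inf_lbound.
  by exists 0 => _ [k _ <-]; exact: nrm_ge0.
by exists 0; [apply/rquo_eq0; exact: rquo0 | rewrite addr0].
Qed.

End Reduced.
End ConditionalExpectation.

(** * The full norm of functions on the units *)

Section UnitsContractive.
Variables (R : realType) (G : topGroupoidType).
Local Notation C := R[i].
Hypothesis Ghaus : hausdorff_space G.
Hypothesis Glc : locally_compact [set: G].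
Hypothesis Get : etale G.
Implicit Types (f g x y : G -> C^o) (v : G).

Lemma conv_units f g c : Cc (@units G) f -> conv f g c = f (grng c) * g c.
Proof.
move=> hf; rewrite (@conv_bisection _ _ _ _ (@units G) (grng c)).
- by rewrite unit_inv ?gmul_rng//; exact: units_rng.
- by have [_ _] := bisection_units Get.
- by move=> b; exact: (Cc_nz hf).
- exact: units_rng.
- by rewrite grng_rng.
Qed.

Lemma conv_units2 f g : Cc (@units G) f -> Cc (@units G) g ->
  conv f g = (fun c => f c * g c).
Proof.
move=> hf hg; apply/funext => c; rewrite conv_units//.
have [uc|nc] := pselect (units c); first by rewrite unit_rng.
by rewrite (Cc_off hg nc) !mulr0.
Qed.

Lemma fstar_units f : Cc (@units G) f -> fstar f = (fun c => ((f c)^*)%C).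
Proof.
move=> hf; apply/funext => c; rewrite /fstar.
have [uc|nc] := pselect (units c); first by rewrite unit_inv.
rewrite (Cc_off hf nc) (Cc_off hf)// => ui; apply: nc.
by rewrite -(ginvK c) unit_inv.
Qed.

Lemma nrm_continuous f : continuous f -> continuous (fun c => nrm (f c)).
Proof.
move=> cf x; apply/cvgrPdist_lt => e e0.
have eC : 0 < e%:C :> C by rewrite ltcR.
have /cvgrPdist_lt/(_ _ eC) := cf x; apply: filterS => y.
by rewrite nrmE ltcR; apply: le_lt_trans; exact: nrm_dist_nrm.
Qed.

(* For [k = M - sqrt (M^2 - |f|^2)] one has [M^2 - |f|^2 = (M - k)^2], hence
   [M^2 |x|^2 - |pi f x|^2 = |M x - pi k x|^2 >= 0]. *)
Lemma opnorm_units H (K : hilbertSpace R) (pi : (G -> C^o) -> {linear K -> K}) f (M : R) :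
  open_subgroupoid H -> star_rep H pi -> Cc (@units G) f -> 0 <= M ->
  (forall c, nrm (f c) <= M) -> opnorm (pi f) <= M.
Proof.
move=> [_ uH _ _] [_ plin pmul padj] hf M0 hM.
have uHC g : Cc (@units G) g -> Cc H g by exact: Cc_sub.
pose k0 c : R := M - Num.sqrt (M ^+ 2 - nrm (f c) ^+ 2).
pose k : G -> C^o := fun c => (k0 c)%:C.
have [cf [L [cL LU fL]]] := CcE hf.
have hk : Cc (@units G) k.
  apply: (CcI Ghaus _ cL LU) => [|c nc]; last first.
    by rewrite /k /k0 fL// nrm0 expr0n subr0 sqrtr_sqr ger0_norm// subrr.
  apply: real_complex_continuous => c.
  apply: (@continuousB R R^o G (fun=> M) (fun c => Num.sqrt (M ^+ 2 - nrm (f c) ^+ 2))).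
    exact: cst_continuous.
  apply: (@continuous_comp _ _ _ (fun c => M ^+ 2 - nrm (f c) ^+ 2) Num.sqrt); last first.
    exact: sqrt_continuous.
  apply: (@continuousB R R^o G (fun=> M ^+ 2) (fun c => nrm (f c) ^+ 2)).
    exact: cst_continuous.
  by apply: (@continuousM R G (fun c => nrm (f c)) (fun c => nrm (f c))); apply: nrm_continuous.
have hs : Cc (@units G) (fstar f).
  have -> : fstar f = (fun c => ((f c)^*)%C) by exact: fstar_units.
  apply: (CcI Ghaus _ cL LU) => [|c /fL ->]; last exact: conjc0.
  exact: conjc_continuous.
have ff : conv (fstar f) f = (2 * M)%:C *: k + (- conv k k).
  rewrite !conv_units2// fstar_units//; apply/funext => c.
  transitivity ((nrm (f c) ^+ 2)%:C : C); first by rewrite nrm_sqr mulrC.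
  transitivity (((2 * M) * k0 c - k0 c * k0 c)%:C : C).
    congr (_%:C); have : Num.sqrt (M ^+ 2 - nrm (f c) ^+ 2) ^+ 2 = M ^+ 2 - nrm (f c) ^+ 2.
      rewrite sqr_sqrtr// subr_ge0 lerXn2r ?nnegrE ?nrm_ge0//.
    rewrite /k0; set s := Num.sqrt _; clearbody s => e.
    by rewrite -[LHS](subKr (M ^+ 2)) -e; ring.
  by rewrite rmorphB !rmorphM.
have kks : fstar k = k.
  by rewrite fstar_units//; apply/funext => c; rewrite /k conjc_real.
apply: opnorm_bound => // x.
have hE z : hdot K z z = (nrm z ^+ 2)%:C by rewrite hdotE nrmE rmorphXn.
suff h : hdot K (pi f x) (pi f x) <= M%:C ^+ 2 * hdot K x x.
  rewrite -(@ler_pXn2r _ 2) ?nnegrE ?mulr_ge0 ?nrm_ge0// exprMn.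
  by move: h; rewrite !hE -rmorphXn -rmorphM lecR.
have hkk : Cc H (conv k k).
  by apply: uHC; rewrite (conv_units2 hk hk); exact: Cc_mull (Cc_continuous hk) hk.
have kx : hdot K x (pi k x) = hdot K (pi k x) x by rewrite -(padj _ _ _ (uHC k hk)) kks.
have e1 : hdot K (pi f x) (pi f x) =
    (2 * M)%:C * hdot K (pi k x) x - hdot K (pi k x) (pi k x).
  have hc : Cc H (conv (fstar f) f).
    rewrite ff; exact: (CcD Ghaus (CcZ Ghaus _ (uHC k hk)) (CcN Ghaus hkk)).
  have hfs : Cc H (fstar f) := uHC _ hs.
  rewrite -padj; last exact: uHC.
  rewrite -pmul//; last exact: uHC.
  rewrite ff plin; [|exact: uHC|exact: CcN].
  rewrite -scaleN1r -[_ *: conv k k]addr0 (plin _ _ _ _ hkk (Cc0 R Ghaus H)).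
  have -> : pi 0 x = 0.
    have := plin 1 0 0 x (Cc0 R Ghaus H) (Cc0 R Ghaus H).
    rewrite !scale1r addr0 => /eqP; rewrite eq_sym -subr_eq0 addrK.
    by move=> /eqP.
  rewrite addr0 scaleN1r pmul; [|exact: uHC..].
  rewrite linearBl linearZl_LR /=; congr (_ - _).
  by rewrite -(padj _ _ _ (uHC k hk)) kks.
have : 0 <= hdot K (M%:C *: x - pi k x) (M%:C *: x - pi k x) by rewrite dnorm_ge0.
rewrite linearBl !linearBr !linearZl_LR !linearZr_LR /= kx.
have -> : Num.conj M%:C = M%:C :> C by exact: conjc_real.
rewrite e1 -subr_ge0.
set a := hdot K x x; set b := hdot K (pi k x) x; set d := hdot K (pi k x) _.
by congr (0 <= _); rewrite rmorphM /= two_complex (_ : M%:C *: (M%:C * a) = M%:C * (M%:C * a))//; ring.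
Qed.

Lemma nrm_femb_units H (A : fullCstar R H) f (M : R) : open_subgroupoid H ->
  Cc (@units G) f -> 0 <= M -> (forall c, nrm (f c) <= M) -> nrm (femb A f) <= M.
Proof.
move=> sH hf M0 hM; have [_ uH _ _] := sH.
rewrite -lee_fin femb_norm; last exact: Cc_sub hf.
apply: ub_ereal_sup => _ [K [pi [hpi ->]]].
by rewrite lee_fin; exact: opnorm_units hpi hf M0 hM.
Qed.

End UnitsContractive.

(** * Norm and positivity in the reduced algebra *)

Section ReducedEstimates.
Variables (R : realType) (G : topGroupoidType).
Local Notation C := R[i].
Hypothesis Ghaus : hausdorff_space G.
Hypothesis Glc : locally_compact [set: G].
Hypothesis Get : etale G.
Variable H : set G.
Hypothesis sH : open_subgroupoid H.
Variable B : redCstar R H.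
Implicit Types (f g x y : G -> C^o) (v : G).

Local Notation lam := (lam Ghaus Glc Get).
Local Notation delta := (delta R).
Local Notation A := (rfull B).
Local Notation q := (rquo (r := B)).

(** Adding an element of [K_E] changes no coefficient, so the full norm in the bound can be lowered
    to anything above the quotient norm. *)
Lemma reduced_sandwich_le f x y v (e : R) : Cc H f -> Cc H x -> Cc H y -> units v ->
  nrm (q (femb A f)) < e ->
  nrm (l2dot (lam f (lam y (delta v))) (lam x (delta v)) : C^o) <=
  e * (nrm (lam y (delta v)) * nrm (lam x (delta v))).
Proof.
move=> hf hx hy uv /nrm_rquo_lt; case=> // k Kk hk.
rewrite -(eval_sandwich Ghaus Glc Get sH A)//.
have -> : cond_exp (cmul (cmul (cstar (femb A x)) (femb A f)) (femb A y)) v =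
    cond_exp (cmul (cmul (cstar (femb A x)) (femb A f + k)) (femb A y)) v.
  rewrite cmulDr cmulDl (cond_expD Ghaus Glc Get)//.
  by rewrite [X in _ = _ + X](K_E_cond_exp _ Kk) addr0.
apply: le_trans (nrm_cond_exp_sandwich Ghaus Glc Get sH _ hx hy uv) _.
by rewrite ler_wpM2r ?mulr_ge0 ?nrm_ge0// ltW.
Qed.

(* For [s = |q Y|] and [p = sqrt s] the conclusion says that [q Y] has no negative
   part: compressing [Y] by [p (s - q Y)] gives an element which is both
   nonnegative and nonpositive. *)
Lemma reduced_negative_part_eq0 (Y : A) (p s : B) :
  (forall x v, Cc H x -> units v ->
    0 <= (cond_exp (cmul (cmul (cstar (femb A x)) Y) (femb A x)) v : C)) ->
  cmul (cmul (cstar (cmul p (s - q Y))) (q Y)) (cmul p (s - q Y)) =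
    - cmul (cstar (cmul s (s - q Y))) (cmul s (s - q Y)) ->
  cmul s (s - q Y) = 0.
Proof.
move=> hY; set X := cmul p _; set Z := cmul s _ => XYX.
have hYa (a : A) v : units v -> 0 <= (cond_exp (cmul (cmul (cstar a) Y) a) v : C).
  move=> uv; have [f hf fa] := femb_seq a.
  have h := tends_cond_exp Ghaus Glc Get uv
    (tends_cmul (tends_cmul (tends_cstar fa) (tends_cst Y)) fa).
  by apply: tends_ge0 h => n; exact: hY.
have [X' qX] := rquo_surj X; have [Z' qZ] := rquo_surj Z.
pose N := cmul (cstar Z') Z'.
have Km : K_E (cmul (cmul (cstar X') Y) X' + N).
  by apply/rquo_eq0; rewrite rquoD !rquoM !rquo_star qX qZ XYX addNr.
(* Modulo [K_E], the compression of [Y] by [X'] is [- N]. The expectations of the two, sandwiched by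
   [w], are nonnegative with sum 0. *)
have N0 (w : A) v : units v -> cond_exp (cmul (cmul (cstar w) N) w) v = 0.
  move=> uv; have := K_E_cond_exp v Km (cstar w) w.
  rewrite cmulDr cmulDl (cond_expD Ghaus Glc Get)//.
  have -> : cmul (cmul (cstar w) (cmul (cmul (cstar X') Y) X')) w =
      cmul (cmul (cstar (cmul X' w)) Y) (cmul X' w) by rewrite cstarM !cmulA.
  have h1 := hYa (cmul X' w) v uv.
  have h2 : 0 <= (cond_exp (cmul (cmul (cstar w) N) w) v : C).
    have -> : cmul (cmul (cstar w) N) w = cmul (cstar (cmul Z' w)) (cmul Z' w).
      by rewrite cstarM !cmulA.
    exact: (cond_exp_ge0 Ghaus Glc Get sH).
  by move=> /eqP; rewrite addr_eq0 => /eqP e; apply/eqP; rewrite eq_le h2 andbT -oppr_ge0 -e.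
suff : q N = 0.
  rewrite rquoM rquo_star qZ => h; apply: nrm_eq0.
  by apply/eqP; rewrite -sqrf_eq0 -nrm_cstar_cmul h nrm0.
apply/rquo_eq0 => x y; apply/funext => v.
have [uv|nv] := pselect (units v); last by have [_ _ ->] := cond_expP Ghaus Glc Get A.
(* [K_E] asks for all two-sided products, so the vanishing on the diagonal is polarized, using
   [a + y] and [a + i y]. *)
pose S w1 w2 : C := cond_exp (cmul (cmul (cstar w1) N) w2) v.
have S0 w : S w w = 0 by exact: N0.
have SD w1 w2 w3 : S w1 (w2 + w3) = S w1 w2 + S w1 w3.
  by rewrite /S cmulDr (cond_expD Ghaus Glc Get).
have SDl w1 w2 w3 : S (w2 + w3) w1 = S w2 w1 + S w3 w1.
  by rewrite /S cstarD !cmulDl (cond_expD Ghaus Glc Get).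
have SZ c w1 w2 : S w1 (c *: w2) = c * S w1 w2.
  by rewrite /S cmulZr (cond_expZ Ghaus Glc Get).
have SZl c w1 w2 : S (c *: w1) w2 = (c^*)%C * S w1 w2.
  by rewrite /S cstarZc !cmulZl (cond_expZ Ghaus Glc Get).
have -> : cond_exp (cmul (cmul x N) y) v = S (cstar x) y by rewrite /S cstarK.
set a := cstar x.
have e1 : S a y + S y a = 0.
  by have := S0 (a + y); rewrite SD !SDl !S0 add0r addr0 addrC.
have e2 : S a y - S y a = 0.
  have := S0 (a + 'i%C *: y); rewrite SD !SDl !SZ !SZl !S0 !mulr0 add0r addr0 => h.
  apply: (mulfI (_ : 'i%C != 0 :> C)); first by rewrite eq_complex /= oner_eq0 andbF.
  rewrite mulr0 -[RHS]h mulrBr addrC; congr (_ + _).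
  by rewrite -mulNr; congr (_ * _); apply/eqP; rewrite eq_complex /= oppr0 !eqxx.
have e3 : S a y = S y a by apply/eqP; rewrite -subr_eq0 e2.
by move: e1; rewrite -e3 -mulr2n => /eqP; rewrite mulrn_eq0 /= => /eqP.
Qed.

End ReducedEstimates.

(** * The augmentation character *)

Section Augmentation.
Variables (R : realType) (G : topGroupoidType).
Local Notation C := R[i].
Hypothesis Ghaus : hausdorff_space G.
Hypothesis Glc : locally_compact [set: G].
Hypothesis Get : etale G.
Implicit Types (f g : G -> C^o) (u v x y : G).

Local Notation II := (@IntIso G).

Let sI : open_subgroupoid II := IntIso_subgroupoid Get.
Let oI : open II. Proof. by have [] := sI. Qed.

Lemma IntIso_rng_src h : II h -> grng h = gsrc h.
Proof. by move=> /interior_subset. Qed.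

Lemma finite_IntIso_at f u : Cc II f -> finite_set (IntIso_at u `&` [set h | f h != 0]).
Proof.
move=> hf; apply: sub_finite_set (finite_fibre Ghaus Glc Get u oI hf).
by move=> h [[/IntIso_rng_src hr hs] fh]; split => //; rewrite hr.
Qed.

Lemma augmentation_eq f g u : (forall h, IntIso_at u h -> f h = g h) ->
  augmentation u f = augmentation u g.
Proof. by move=> h; apply: eq_fsbigr => x; rewrite inE => /h. Qed.

Lemma augmentationD f g u : Cc II f -> Cc II g ->
  augmentation u (f + g) = augmentation u f + augmentation u g.
Proof.
move=> hf hg; pose D := IntIso_at u `&` ([set h | f h != 0] `|` [set h | g h != 0]).
have e (k : G -> C^o) : (forall h, k h != 0 -> f h != 0 \/ g h != 0) ->
    augmentation u k = \sum_(h \in D) k h.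
  move=> hk; apply/esym/fsbig_widen; first by move=> h [].
  move=> h [Ih nD] /=; apply/eqP; apply: contra_notT nD => kh; split => //.
  exact: hk.
have h0 h : (f + g) h != 0 -> f h != 0 \/ g h != 0.
  move=> fgh; have [f0|f0] := eqVneq (f h) 0; last by left.
  right; apply: contraNneq fgh => g0; suff : f h + g h == 0 by [].
  by rewrite f0 g0 addr0.
rewrite (e _ h0) (e f (fun h fh => or_introl fh)) (e g (fun h gh => or_intror gh)).
by rewrite -fsbig_split// /D setIUr finite_setU; split; exact: finite_IntIso_at.
Qed.

Lemma augmentationZ (c : C) f u : augmentation u (c *: f) = c * augmentation u f.
Proof. by rewrite /augmentation mulr_fsumr. Qed.

Lemma augmentationN f u : augmentation u (- f) = - augmentation u f.
Proof. by rewrite -[in LHS]scaleN1r augmentationZ mulN1r. Qed.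

Lemma augmentation0 u : augmentation u (0 : G -> C^o) = 0.
Proof. by rewrite /augmentation fsbig1. Qed.

Lemma augmentation1 f u b : IntIso_at u b ->
  (forall h, IntIso_at u h -> f h != 0 -> h = b) -> augmentation u f = f b.
Proof.
move=> Ib h; rewrite /augmentation.
transitivity (\sum_(x \in [set b]) f x); last by rewrite fsbig_set1.
apply/esym/fsbig_widen; first by move=> _ ->.
move=> x [Ix nx] /=; apply/eqP; apply: contra_notT nx => fx; exact: h.
Qed.

(** A bisection in [IntIso] meets the group at [u] in at most one element [b]. On this group
    [conv f g] is then [f b] times a left translate of [g], and translation permutes the group. *)
Lemma augmentation_conv f g u : Cc II f -> Cc II g ->
  augmentation u (conv f g) = augmentation u f * augmentation u g.
Proof.
move=> hf hg; apply: (Cc_ind (Z := set0) (P := fun f =>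
  augmentation u (conv f g) = augmentation u f * augmentation u g) Ghaus Glc Get oI _ _ _ hf) => //.
- by rewrite conv0l !augmentation0 mul0r.
- move=> f1 f2 h1 h2 e1 e2.
  have -> : conv (f1 + f2) g = conv f1 g + conv f2 g.
    by apply/funext => c; apply: convDl; exact: (fibreP Ghaus Glc Get _ oI).
  by rewrite !augmentationD ?e1 ?e2 ?mulrDl//; exact: Cc_conv.
- move=> B f1 bB BI hB _; have [_ _ iB] := bB.
  have [[b [Bb rb]]|no] := pselect (exists b, B b /\ grng b = u); last first.
    have z h : IntIso_at u h -> f1 h = 0.
      move=> [Ih hu]; apply/eqP; apply: contra_notT no => /(Cc_nz hB) Bh; exists h.
      by rewrite (IntIso_rng_src Ih).
    rewrite (augmentation_eq (g := 0)) ?augmentation0; last first.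
      move=> h [Ih hu]; apply: conv_eq0 => a ah.
      apply/eqP; apply: contra_notT no => /(Cc_nz hB) Ba; exists a.
      by rewrite ah (IntIso_rng_src Ih).
    by rewrite (@augmentation_eq f1 0)// augmentation0 mul0r.
  have Ib : II b by exact: BI.
  have sb : gsrc b = u by rewrite -(IntIso_rng_src Ib).
  rewrite (@augmentation1 f1 u b)//; last first.
    move=> h [Ih hu] /(Cc_nz hB) Bh; apply: (bisection_inj_rng bB) => //.
    by rewrite (IntIso_rng_src Ih) hu.
  rewrite -augmentationZ /augmentation.
  have [_ _ Im Ii] := sI.
  rewrite (@reindex_fsbig _ _ _ _ _ (gmul b) (IntIso_at u) (IntIso_at u)).
    apply: eq_fsbigr => h; rewrite inE => -[Ih hu].
    have bh : gsrc b = grng h by rewrite sb (IntIso_rng_src Ih).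
    rewrite (conv_bisection _ iB _ Bb); first by rewrite gmul_invl.
      by move=> a; exact: (Cc_nz hB).
    by rewrite grng_mul.
  split.
  - move=> h [Ih hu]; have bh : gsrc b = grng h by rewrite sb (IntIso_rng_src Ih).
    by split; [exact: Im | rewrite /= gsrc_mul].
  - move=> h k; rewrite !inE => -[Ih hu] [Ik ku]; apply: gmul_injl.
      by rewrite sb (IntIso_rng_src Ih).
    by rewrite sb (IntIso_rng_src Ik).
  - move=> h [Ih hu]; have bh : grng b = grng h by rewrite rb (IntIso_rng_src Ih).
    exists (gmul (ginv b) h); last by rewrite gmul_invr.
    split; last by rewrite /= gsrc_mul ?gsrc_inv.
    by apply: Im => //; [exact: Ii | rewrite gsrc_inv].
Qed.

Lemma augmentation_fstar f u : Cc II f ->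
  augmentation u (fstar f) = ((augmentation u f)^*)%C.
Proof.
move=> hf; apply: (Cc_ind (Z := set0) (P := fun f =>
  augmentation u (fstar f) = ((augmentation u f)^*)%C) Ghaus Glc Get oI _ _ _ hf) => //.
- have -> : fstar 0 = 0 :> (G -> C^o) by apply/funext => c; exact: conjc0.
  by rewrite augmentation0 conjc0.
- move=> f1 f2 h1 h2 e1 e2.
  by rewrite fstarD !augmentationD ?e1 ?e2 ?conjcD//; exact: Cc_fstar.
- move=> B f1 bB BI hB _; have [_ _ _ Ii] := sI.
  have [[b [Bb rb]]|no] := pselect (exists b, B b /\ grng b = u); last first.
    rewrite (@augmentation_eq f1 0) ?augmentation0 ?conjc0; last first.
      move=> h [Ih hu]; apply/eqP; apply: contra_notT no => /(Cc_nz hB) Bh; exists h.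
      by rewrite (IntIso_rng_src Ih).
    rewrite (@augmentation_eq _ 0) ?augmentation0// => h [Ih hu].
    rewrite /fstar (_ : f1 (ginv h) = 0) ?conjc0//.
    apply/eqP; apply: contra_notT no => /(Cc_nz hB) Bh; exists (ginv h).
    by rewrite grng_inv.
  have Ib : II b by exact: BI.
  have sb : gsrc b = u by rewrite -(IntIso_rng_src Ib).
  rewrite (@augmentation1 f1 u b)//; last first.
    move=> h [Ih hu] /(Cc_nz hB) Bh; apply: (bisection_inj_rng bB) => //.
    by rewrite (IntIso_rng_src Ih) hu.
  rewrite (@augmentation1 _ u (ginv b)).
  - by rewrite /fstar ginvK.
  - by split; [exact: Ii | rewrite /= gsrc_inv].
  - move=> h [Ih hu]; rewrite /fstar conjc_eq0 => /(Cc_nz hB) Bh.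
    rewrite -[h]ginvK; congr ginv; apply: (bisection_inj_rng bB) => //.
    by rewrite grng_inv hu rb.
Qed.

Lemma bump_compact (K U : set G) : compact K -> open U -> K `<=` U ->
  exists2 psi : G -> C^o, Cc U psi & forall y, K y -> psi y = 1.
Proof.
move=> cK oU KU.
have hV x : exists V, K x -> [/\ open V, V x & exists phi : G -> R,
    [/\ Cc U (fun y => (phi y)%:C : C^o), continuous phi & forall y, V y -> phi y = 1]].
  have [Kx|nK] := pselect (K x); last by exists set0.
  have [phi [Cphi cphi _ [V [oV Vx V1]]]] := Cc_bump R Ghaus Glc oU (KU _ Kx).
  by exists V; split => //; exists phi.
pose W x := projT1 (cid (hV x)).
have WP x : K x -> [/\ open (W x), W x x & exists phi : G -> R,
    [/\ Cc U (fun y => (phi y)%:C : C^o), continuous phi & forall y, W x y -> phi y = 1]].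
  by rewrite /W; case: cid.
have [x Kx|s sK sW] := compact_cover_seq (U := W) cK; first by have [] := WP x Kx.
suff [psi hpsi psi1] : exists2 psi : G -> C^o, Cc U psi &
    forall y x, x \in s -> W x y -> psi y = 1.
  by exists psi => // y /sW[x xs Wxy]; exact: psi1 xs Wxy.
elim: s sK {sW} => [|x s ih] sK; first by exists 0 => //; exact: Cc0.
have [|psi hpsi psi1] := ih; first by move=> z zs; apply: sK; rewrite inE zs orbT.
have [_ _ [phi [Cphi cphi phi1]]] := WP x (sK x (mem_head _ _)).
(* This is 1 wherever [phi] or [psi] is 1. *)
exists ((fun y => (phi y)%:C) + (fun y => (1 - (phi y)%:C) * psi y)).
  apply: CcD => //; apply: (@Cc_mull R G Ghaus U psi (fun y => 1 - (phi y)%:C)) => // y.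
  apply: (@continuousB C C^o G (fun=> 1) (fun y => (phi y)%:C)); first exact: cst_continuous.
  exact: real_complex_continuous.
move=> y z; rewrite inE => /orP[/eqP->|zs] Wy.
  suff : (phi y)%:C + (1 - (phi y)%:C) * psi y = 1 by [].
  by rewrite phi1// subrr mul0r addr0.
suff : (phi y)%:C + (1 - (phi y)%:C) * psi y = 1 by [].
by rewrite (psi1 y z)// mulr1 subrKC.
Qed.

Section Character.
Variable B : redCstar R II.
Local Notation A := (rfull B).
Local Notation q := (rquo (r := B)).
Variable u0 : G.
Hypothesis u0u : units u0.

(** The extension is defined by uniform approximation; [nrm_femb_units] turns uniform closeness on
    units into closeness in the full norm. *)
Lemma C0_emb_femb f : Cc (@units G) f -> C0_emb A f = femb A f.
Proof.
move=> hf; rewrite /C0_emb; apply: xget_unique.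
  by move=> e e0; exists f => //; split=> [x|]; rewrite subrr nrm0.
move=> a ha; apply/eqP; rewrite -subr_eq0; apply/eqP/nrm_le_eps => e e0.
have e2 : 0 < e / 2 by rewrite divr_gt0.
have [g hg [h1 h2]] := ha _ e2.
have [_ uI _ _] := sI.
rewrite (le_lt_trans (nrm_dist_triangle _ (femb A g) _))// (splitr e) ltr_leD//.
have -> : femb A g - femb A f = femb A (g - f).
  by rewrite (fembB Ghaus)//; [exact: Cc_sub hg | exact: Cc_sub hf].
apply: (nrm_femb_units Ghaus Get A sI).
- exact: CcB.
- exact: ltW.
- by move=> c; rewrite -[_ c]/(g c - f c) nrmBC ltW.
Qed.

Lemma Cc_C0_units f : Cc (@units G) f -> C0_units f.
Proof.
move=> hf; have [cf [K [cK KU fK]]] := CcE hf; split.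
- exact: continuous_subspaceT.
- by move=> x; exact: Cc_off.
- by move=> e e0; exists K; split=> // u _ /fK ->; rewrite nrm0.
Qed.

Lemma J_other_closed_ideal : closed_ideal (J_other (B := B) u0).
Proof.
split.
- by apply: closed_bigI => M [[]].
- by move=> M [[]].
- move=> c a b Ja Jb M hM; have [[_ _ h _] _] := hM; apply: h.
    exact: Ja hM.
  exact: Jb hM.
- move=> a b Jb; split=> M hM; have [[_ _ _ h] _] := hM.
    by have [] := h a b (Jb M hM).
  by have [] := h a b (Jb M hM).
Qed.

(** On a bisection, [f] is the product of its transport [F] to the units, where [F u0 = 0], and a
    bump equal to 1 on the support of [f]. This is the independence of [other_norm] from the chosen
    lift. *)
Lemma vanishing_J_other f : Cc II f -> (forall h, IntIso_at u0 h -> f h = 0) ->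
  J_other u0 (q (femb A f)).
Proof.
have [Jc J0 Jl Jm] := J_other_closed_ideal.
apply: (Cc_ind (P := fun f => J_other u0 (q (femb A f))) Ghaus Glc Get oI).
- by rewrite (femb0 Ghaus) rquo0.
- move=> f1 f2 h1 h2 j1 j2; rewrite (fembD A)// rquoD -[X in X + _]scale1r.
  exact: Jl.
- move=> V f1 bV VI hV f0; have [oV _ _] := bV.
  have [cf [K [cK KV fK]]] := CcE hV.
  have [e he e1] := bump_compact cK oV KV.
  pose F := pull (section_of V) (@grng G @` V) f1.
  have hF : Cc (@units G) F.
    apply: Cc_sub (pull_Cc Ghaus Get bV hV) => _ [b _ <-]; exact: units_rng.
  have -> : f1 = conv F e.
    apply/funext => c; rewrite (conv_units Get)//.
    have [Vc|nV] := pselect (V c); last by rewrite (Cc_off hV nV) (Cc_off he nV) mulr0.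
    rewrite /F pullE; last by exists c.
    rewrite section_of_rng//; have [/e1->|/fK->] := pselect (K c); first by rewrite mulr1.
    by rewrite mul0r.
  have [_ uI _ _] := sI.
  rewrite femb_conv; [|exact: Cc_sub hF|exact: Cc_sub he].
  rewrite rquoM; apply: (Jm _ _ _).2.
  move=> M [_ hM]; apply: hM; exists F; last by rewrite C0_emb_femb.
  split; first exact: Cc_C0_units.
  have [Vu|nV] := pselect ((@grng G @` V) u0); last by rewrite /F pull_off.
  rewrite /F pullE//; apply: f0; have [Vs rs] := section_ofP Vu.
  by split; [exact: VI | rewrite /= -(IntIso_rng_src (VI _ Vs))].
Qed.

Hypothesis aug_cont : augmentation_continuous B u0.

(** The lift chosen in [other_norm] differs from [f] by an element that [vanishing_J_other] places
    in [J_other], so [other_norm] is at most the reduced norm of [f]. Continuity at 0 and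
    homogeneity give the bound. *)
Lemma augmentation_bounded : exists2 M : R, 0 <= M &
  forall f, Cc II f -> nrm (augmentation u0 f : C^o) <= M * nrm (q (femb A f)).
Proof.
have g0 : group_alg u0 (0 : G -> C^o).
  split; last by move=> h /=; rewrite eqxx.
  by apply: sub_finite_set (@finite_set0 G) => h /=; rewrite eqxx.
have [d d0 hd] := aug_cont g0 ltr01.
exists (2 / d); first by rewrite divr_ge0// ltW.
have small f : Cc II f -> nrm (q (femb A f)) < d -> nrm (augmentation u0 f : C^o) < 1.
  move=> hf hn; pose y : G -> C^o := fun h => if `[< IntIso_at u0 h >] then f h else 0.
  have yf h : IntIso_at u0 h -> y h = f h by move=> Ih; rewrite /y asboolT.
  have hy : group_alg u0 y.
    split.
      apply: sub_finite_set (finite_IntIso_at u0 hf) => h /=; rewrite /y.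
      by case: asboolP => [Ih fh|_]; [split | rewrite eqxx].
    by move=> h /=; rewrite /y; case: asboolP => //; rewrite eqxx.
  have := hd y hy; rewrite subr0 augmentation0 subr0 (augmentation_eq yf); apply.
  rewrite /other_norm; case: xgetP => [f0 _ [hf0 f0y]|/(_ f)]; last first.
    by case; split => // h /yf.
  have hJ : J_other u0 (q (femb A (f - f0))).
    apply: vanishing_J_other; first exact: CcB.
    by move=> h Ih; rewrite -[_ h]/(f h - f0 h) f0y// yf// subrr.
  apply: le_lt_trans hn; rewrite /quotient_norm; apply: inf_lbound.
    by exists 0 => _ [k _ <-]; exact: nrm_ge0.
  exists (q (femb A (f - f0))) => //; congr nrm.
  by rewrite (fembB Ghaus)// rquoB subrKC.
move=> f hf; set N := nrm (q _); apply/ler_addgt0Pr => e e0.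
(* Chosen so that [t * N < d] and [1 / t = 2 / d * N + e]; the term [e * d] covers the case
   [N = 0]. *)
pose t := d / (2 * N + e * d).
have Np : 0 < 2 * N + e * d by rewrite ltr_wpDl ?mulr_ge0 ?nrm_ge0// mulr_gt0.
have t0 : 0 < t by rewrite divr_gt0.
have := small (t%:C *: f) (CcZ Ghaus _ hf).
rewrite (fembZ Ghaus)// rquoZ nrm_Zreal augmentationZ nrm_mul nrm_real ger0_norm ?(ltW t0)// -/N.
have -> : t * N < d.
  rewrite /t mulrAC ltr_pdivrMr// ltr_pM2l//.
  have := nrm_ge0 (q (femb A f)); have : 0 < e * d by rewrite mulr_gt0.
  by rewrite -/N; lra.
move=> /(_ isT); rewrite mulrC -ltr_pdivlMr// => /ltW /le_trans; apply.
by rewrite div1r invf_div mulrDl mulrAC mulfK ?gt_eqF.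
Qed.

Lemma augmentation_character : exists chi : B -> C^o,
  [/\ forall f, Cc II f -> chi (q (femb A f)) = augmentation u0 f,
      forall a b, chi (cmul a b) = chi a * chi b,
      forall a b, chi (a - b) = chi a - chi b &
      forall a, chi (cstar a) = ((chi a)^*)%C].
Proof.
have [M M0 hM] := augmentation_bounded.
have happ (a : B) e : 0 < e -> exists2 f, Cc II f & nrm (a - q (femb A f)) < e.
  move=> e0; have [a' <-] := rquo_surj a.
  have [f hf h] := femb_approx a' e0; exists f => //.
  by rewrite -rquoB; apply: le_lt_trans h; exact: nrm_rquo_le.
have [a e|f g hf hg|chi [c1 c2]] := @dense_extension R B _ (Cc II) (fun f => q (femb A f))
  (augmentation u0) M M0.
- exact: happ.
- have -> : augmentation u0 f - augmentation u0 g = augmentation u0 (f - g).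
    by rewrite augmentationD ?augmentationN//; exact: CcN.
  by rewrite -rquoB -(fembB Ghaus)//; apply: hM; exact: CcB.
have seqa (a : B) : exists2 f : nat -> (G -> C^o), (forall n, Cc II (f n)) &
    tends (fun n => q (femb A (f n))) a.
  have hs n : exists f, Cc II f /\ nrm (a - q (femb A f)) < n.+1%:R^-1.
    by have [|x Dx hx] := happ a n.+1%:R^-1; [rewrite invr_gt0 ltr0n | exists x].
  exists (fun n => projT1 (cid (hs n))) => [n|e e0]; first by case: cid => x [].
  exists (Num.bound e^-1) => n Nn; case: cid => x [_ /= hx]; apply: lt_trans hx _.
  rewrite invf_plt ?posrE//; apply: lt_le_trans (archi_boundP _) _.
    by rewrite invr_ge0 ltW.
  by rewrite ler_nat ltnW.
have tc (w : nat -> B) a : tends w a -> tends (fun n => chi (w n)) (chi a).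
  exact: tends_nrm_lip c2.
exists chi; split => //.
- move=> a b; have [f hf fa] := seqa a; have [g hg gb] := seqa b.
  have h1 := tc _ _ (tends_cmul fa gb).
  have h2 := tendsZZ (tc _ _ fa) (tc _ _ gb).
  apply: tends_unique h1 _; apply: tends_ext h2 => n.
  rewrite -rquoM -femb_conv// !c1//; last exact: Cc_conv.
  by rewrite augmentation_conv.
- move=> a b; have [f hf fa] := seqa a; have [g hg gb] := seqa b.
  have h1 := tc _ _ (tendsD fa (tendsZ (-1) gb)).
  have h2 := tendsD (tc _ _ fa) (tendsZ (-1) (tc _ _ gb)).
  rewrite -[a - b]/(a + - b) -[in LHS](scaleN1r b).
  rewrite -[chi a - chi b]/(chi a + - chi b) -(scaleN1r (chi b)).
  apply: tends_unique h1 _; apply: tends_ext h2 => n.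
  rewrite -rquoZ -rquoD -(fembZ Ghaus)// -(fembD A)//; last exact: CcZ.
  rewrite !c1//; last by apply: CcD => //; exact: CcZ.
  by rewrite augmentationD ?augmentationZ//; exact: CcZ.
- move=> a; have [f hf fa] := seqa a.
  have h1 := tc _ _ (tends_cstar fa).
  apply: tends_unique h1 _ => e /(tc _ _ fa)[N hN]; exists N => n /hN.
  rewrite -rquo_star -femb_star// !c1//; last exact: Cc_fstar.
  by rewrite augmentation_fstar// -conjcB nrm_conj.
Qed.

End Character.
End Augmentation.

(** * The ideal generated by a translation difference *)

Section Translation.
Variables (R : realType) (G : topGroupoidType).
Local Notation C := R[i].
Local Notation l2 := (l2 R G).
Hypothesis Ghaus : hausdorff_space G.
Hypothesis Glc : locally_compact [set: G].
Hypothesis Get : etale G.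
Implicit Types (f g : G -> C^o) (xi eta : l2) (a b c h u v w : G) (B : set G).

Local Notation lam := (lam Ghaus Glc Get).
Local Notation II := (@IntIso G).

(** In the usual convention this is left translation by [h^-1]: it carries vectors over [grng h] to
    vectors over [gsrc h]. *)
Definition ltr_fun h xi : G -> C^o := fun c => if `[< grng c = gsrc h >] then xi (gmul h c) else 0.

Lemma ltr_ex h xi : exists2 eta : l2, eta =1 ltr_fun h xi & nrm eta <= 1 * nrm xi.
Proof.
apply: (@l2_transport _ _ _ _ [set c | grng c = gsrc h] (gmul h)) => //.
- by move=> c; rewrite /ltr_fun; case: asboolP => //; rewrite eqxx.
- by move=> c hc; rewrite /ltr_fun asboolT// mul1r.
- by move=> c d hc hd; apply: gmul_injl.
Qed.

Definition ltr h xi : l2 := projT1 (cid2 (ltr_ex h xi)).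

Lemma ltrE h xi c : grng c = gsrc h -> ltr h xi c = xi (gmul h c).
Proof. by move=> hc; rewrite /ltr; case: cid2 => eta /= -> _; rewrite /ltr_fun asboolT. Qed.

Lemma ltr_off h xi c : grng c <> gsrc h -> ltr h xi c = 0.
Proof. by move=> hc; rewrite /ltr; case: cid2 => eta /= -> _; rewrite /ltr_fun asboolF. Qed.

Lemma nrm_ltr_le h xi : nrm (ltr h xi) <= nrm xi.
Proof. by rewrite /ltr; case: cid2 => eta /= _; rewrite mul1r. Qed.

Lemma ltrB h xi eta : ltr h (xi - eta) = ltr h xi - ltr h eta.
Proof.
apply: l2_ext => c; rewrite -[RHS]/(ltr h xi c - ltr h eta c).
have [e|ne] := pselect (grng c = gsrc h); first by rewrite !ltrE.
by rewrite !ltr_off// subr0.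
Qed.

Definition over v xi := forall c, grng c <> v -> xi c = 0.

Lemma ltr_over h xi : over (gsrc h) (ltr h xi).
Proof. by move=> c; exact: ltr_off. Qed.

(** The adjoint is used because a vector over [v] then meets the arrow of [B] with range [v], the
    one that [section_of] delivers. *)
Lemma lam_fstar_bisection B f b xi : bisection B -> Cc B f -> B b -> over (grng b) xi ->
  lam (fstar f) xi = ((f b)^*)%C *: ltr b xi.
Proof.
move=> bB hB Bb ov; have hT : Cc [set: G] f by exact: Cc_sub hB.
have hs : Cc [set: G] (fstar f) by apply: Cc_fstar => //; exact: open_subgroupoidT.
have [_ _ iB'] := bisection_inv bB.
have sB' c : fstar f c != 0 -> (@ginv G @^-1` B) c.
  by rewrite /fstar conjc_eq0 => /(Cc_nz hB).
apply: l2_ext => c; rewrite lamE//.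
transitivity (((f b)^*)%C * (ltr b xi c : C)); last by [].
have [e|ne] := pselect (grng c = gsrc b).
  rewrite ltrE// (@conv_bisection _ _ _ _ _ (ginv b) c iB' sB').
  - by rewrite /fstar ginvK.
  - by rewrite /= ginvK.
  - by rewrite grng_inv.
rewrite ltr_off// mulr0.
have [[d [Bd dc]]|nd] := pselect (exists d, (@ginv G @^-1` B) d /\ grng d = grng c); last first.
  rewrite conv_eq0// => d dc; apply/eqP; apply: contra_notT nd => /sB' Bd.
  by exists d.
rewrite (conv_bisection _ iB' sB' Bd dc) ov ?mulr0//.
rewrite grng_mul ?gsrc_inv// grng_inv => sd; apply: ne.
by rewrite -dc -gsrc_inv; congr gsrc; apply: (bisection_inj_rng bB) => //; rewrite grng_inv.
Qed.

Lemma lam_fstar_bisection0 B f v xi : bisection B -> Cc B f ->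
  (forall b, B b -> grng b = v -> f b = 0) -> over v xi -> lam (fstar f) xi = 0.
Proof.
move=> bB hB nb ov; have hT : Cc [set: G] f by exact: Cc_sub hB.
have hs : Cc [set: G] (fstar f) by apply: Cc_fstar => //; exact: open_subgroupoidT.
have [_ _ iB'] := bisection_inv bB.
have sB' c : fstar f c != 0 -> (@ginv G @^-1` B) c.
  by rewrite /fstar conjc_eq0 => /(Cc_nz hB).
apply: l2_ext => c; rewrite lamE//.
have [[d [Bd dc]]|nd] := pselect (exists d, (@ginv G @^-1` B) d /\ grng d = grng c); last first.
  rewrite conv_eq0// => d dc; apply/eqP; apply: contra_notT nd => /sB' Bd.
  by exists d.
rewrite (conv_bisection _ iB' sB' Bd dc).
have [sd|sd] := pselect (gsrc d = v).
  by rewrite /fstar nb ?conjc0 ?mul0r// grng_inv.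
by rewrite ov ?mulr0// grng_mul ?gsrc_inv// grng_inv.
Qed.

Lemma lam_units f v xi : Cc (@units G) f -> over v xi -> lam f xi = f v *: xi.
Proof.
move=> hf ov; have hT : Cc [set: G] f by exact: Cc_sub hf.
apply: l2_ext => c; rewrite lamE// conv_units//.
transitivity ((f v : C) * (xi c : C)); last by [].
have [->//|ne] := pselect (grng c = v).
by rewrite ov// !mulr0.
Qed.

Lemma lamD f g xi : Cc [set: G] f -> Cc [set: G] g -> lam (f + g) xi = lam f xi + lam g xi.
Proof. by move=> hf hg; have := lam_linear Ghaus Glc Get 1 xi hf hg; rewrite !scale1r. Qed.

Lemma lam0 xi : lam 0 xi = 0.
Proof.
have h := Cc0 R Ghaus [set: G].
have := lamD xi h h; rewrite addr0 => /eqP.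
by rewrite eq_sym -subr_eq0 addrK => /eqP.
Qed.

Lemma lamZ (k : C) f xi : Cc [set: G] f -> lam (k *: f) xi = k *: lam f xi.
Proof.
move=> hf; have := lam_linear Ghaus Glc Get k xi hf (Cc0 R Ghaus [set: G]).
by rewrite lam0 !addr0.
Qed.

Lemma lamN f xi : Cc [set: G] f -> lam (- f) xi = - lam f xi.
Proof. by move=> hf; rewrite -scaleN1r lamZ// scaleN1r. Qed.

Lemma fstarN f : fstar (- f) = - fstar f.
Proof. by apply/funext => c; rewrite /fstar; exact: conjcN. Qed.

Section Difference.
Variables (B : set G) (f : G -> C^o).
Hypotheses (bB : bisection B) (BI : B `<=` II) (hB : Cc B f).

Definition base_fun : G -> C^o := pull (section_of B) (@grng G @` B) f.

Lemma base_fun_Cc : Cc (@units G) base_fun.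
Proof.
by apply: Cc_sub (pull_Cc Ghaus Get bB hB) => _ [b _ <-]; exact: units_rng.
Qed.

Let k : G -> C^o := f - base_fun.

Lemma difference_Cc : Cc [set: G] k.
Proof. by apply: CcB => //; [exact: Cc_sub hB | exact: Cc_sub base_fun_Cc]. Qed.

Let lam_kstar xi : lam (fstar k) xi = lam (fstar f) xi - lam (fstar base_fun) xi.
Proof.
have hT : Cc [set: G] f by exact: Cc_sub hB.
have hF : Cc [set: G] base_fun by exact: Cc_sub base_fun_Cc.
have sT := open_subgroupoidT G.
by rewrite /k fstarD fstarN lamD ?lamN//; try apply: CcN => //; exact: Cc_fstar.
Qed.

Let lam_base xi v : over v xi -> lam (fstar base_fun) xi = ((base_fun v)^*)%C *: xi.
Proof.
move=> ov; have hF := base_fun_Cc; rewrite (lam_units (v := v))//; last first.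
  have [_ uH _ iH] := open_subgroupoidT G.
  rewrite fstar_units//; have [cf [K [cK KU fK]]] := CcE hF.
  by apply: (CcI Ghaus _ cK KU) => [|c /fK ->]; [exact: conjc_continuous | exact: conjc0].
by rewrite fstar_units.
Qed.

Lemma lam_difference b xi : B b -> over (grng b) xi ->
  lam (fstar k) xi = ((f b)^*)%C *: (ltr b xi - xi).
Proof.
move=> Bb ov; rewrite lam_kstar (lam_fstar_bisection bB hB Bb ov) (lam_base ov).
rewrite /base_fun pullE; last by exists b.
by rewrite section_of_rng// scalerBr.
Qed.

Lemma lam_difference0 v xi : (forall b, B b -> grng b = v -> f b = 0) -> over v xi ->
  lam (fstar k) xi = 0.
Proof.
move=> nb ov; rewrite lam_kstar (lam_fstar_bisection0 bB hB nb ov) (lam_base ov).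
rewrite (_ : base_fun v = 0) ?conjc0 ?scale0r ?subr0//.
have [Vv|nV] := pselect ((@grng G @` B) v); last by rewrite /base_fun pull_off.
by rewrite /base_fun pullE//; have [Bs rs] := section_ofP Vv; exact: nb.
Qed.

(** The conjugate [a b a^-1], with [a] in [X] of range [v] and [b] in [B] over the source of [a];
    isotropy of [b] makes the product composable. *)
Definition conjugate_section (X : set G) v : G :=
  let a := section_of X v in gmul a (gmul (section_of B (gsrc a)) (ginv a)).

Definition conjugate_domain (X : set G) : set G :=
  @grng G @` (X `&` @gsrc G @^-1` (@grng G @` B)).

Lemma conjugate_domainP X v : bisection X -> conjugate_domain X v ->
  let a := section_of X v in let b := section_of B (gsrc a) in
  [/\ X a, grng a = v, B b & grng b = gsrc a].
Proof.
move=> bX [a [Xa Ba] <-]; rewrite section_of_rng//=.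
by have [Bs rs] := section_ofP Ba.
Qed.

Lemma conjugate_local_section X : bisection X ->
  local_section (conjugate_domain X) (conjugate_section X).
Proof.
move=> bX; have [oX _ _] := bX; have [oB _ _] := bB.
have oV : open (conjugate_domain X).
  apply: (open_rng Get); apply: openI => //.
  by apply: open_preimage; [exact: gsrc_continuous | exact: open_rng].
split => //.
- by move=> _ [a _ <-]; exact: units_rng.
- move=> v /(conjugate_domainP bX)[Xa ra Bb rb].
  have sb : gsrc (section_of B (gsrc (section_of X v))) = gsrc (section_of X v).
    by rewrite -(IntIso_rng_src (BI Bb)).
  by rewrite /conjugate_section grng_mul// grng_mul// grng_inv.
- move=> v Vv; have [Xa ra Bb rb] := conjugate_domainP bX Vv.
  have XV : (@grng G @` X) v by exists (section_of X v).
  have ca : {for v, continuous (section_of X)} by exact: section_of_continuous.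
  have cb : {for v, continuous (fun v => section_of B (gsrc (section_of X v)))}.
    apply: (@continuous_comp _ _ _ (fun v => gsrc (section_of X v)) (section_of B)).
      by apply: continuous_comp => //; exact: (gsrc_continuous Get).
    by apply: section_of_continuous => //; exists (section_of B (gsrc (section_of X v))).
  have nV : nbhs v (conjugate_domain X) by exact: open_nbhs_nbhs.
  apply: gmul_continuous_at => //.
    apply: gmul_continuous_at => //.
      by apply: continuous_comp => //; exact: ginv_continuous.
    apply: filterS nV => w /(conjugate_domainP bX)[_ _ Bw rw].
    by rewrite grng_inv -(IntIso_rng_src (BI Bw)).
  apply: filterS nV => w /(conjugate_domainP bX)[_ _ Bw rw].
  by rewrite grng_mul// grng_inv -(IntIso_rng_src (BI Bw)).
Qed.

(** The image of a local section is open, so isotropy of its arrows already places them in the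
    interior. *)
Lemma conjugate_section_IntIso X v : bisection X -> conjugate_domain X v ->
  II (conjugate_section X v).
Proof.
move=> bX Vv; have ls := conjugate_local_section bX.
have oT := local_section_open Get ls.
have h : conjugate_section X @` conjugate_domain X `<=` II.
  rewrite /IntIso -open_subsetE// => _ [w Ww <-].
  have [Xa ra Bb rb] := conjugate_domainP bX Ww.
  have [_ _ rs _] := ls.
  have sb : gsrc (section_of B (gsrc (section_of X w))) = gsrc (section_of X w).
    by rewrite -(IntIso_rng_src (BI Bb)).
  rewrite /Iso /= rs// /conjugate_section.
  by rewrite gsrc_mul ?gsrc_mul ?grng_mul ?grng_inv ?gsrc_inv.
by apply: h; exists v.
Qed.

(** Translating by [a] and then by [b] amounts to translating by [a b a^-1] and then by [a]. This
    brings a difference over the source of [a] back to one over [v]. *)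
Lemma lam_difference_conjugate X x v xi : bisection X -> Cc X x -> conjugate_domain X v ->
  over v xi -> exists2 c : C, c = ((x (section_of X v))^*)%C *
      ((f (section_of B (gsrc (section_of X v))))^*)%C &
    lam (fstar k) (lam (fstar x) xi) =
      c *: ltr (section_of X v) (ltr (conjugate_section X v) xi - xi).
Proof.
move=> bX hX Vv ov; have [Xa ra Bb rb] := conjugate_domainP bX Vv.
set a := section_of X v in Xa ra Bb rb *; set b := section_of B _ in Bb rb *.
exists (((x a)^*)%C * ((f b)^*)%C) => //.
have ovx : over (grng b) (ltr a xi) by rewrite rb; exact: ltr_over.
rewrite (lam_fstar_bisection bX hX Xa); last by rewrite ra.
transitivity (((x a)^*)%C *: lam (fstar k) (ltr a xi)); first exact: linearZ.
rewrite (lam_difference Bb ovx) scalerA; congr (_ *: _).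
rewrite ltrB; congr (_ - _); apply: l2_ext => c.
have sb : gsrc b = gsrc a by rewrite -(IntIso_rng_src (BI Bb)).
have [e|ne] := pselect (grng c = gsrc a); last by rewrite !ltr_off// sb.
rewrite ltrE ?sb// ltrE; last by rewrite grng_mul ?sb.
rewrite [RHS]ltrE// ltrE; last first.
  rewrite grng_mul// ra /conjugate_section -/a -/b.
  by rewrite gsrc_mul ?gsrc_mul ?grng_mul ?grng_inv ?gsrc_inv.
congr (l2fun xi _); rewrite /conjugate_section -/a -/b.
have h3 : gsrc b = grng (ginv a) by rewrite grng_inv.
have h1 : gsrc a = grng (gmul b (ginv a)) by rewrite grng_mul.
have h4 : gsrc (ginv a) = grng (gmul a c) by rewrite gsrc_inv grng_mul.
have h2 : gsrc (gmul b (ginv a)) = grng (gmul a c) by rewrite gsrc_mul.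
by rewrite -(gmulA _ _ _ h1 h2) -(gmulA _ _ _ h3 h4) gmul_invl.
Qed.

End Difference.
End Translation.

(** * Quadratic forms of the ideal near one unit *)

Section LocalBound.
Variables (R : realType) (G : topGroupoidType).
Local Notation C := R[i].
Local Notation l2 := (l2 R G).
Hypothesis Ghaus : hausdorff_space G.
Hypothesis Glc : locally_compact [set: G].
Hypothesis Get : etale G.
Variable u0 : G.
Hypothesis u0u : units u0.
Implicit Types (f g x y : G -> C^o) (xi eta : l2) (b c h u v w : G).

Local Notation lam := (lam Ghaus Glc Get).
Local Notation II := (@IntIso G).

Let sT := open_subgroupoidT G.

Definition displacement (ts : seq (G -> G)) v xi : R :=
  \sum_(t <- ts) nrm (ltr (t v) xi - xi).

Lemma displacement_ge0 ts v xi : 0 <= displacement ts v xi.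
Proof. by apply: sumr_ge0 => t _; exact: nrm_ge0. Qed.

(* Near [u0], the quadratic form of [a] on vectors over a single unit is controlled by how
   much finitely many local sections of [IntIso G] move these vectors. *)
Definition isotropy_bound (a : G -> C^o) := exists (M : R) (V : set G) (ts : seq (G -> G)),
  [/\ 0 <= M, open V, V u0, V `<=` @units G &
   (forall t, List.In t ts -> local_section V t /\ forall v, V v -> II (t v)) /\
   forall v xi, V v -> over v xi ->
     nrm (l2dot (lam a xi) xi : C^o) <= M * nrm xi * displacement ts v xi].

Lemma isotropy_bound0 : isotropy_bound 0.
Proof.
exists 0, (@units G), [::]; split => //; first exact: open_units.
split=> // v xi _ _; rewrite lam0 !mul0r.
by have := l2dot_nrm_le 0 xi; rewrite nrm0 mul0r.
Qed.

Lemma isotropy_boundD f g : Cc [set: G] f -> Cc [set: G] g ->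
  isotropy_bound f -> isotropy_bound g -> isotropy_bound (f + g).
Proof.
move=> hf hg [M [V [ts [M0 oV Vu VU [hts hV]]]]] [N [W [us [N0 oW Wu WU [hus hW]]]]].
exists (M + N), (V `&` W), (ts ++ us); split.
- exact: addr_ge0.
- exact: openI.
- by [].
- by move=> v [/VU].
- split.
    move=> t /List.in_app_iff[/hts|/hus] [ls hI]; split.
    + by apply: local_section_sub ls _ _; [exact: openI | exact: subIsetl].
    + by move=> v [/hI].
    + by apply: local_section_sub ls _ _; [exact: openI | exact: subIsetr].
    + by move=> v [_ /hI].
  move=> v xi [Vv Wv] ov; rewrite lamD// l2dotDl.
  rewrite (le_trans (nrm_triangle (V := C^o) _ _))//.
  apply: le_trans (lerD (hV v xi Vv ov) (hW v xi Wv ov)) _.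
  rewrite /displacement big_cat /= -!/(displacement _ _ _).
  have := displacement_ge0 ts v xi; have := displacement_ge0 us v xi.
  have := nrm_ge0 xi; set X := nrm xi; set S := displacement ts v xi.
  set T := displacement us v xi => X0 T0 S0.
  have -> : (M + N) * X * (S + T) = M * X * S + N * X * T + (M * X * T + N * X * S) by ring.
  by rewrite lerDl addr_ge0// !mulr_ge0.
Qed.

Section Generator.
Variables (B : set G) (f : G -> C^o).
Hypotheses (bB : bisection B) (BI : B `<=` II) (hB : Cc B f).
Local Notation k := (f - base_fun B f).

Let hk : Cc [set: G] k := difference_Cc Ghaus Get bB hB.

(** By linearity [x] lives on a bisection [X]. Moving [x] and [k] to the other side of the inner
    product leaves [lam y xi] against a translated difference, and Cauchy-Schwarz applies. The cases
    ask whether [X] has an arrow over [u0] and whether [B] has one over its source. *)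
Lemma isotropy_bound_generator x y : Cc [set: G] x -> Cc [set: G] y ->
  isotropy_bound (conv (conv x k) y).
Proof.
move=> hx hy; have CT z : Cc [set: G] z -> Cc [set: G] (conv (conv z k) y).
  by move=> hz; apply: (Cc_conv Ghaus Glc Get sT) => //; exact: Cc_conv.
apply: (Cc_ind (Z := set0) (P := fun x => isotropy_bound (conv (conv x k) y))
  Ghaus Glc Get openT _ _ _ hx) => //.
- by rewrite !conv0l; exact: isotropy_bound0.
- move=> x1 x2 h1 h2 b1 b2.
  have -> : conv (conv (x1 + x2) k) y = conv (conv x1 k) y + conv (conv x2 k) y.
    have -> : conv (x1 + x2) k = conv x1 k + conv x2 k.
      by apply/funext => c; apply: convDl; exact: (fibreP Ghaus Glc Get _ openT).
    apply/funext => c; apply: convDl; exact: (fibreP Ghaus Glc Get _ openT (Cc_conv Ghaus Glc Get sT _ _)).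
  by apply: isotropy_boundD => //; exact: CT.
- move=> X z bX _ hX _; have [oX _ _] := bX; have [oB _ _] := bB.
  have hz : Cc [set: G] z by exact: Cc_sub hX.
  have formE xi : l2dot (lam (conv (conv z k) y) xi) xi =
      l2dot (lam y xi) (lam (fstar k) (lam (fstar z) xi)).
    rewrite lam_conv//; last exact: Cc_conv.
    rewrite lam_conv// -[in LHS](fstarK z) lam_adjoint//; last exact: Cc_fstar.
    by rewrite -[in LHS](fstarK k) lam_adjoint//; exact: Cc_fstar.
  have null V : open V -> V u0 -> V `<=` @units G ->
      (forall v xi, V v -> over v xi -> lam (fstar k) (lam (fstar z) xi) = 0) ->
      isotropy_bound (conv (conv z k) y).
    move=> oV Vu VU h0; exists 0, V, [::]; split=> //; split=> // v xi Vv ov.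
    by rewrite formE (h0 v)// l2dot0r nrm0 !mul0r.
  have [[_ [K [cK KX zK]]] [_ [L [cL LB fL]]]] := (CcE hX, CcE hB).
  (* The complement of the open range of [X] or [B] need not be open. Removing the closed range of a
     compact support leaves a neighbourhood on which the operator still vanishes. *)
  have closed_rng (D : set G) : compact D -> closed (@grng G @` D).
    move=> cD; apply: compact_closed => //; apply: continuous_compact => //.
    by apply: continuous_subspaceT; exact: grng_continuous.
  have [Xu|nX] := pselect ((@grng G @` X) u0); last first.
    apply: (null (@units G `&` ~` (@grng G @` K))).
    - by apply: openI; [exact: open_units | apply: closed_openC; exact: closed_rng].
    - by split => // -[c /KX Xc cu]; apply: nX; exists c.
    - by move=> v [].
    - move=> v xi [_ nv] ov; rewrite (lam_fstar_bisection0 Ghaus Glc Get bX hX _ ov).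
        exact: linear0.
      by move=> b Xb bv; apply: zK => Kb; apply: nv; exists b.
  have [Xs rs] := section_ofP Xu.
  have [Bu|nB] := pselect ((@grng G @` B) (gsrc (section_of X u0))); last first.
    apply: (null (@grng G @` (X `&` @gsrc G @^-1` (~` (@grng G @` L))))).
    - apply: open_rng => //; apply: openI => //; apply: open_preimage.
        exact: gsrc_continuous.
      by apply: closed_openC; exact: closed_rng.
    - exists (section_of X u0) => //; split => // -[c /LB Bc cu]; apply: nB.
      by exists c.
    - by move=> _ [c _ <-]; exact: units_rng.
    - move=> _ xi [a [Xa na] <-] ov.
      rewrite (lam_fstar_bisection Ghaus Glc Get bX hX Xa ov).
      transitivity (((z a)^*)%C *: lam (fstar k) (ltr a xi)); first exact: linearZ.
      rewrite (lam_difference0 Ghaus Glc Get bB hB (v := gsrc a)) ?scaler0//.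
        by move=> b Bb ba; apply: fL => Lb; apply: na; exists b.
      exact: ltr_over.
  have [Mz [Mz0 hMz]] := Cc_bounded hX; have [Mf [Mf0 hMf]] := Cc_bounded hB.
  have [My My0 hMy] := lam_bounded Ghaus Glc Get hy.
  have ls := conjugate_local_section Get bB BI bX.
  have [oV VU _ _] := ls.
  exists (My * (Mz * Mf)), (conjugate_domain B X), [:: conjugate_section B X]; split => //.
  - by rewrite !mulr_ge0.
  - by exists (section_of X u0).
  - split.
      move=> t [<-|//]; split => // v Vv.
      exact: conjugate_section_IntIso.
    move=> v xi Vv ov; rewrite formE /displacement big_seq1.
    have [c cE ->] := lam_difference_conjugate Ghaus Glc Get bB BI hB bX hX Vv ov.
    rewrite (le_trans (l2dot_nrm_le _ _))// nrmZ.
    have hc : nrm (c : C^o) <= Mz * Mf.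
      by rewrite cE nrm_mul !nrm_conj ler_pM ?nrm_ge0.
    have h1 := hMy xi; have h2 := nrm_ltr_le (section_of X v) (ltr (conjugate_section B X v) xi - xi).
    have -> : My * (Mz * Mf) * nrm xi * nrm (ltr (conjugate_section B X v) xi - xi) =
       (My * nrm xi) * (Mz * Mf * nrm (ltr (conjugate_section B X v) xi - xi)) by ring.
    by rewrite ler_pM ?nrm_ge0 ?mulr_ge0 ?nrm_ge0// ler_pM ?nrm_ge0.
Qed.

(** A factor on each side of [k] makes this stable under multiplication from both sides; scalars are
    absorbed in [x]. *)
Inductive ideal_span : (G -> C^o) -> Prop :=
| ideal_span0 : ideal_span 0
| ideal_spanS x y g : Cc [set: G] x -> Cc [set: G] y -> ideal_span g ->
    ideal_span (conv (conv x k) y + g).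

Lemma ideal_span_Cc g : ideal_span g -> Cc [set: G] g.
Proof.
elim=> [|x y {}g hx hy _ ih]; first exact: Cc0.
apply: CcD => //; apply: (Cc_conv Ghaus Glc Get sT) => //; exact: Cc_conv.
Qed.

Lemma ideal_spanD g1 g2 : ideal_span g1 -> ideal_span g2 -> ideal_span (g1 + g2).
Proof.
elim=> [|x y g hx hy _ ih] h2; first by rewrite add0r.
by rewrite -addrA; apply: ideal_spanS => //; exact: ih.
Qed.

Lemma conv_addr a g1 g2 : Cc [set: G] a -> conv a (g1 + g2) = conv a g1 + conv a g2.
Proof.
by move=> ha; apply/funext => c; apply: convDr; exact: (fibreP Ghaus Glc Get _ openT).
Qed.

Lemma conv_addl a g1 g2 : Cc [set: G] g1 -> Cc [set: G] g2 ->
  conv (g1 + g2) a = conv g1 a + conv g2 a.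
Proof.
by move=> h1 h2; apply/funext => c; apply: convDl; exact: (fibreP Ghaus Glc Get _ openT).
Qed.

Lemma ideal_spanZ (t : C) g : ideal_span g -> ideal_span (t *: g).
Proof.
elim=> [|x y {}g hx hy _ ih]; first by rewrite scaler0; exact: ideal_span0.
rewrite scalerDr; have -> : t *: conv (conv x k) y = conv (conv (t *: x) k) y.
  apply/funext => c; rewrite -[LHS]/(t * conv (conv x k) y c) -convZl; congr (conv _ y c).
  by apply/funext => d; rewrite convZl.
by apply: ideal_spanS => //; exact: CcZ.
Qed.

Lemma ideal_spanMl a g : Cc [set: G] a -> ideal_span g -> ideal_span (conv a g).
Proof.
move=> ha; elim=> [|x y {}g hx hy _ ih]; first by rewrite conv0r; exact: ideal_span0.
have hxk : Cc [set: G] (conv x k) by exact: Cc_conv.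
rewrite conv_addr// -(conv_assoc Ghaus Glc Get _ sT ha hxk).
rewrite -(conv_assoc Ghaus Glc Get _ sT ha hx).
by apply: ideal_spanS => //; exact: Cc_conv.
Qed.

Lemma ideal_spanMr a g : Cc [set: G] a -> ideal_span g -> ideal_span (conv g a).
Proof.
move=> ha; elim=> [|x y {}g hx hy hg ih]; first by rewrite conv0l; exact: ideal_span0.
have hxk : Cc [set: G] (conv x k) by exact: Cc_conv.
rewrite conv_addl ?(conv_assoc Ghaus Glc Get _ sT hxk hy)//; last exact: ideal_span_Cc.
  by apply: ideal_spanS => //; exact: Cc_conv.
exact: Cc_conv.
Qed.

Lemma isotropy_bound_ideal g : ideal_span g -> isotropy_bound g.
Proof.
elim=> [|x y {}g hx hy hg ih]; first exact: isotropy_bound0.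
apply: isotropy_boundD => //; last exact: isotropy_bound_generator.
  by apply: (Cc_conv Ghaus Glc Get sT) => //; exact: Cc_conv.
exact: ideal_span_Cc.
Qed.

Lemma ideal_span_closed_ideal (CG : redCstar R [set: G]) :
  closed_ideal (closure [set rquo (r := CG) (femb (rfull CG) g) | g in ideal_span]).
Proof.
set q := rquo (r := CG); set S := [set _ | _ in _].
have clP (b : CG) : closure S b <->
    forall e : R, 0 < e -> exists2 g, ideal_span g & nrm (b - q (femb (rfull CG) g)) < e.
  split=> [cb e e0|hb].
    have eC : 0 < e%:C :> C by rewrite ltcR.
    have [_ [[g hg <-] hb]] := cb _ (nbhsx_ballx b _ eC).
    by exists g => //; move: hb; rewrite -ball_normE /= nrmE ltcR.
  move=> N /nbhs_ballP[e /= e0 hN].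
  have eR : e = (complex.Re e)%:C by rewrite RRe_real// gtr0_real.
  have [|g hg h] := hb (complex.Re e); first by rewrite -ltcR -eR.
  exists (q (femb (rfull CG) g)); split; first by exists g.
  by apply: hN; rewrite -ball_normE /= nrmE eR ltcR.
have happ (a : CG) e : 0 < e -> exists2 f, Cc [set: G] f & nrm (a - q (femb (rfull CG) f)) < e.
  move=> e0; have [a' <-] := rquo_surj a.
  have [f' hf h] := femb_approx a' e0; exists f' => //.
  by rewrite -rquoB; apply: le_lt_trans h; exact: nrm_rquo_le.
split.
- exact: closed_closure.
- apply/clP => e e0; exists 0; first exact: ideal_span0.
  by rewrite (femb0 Ghaus) /q rquo0 subrr nrm0.
- move=> c a b /clP ha /clP hb; apply/clP => e e0.
  have c1 : 0 < 1 + nrm (c : C^o) by rewrite ltr_pwDl ?nrm_ge0.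
  have [g hg h] := ha (e / 2 / (1 + nrm (c : C^o))) (divr_gt0 (divr_gt0 e0 (ltr0n _ 2)) c1).
  have [g' hg' h'] := hb (e / 2) (divr_gt0 e0 (ltr0n _ 2)).
  exists (c *: g + g'); first by apply: ideal_spanD => //; exact: ideal_spanZ.
  have hg1 := ideal_span_Cc hg; have hg2 := ideal_span_Cc hg'.
  rewrite femb_linear// /q rquo_linear opprD addrACA -scalerBr.
  rewrite (le_lt_trans (nrm_triangle _ _))// (splitr e) ltrD// nrmZ.
  move: h; rewrite ltr_pdivlMr//; apply: le_lt_trans.
  by rewrite mulrC ler_wpM2l ?nrm_ge0// lerDr.
(* [ideal_span] is stable under multipliers from [Cc] only, so a general multiplier is approximated
   along with the element of the closure. *)
- have prod (a b : CG) (e : R) : 0 < e -> exists2 d : R, 0 < d &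
      forall a' b' : CG, nrm (a - a') < d -> nrm (b - b') < d -> nrm (cmul a b - cmul a' b') < e.
    move=> e0; pose d := Num.min 1 (e / (2 + nrm a + nrm b)).
    have s0 : 0 < 2 + nrm a + nrm b by rewrite -addrA ltr_pwDl// addr_ge0 ?nrm_ge0.
    have d0 : 0 < d by rewrite lt_min ltr01 divr_gt0.
    have d1 : d <= 1 by rewrite ge_min lexx.
    have de : d * (2 + nrm a + nrm b) <= e by rewrite -ler_pdivlMr// ge_min lexx orbT.
    exists d => // a' b' ha hb.
    have -> : cmul a b - cmul a' b' = cmul (a - a') b' + cmul a (b - b').
      by rewrite cmulBl cmulBr [RHS]addrC subrKA.
    rewrite (le_lt_trans (nrm_triangle _ _))//.
    have nb : nrm b' <= 1 + nrm b.
      rewrite -[b'](subrK b) (le_trans (nrm_triangle _ _))// lerD2r nrmBC.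
      exact: le_trans (ltW hb) d1.
    have h1 : nrm (cmul (a - a') b') <= d * (1 + nrm b).
      by rewrite (le_trans (nrm_cmul _ _))// ler_pM ?nrm_ge0// ltW.
    have h2 : nrm (cmul a (b - b')) <= nrm a * d.
      by rewrite (le_trans (nrm_cmul _ _))// ler_wpM2l ?nrm_ge0// ltW.
    by have := nrm_ge0 a; nra.
  move=> a b /clP hb; split; apply/clP => e e0.
    have [d d0 hd] := prod a b e e0.
    have [f' hf h] := happ a d d0; have [g hg h'] := hb d d0.
    exists (conv f' g); first exact: ideal_spanMl.
    rewrite femb_conv//; last exact: ideal_span_Cc.
    by rewrite /q rquoM; exact: hd.
  have [d d0 hd] := prod b a e e0.
  have [f' hf h] := happ a d d0; have [g hg h'] := hb d d0.
  exists (conv g f'); first exact: ideal_spanMr.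
  rewrite femb_conv//; last exact: ideal_span_Cc.
  by rewrite /q rquoM; exact: hd.
Qed.

End Generator.
End LocalBound.

(** * Almost invariant vectors *)

Section Gap.
Variables (R : realType) (G : topGroupoidType).
Local Notation C := R[i].
Local Notation l2 := (l2 R G).
Hypothesis Ghaus : hausdorff_space G.
Hypothesis Glc : locally_compact [set: G].
Hypothesis Get : etale G.
Implicit Types (f g x y : G -> C^o) (xi eta : l2) (b c h u v w : G) (t : G -> G).

Local Notation lam := (lam Ghaus Glc Get).
Local Notation delta := (delta R).
Local Notation II := (@IntIso G).

Let sT := open_subgroupoidT G.
Let sI := IntIso_subgroupoid Get.

(** Arrows of [IntIso] have equal range and source, so acting by them never leaves the fibre over
    [v]. These vectors are the ones that test positivity in the reduced algebra of [IntIso]. *)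
Lemma over_lam_delta x v : Cc II x -> units v -> over v (lam x (delta v)).
Proof.
move=> hx uv c cv; rewrite lamE; last exact: Cc_sub hx.
rewrite /conv fsbig1// => -[a b] [/= ab abc]; rewrite /=.
have [bv|_] := eqVneq b v; last by rewrite mulr0.
have [xa|/(Cc_nz hx) Ia] := eqVneq (x a) 0; first by rewrite xa mul0r.
by case: cv; rewrite -abc grng_mul// (IntIso_rng_src Ia) ab bv unit_rng.
Qed.

Lemma sqr_sum_le (T : Type) (s : seq T) (F : T -> R) :
  (\sum_(t <- s) F t) ^+ 2 <= (size s)%:R * \sum_(t <- s) F t ^+ 2.
Proof.
elim: s => [|a s ih]; first by rewrite !big_nil expr0n mulr0.
rewrite !big_cons /= -natr1; move: ih; set S := \sum_(j <- s) F j.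
set Q := \sum_(j <- s) _; set n := (size s)%:R => ih.
have n0 : 0 <= n :> R by exact: ler0n.
have Q0 : 0 <= Q by apply: sumr_ge0 => t _; exact: sqr_ge0.
have h : 2 * F a * S <= n * F a ^+ 2 + Q.
  have [n00|np] := eqVneq n 0.
    have S0 : S = 0 by apply/eqP; rewrite -sqrf_eq0 eq_le sqr_ge0 andbT; move: ih; rewrite n00 mul0r.
    by rewrite S0 mulr0 n00 mul0r add0r.
  have np' : 0 < n by rewrite lt_def np.
  rewrite -(ler_pM2l np'); have := sqr_ge0 (n * F a - S); lra.
by move: ih h; lra.
Qed.

(* Uniformly over [V], the isotropy groups have no almost invariant vectors. *)
Definition isotropy_gap V (ts : seq (G -> G)) (e : R) :=
  (forall t, List.In t ts -> local_section V t /\ forall v, V v -> II (t v)) /\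
  forall v x, V v -> Cc II x -> e * nrm (lam x (delta v)) ^+ 2 <=
    \sum_(t <- ts) nrm (ltr (t v) (lam x (delta v)) - lam x (delta v)) ^+ 2.

(** Some [a] in [ideal_span] is within [1/2] of a bump equal to 1 near [u0]. For a vector of norm
    [N] and displacement [D] this gives [N ^ 2 <= N ^ 2 / 2 + M N D], and the half is absorbed on
    the left. *)
Lemma isotropy_gap_exists u0 (CG : redCstar R [set: G]) B f : units u0 ->
  bisection B -> B `<=` II -> Cc B f ->
  closure [set rquo (r := CG) (femb (rfull CG) g) | g in ideal_span B f] = setT ->
  exists V ts e, [/\ 0 < e, open V, V u0, V `<=` @units G & isotropy_gap V ts e].
Proof.
move=> u0u bB BI hB JT.
have [phi [hphi _ phi01 [V1 [oV1 V1u phi1]]]] := Cc_bump R Ghaus Glc (open_units Get) u0u.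
set g1 : G -> C^o := fun _ => _ in hphi.
have hg1 : Cc [set: G] g1 by exact: Cc_sub hphi.
set q := rquo (r := CG) in JT; set A := rfull CG in q JT *.
have [a ha] : exists2 a, ideal_span B f a & nrm (q (femb A (g1 - a))) < 2^-1.
  have eC : 0 < (2^-1)%:C :> C by rewrite ltcR invr_gt0.
  have hc : closure [set q (femb A g) | g in ideal_span B f] (q (femb A g1)) by rewrite JT.
  have [_ [[a ha <-] hb]] := hc _ (nbhsx_ballx _ _ eC).
  exists a => //; have haT := ideal_span_Cc Ghaus Glc Get bB hB ha.
  rewrite (fembB Ghaus)// /q rquoB.
  by move: hb; rewrite -ball_normE /= nrmE ltcR.
have haT := ideal_span_Cc Ghaus Glc Get bB hB ha.
have [M [V [ts [M0 oV Vu VU [hts hV]]]]] := isotropy_bound_ideal Ghaus Glc Get u0u bB BI hB ha.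
(* From [N <= 2 M D] and Cauchy-Schwarz on the sum [D], [N ^ 2] is at most [4 M ^ 2 (size ts)] times
   the sum of squares; adding 1 makes the constant positive in all cases. *)
move=> hlt; exists (V `&` V1), ts, (1 + 4 * M ^+ 2 * (size ts)%:R)^-1.
have K0 : 0 <= 4 * M ^+ 2 * (size ts)%:R by rewrite !mulr_ge0 ?sqr_ge0.
have K1 : 0 < 1 + 4 * M ^+ 2 * (size ts)%:R by rewrite ltr_pwDl.
split; [by rewrite invr_gt0 | exact: openI | by [] | by move=> v [/VU] |].
split.
  move=> t /hts[ls hI]; split; last by move=> v [/hI].
  by apply: local_section_sub ls _ _; [exact: openI | exact: subIsetl].
move=> v x [Vv V1v] hx; have uv := VU v Vv.
have ov := over_lam_delta hx uv.
have := reduced_sandwich_le Ghaus Glc Get sT (B := CG) (CcB Ghaus hg1 haT) (Cc_sub (subsetT _) hx)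
  (Cc_sub (subsetT _) hx) uv hlt.
set xi := lam x (delta v) in ov *.
rewrite lamD//; last exact: CcN.
rewrite lamN// (lam_units _ _ _ hphi ov) /g1 phi1// scale1r => h1.
have h2 := hV v xi Vv ov.
set D := displacement _ _ _ in h2; have D0 : 0 <= D := displacement_ge0 _ _ _.
set N := nrm xi in h1 h2 *; have N0 : 0 <= N by exact: nrm_ge0.
have h3 : N ^+ 2 <= 2^-1 * (N * N) + M * N * D.
  have -> : N ^+ 2 = nrm (l2dot xi xi : C^o).
    by rewrite l2dot_nrm nrm_real ger0_norm// sqr_ge0.
  rewrite -{1}(subrK (lam a xi) xi) l2dotDl (le_trans (nrm_triangle (V := C^o) _ _))//.
  exact: lerD.
have h4 : N <= 2 * M * D.
  have [N00|Np] := eqVneq N 0; first by rewrite N00 !mulr_ge0.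
  have Np' : 0 < N by rewrite lt_def Np.
  by rewrite -(ler_pM2r Np'); move: h3; lra.
have h5 : N ^+ 2 <= 4 * M ^+ 2 * D ^+ 2.
  have -> : 4 * M ^+ 2 * D ^+ 2 = (2 * M * D) ^+ 2 by ring.
  by rewrite lerXn2r ?nnegrE// !mulr_ge0.
have h6 : D ^+ 2 <= _ := sqr_sum_le ts (fun t => nrm (ltr (t v) xi - xi)).
rewrite mulrC ler_pdivrMr//; apply: (le_trans h5).
set Q := \sum_(_ <- _) _ in h6 *; have Q0 : 0 <= Q by apply: sumr_ge0 => t _; exact: sqr_ge0.
rewrite mulrDr mulr1 ler_wpDl// mulrC; apply: le_trans (ler_wpM2r _ h6) _.
  by rewrite !mulr_ge0 ?sqr_ge0.
by rewrite le_eqVlt; apply/orP; left; apply/eqP; ring.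
Qed.

Lemma local_section_bisection V t : local_section V t -> (forall v, V v -> II (t v)) ->
  bisection (t @` V).
Proof.
move=> ls tI; have [oV VU tr _] := ls.
have inj : set_inj (t @` V) (@grng G).
  by move=> a b; rewrite !inE => -[v Vv <-] [w Vw <-]; rewrite !tr// => ->.
split => //; first exact: local_section_open.
have srcI a : a \in t @` V -> gsrc a = grng a.
  by rewrite inE => -[v Vv <-]; rewrite (IntIso_rng_src (tI v Vv)).
by move=> a b aV bV; rewrite (srcI a aV) (srcI b bV); exact: inj.
Qed.

Lemma lam_push V t g v xi : local_section V t -> (forall w, V w -> II (t w)) ->
  Cc V g -> V v -> over v xi ->
  lam (fstar (push t g)) xi = ((g v)^*)%C *: ltr (t v) xi.
Proof.
move=> ls tI hg Vv ov; have [_ _ tr _] := ls.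
have hp := push_Cc Ghaus Get ls hg.
rewrite (@lam_fstar_bisection _ _ Ghaus Glc Get (t @` V) _ (t v))//.
- by rewrite /push tr// asboolT.
- exact: (local_section_bisection ls tI).
- by rewrite tr.
Qed.

Lemma augmentation_push V t g u : local_section V t -> (forall w, V w -> II (t w)) -> V u ->
  augmentation u (push t g) = g u.
Proof.
move=> ls tI Vu; have [_ _ tr _] := ls; have It := tI u Vu.
have st : gsrc (t u) = u by rewrite -(IntIso_rng_src It) tr.
rewrite (@augmentation1 R G (push t g) u (t u)) //; first by rewrite /push tr// asboolT.
move=> h [Ih hu]; rewrite /push; case: asboolP => [-> _|]; last by rewrite eqxx.
by rewrite (IntIso_rng_src Ih) hu.
Qed.

Lemma l2dot_conv_fstar g xi : Cc [set: G] g ->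
  l2dot (lam (conv g (fstar g)) xi) xi = (nrm (lam (fstar g) xi) ^+ 2)%:C.
Proof.
move=> hg; have hs := Cc_fstar Ghaus sT hg.
by rewrite lam_conv// -{1}(fstarK g) lam_adjoint// l2dot_nrm.
Qed.

End Gap.

(** * A positive element with negative augmentation *)

Section Contradiction.
Variables (R : realType) (G : topGroupoidType).
Local Notation C := R[i].
Local Notation l2 := (l2 R G).
Hypothesis Ghaus : hausdorff_space G.
Hypothesis Glc : locally_compact [set: G].
Hypothesis Get : etale G.
Implicit Types (f g x y : G -> C^o) (xi eta : l2) (b c h u v w : G) (t : G -> G).

Local Notation lam := (lam Ghaus Glc Get).
Local Notation delta := (delta R).
Local Notation II := (@IntIso G).

Let sT := open_subgroupoidT G.
Let sI := IntIso_subgroupoid Get.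
Let IT f : Cc II f -> Cc [set: G] f. Proof. exact: Cc_sub. Qed.

(** [S] is the sum of the products of [F t] with its adjoint; the augmentation is multiplicative and
    vanishes on each [F t], hence on [S]. *)
Lemma sum_of_squares (A : fullCstar R II) u (F : (G -> G) -> G -> C^o) ts :
  (forall t, List.In t ts -> Cc II (F t) /\ augmentation u (F t) = 0) ->
  exists S, [/\ Cc II S, augmentation u S = 0, cstar (femb A S) = femb A S &
    forall xi, l2dot (lam S xi) xi = (\sum_(t <- ts) nrm (lam (fstar (F t)) xi) ^+ 2)%:C].
Proof.
elim: ts => [|t ts ih] hF.
  exists 0; rewrite augmentation0 (femb0 Ghaus); split=> //; first exact: Cc0.
    by apply: nrm_eq0; rewrite nrm_cstar nrm0.
  by move=> xi; rewrite lam0 big_nil -(scale0r (0 : l2)) l2dotZl mul0r.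
have [ht at0] := hF t (or_introl erefl).
have [|S [hS aS sS lS]] := ih; first by move=> t' h; apply: hF; right.
have hs := Cc_fstar Ghaus sI ht; have hc := Cc_conv Ghaus Glc Get sI ht hs.
exists (conv (F t) (fstar (F t)) + S); split.
- exact: CcD.
- by rewrite augmentationD// aS addr0 augmentation_conv// at0 mul0r.
- by rewrite fembD// cstarD sS femb_conv// femb_star// cstarM cstarK.
- move=> xi; rewrite lamD//; [|exact: IT..].
  by rewrite l2dotDl lS l2dot_conv_fstar ?big_cons ?rmorphD//; exact: IT.
Qed.

(** With [y] the image of [Y] and [s = |y|], positivity gives [s (s - y) = 0]. Since [s = p ^ 2]
    with [p] self-adjoint, [chi s] is nonnegative; its square is [e ^ 2], so it is [e], and the
    relation becomes [e (e + e) = 0]. *)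
Lemma no_isotropy_gap (B : redCstar R II) u V ts (e : R) : units u ->
  augmentation_continuous B u -> 0 < e -> open V -> V u -> V `<=` @units G ->
  isotropy_gap Ghaus Glc Get V ts e -> False.
Proof.
move=> uu ac e0 oV Vu VU [hts gap].
have [phi [hphi _ phi01 [V1 [oV1 V1u phi1]]]] := Cc_bump R Ghaus Glc oV Vu.
set g : G -> C^o := fun _ => _ in hphi.
have gu : g u = 1 by rewrite /g phi1.
have hgU : Cc (@units G) g by exact: Cc_sub hphi.
have [_ UI _ _] := sI.
have hgI : Cc II g by exact: Cc_sub hgU.
have ag : augmentation u g = 1.
  rewrite (@augmentation1 R G g u u)//; first by split; [exact: UI | exact: unit_src].
  by move=> h [Ih <-] /(Cc_nz hgU)/unit_src.
pose A := rfull B; pose q := rquo (r := B).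
pose F t : G -> C^o := push t g - g.
have hF t : List.In t ts -> Cc II (F t) /\ augmentation u (F t) = 0.
  move=> /hts[ls tI].
  have hp : Cc II (push t g).
    by apply: Cc_sub (push_Cc Ghaus Get ls hphi) => _ [v Vv <-]; exact: tI.
  split; first exact: CcB.
  rewrite augmentationD//; last exact: CcN.
  by rewrite augmentationN (augmentation_push _ ls)// gu ag subrr.
have [S [hS aS sS lS]] := sum_of_squares A hF.
have hgs := Cc_fstar Ghaus sI hgI; have hgg := Cc_conv Ghaus Glc Get sI hgI hgs.
pose Y := S - e%:C *: conv g (fstar g).
have hY : Cc II Y by apply: CcB => //; exact: CcZ.
have aY : augmentation u Y = (- e)%:C.
  rewrite augmentationD ?aS//; last by apply: CcN => //; exact: CcZ.
  rewrite augmentationN augmentationZ augmentation_conv// augmentation_fstar// ag.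
  by rewrite conjc1 !mulr1 add0r rmorphN.
have sY : cstar (q (femb A Y)) = q (femb A Y).
  rewrite -rquo_star /Y (fembB Ghaus)//; last exact: CcZ.
  by rewrite (fembZ Ghaus)// cstarB sS cstarZreal femb_conv// femb_star// cstarM cstarK.
have pos x v : Cc II x -> units v ->
    0 <= (cond_exp (cmul (cmul (cstar (femb A x)) (femb A Y)) (femb A x)) v : C).
  move=> hx uv; rewrite (eval_sandwich Ghaus Glc Get)//.
  have ov := over_lam_delta Ghaus Glc Get hx uv; set xi := lam x _ in ov *.
  rewrite /Y lamD; [|exact: IT|by apply: CcN => //; apply: CcZ => //; exact: IT].
  rewrite lamN ?lamZ; [|exact: IT|by apply: CcZ => //; exact: IT].
  rewrite l2dotDl lS -scaleN1r scalerA l2dotZl l2dot_conv_fstar; last exact: IT.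
  rewrite mulN1r -rmorphN -rmorphM -rmorphD ler0c mulNr subr_ge0.
  have lg : lam (fstar g) xi = ((g v)^*)%C *: xi.
    rewrite (lam_units _ _ _ _ ov); first by rewrite fstar_units.
    rewrite fstar_units//; have [cf [K [cK KU fK]]] := CcE hgU.
    by apply: (CcI Ghaus _ cK KU) => [|c /fK ->]; [exact: conjc_continuous | exact: conjc0].
  (* Off [V] the bump [g] vanishes and only squares remain; on [V] every term carries the factor
     [|g v| ^ 2] and the gap applies. *)
  have [Vv|nV] := pselect (V v); last first.
    rewrite lg (Cc_off hphi nV) conjc0 scale0r nrm0 expr0n mulr0.
    by apply: sumr_ge0 => t _; exact: sqr_ge0.
  rewrite lg nrmZ exprMn nrm_conj mulrCA.
  apply: le_trans (ler_wpM2l (sqr_ge0 _) (gap v x Vv hx)) _.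
  rewrite -/xi mulr_sumr le_eqVlt; apply/orP; left; apply/eqP.
  elim: (ts) hts {hF lS gap} => [|t us ih] hts; first by rewrite !big_nil.
  rewrite !big_cons ih; last by move=> t' h; apply: hts; right.
  have [ls tI] := hts t (or_introl erefl); congr (_ + _).
  have hp : Cc [set: G] (push t g) by apply: Cc_sub (push_Cc Ghaus Get ls hphi).
  have lF : lam (fstar (F t)) xi = ((g v)^*)%C *: (ltr (t v) xi - xi).
    rewrite /F fstarD fstarN lamD; [|exact: Cc_fstar|apply: CcN => //; exact: IT].
    by rewrite lamN ?lg ?(lam_push Ghaus Glc Get ls tI hphi Vv ov) ?scalerBr//; exact: IT.
  by rewrite lF nrmZ exprMn nrm_conj.
have [chi [chif chiM chiB chis]] := augmentation_character Ghaus Glc Get ac.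
have [p [s [ps _ pp ss XYX]]] := cstar_abs sY.
have z0 := reduced_negative_part_eq0 Ghaus Glc Get sI pos XYX.
have chi0 : chi 0 = 0 by rewrite -(subrr 0) chiB subrr.
have cY : chi (q (femb A Y)) = (- e)%:C by rewrite chif.
have [r pr] : exists r : R, chi p = r%:C.
  exists (complex.Re (chi p)); have := chis p; rewrite ps.
  case: (chi p) => a b /= [] h.
  by congr (_ +i* _)%C; move: h; lra.
have cs : chi s = (r * r)%:C by rewrite -pp chiM pr rmorphM.
have r2 : (r * r) * (r * r) = e * e.
  have := chiM s s; rewrite ss chiM cY cs.
  rewrite -[X in X = _](rmorphM (real_complex R)) -[X in _ = X](rmorphM (real_complex R)).
  by move=> /complexI; rewrite mulrNN.
have re : r * r = e.
  apply/eqP; rewrite -(@eqrXn2 _ 2) ?(ltW e0)// -?expr2 ?sqr_ge0//.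
  by rewrite expr2 r2 -expr2.
move: (congr1 chi z0); rewrite chi0 chiM chiB cs cY re -rmorphB -rmorphM => /complexI /eqP.
by rewrite opprK mulf_eq0 -mulr2n mulrn_eq0 /= orbb gt_eqF.
Qed.

(** At the unit [grng b] the function [k] is -1: [f] vanishes there and [base_fun] equals [f b]. A
    bump [w] equal to 1 at this unit puts [w k w] in the ideal with the same value, which the
    conditional expectation detects. *)
Lemma ideal_span_nontrivial (CG : redCstar R [set: G]) B f b : bisection B -> B `<=` II ->
  Cc B f -> B b -> f b = 1 -> ~ B (grng b) ->
  closure [set rquo (r := CG) (femb (rfull CG) g) | g in ideal_span B f] <> [set 0].
Proof.
move=> bB BI hB Bb fb nBb J0; set u := grng b in nBb; have uu : units u := units_rng b.
set q := rquo (r := CG) in J0; set A := rfull CG in q J0.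
have [phi [hphi _ _ [V1 [_ V1u phi1]]]] := Cc_bump R Ghaus Glc (open_units Get) uu.
set w : G -> C^o := fun _ => _ in hphi.
have hw : Cc [set: G] w by exact: Cc_sub hphi.
have wu : w u = 1 by rewrite /w phi1.
set k := f - base_fun B f.
have hk : Cc [set: G] k := difference_Cc Ghaus Get bB hB.
have ku : k u = -1.
  rewrite /k; transitivity (f u - base_fun B f u) => //.
  rewrite (Cc_off hB nBb) /base_fun pullE; last by exists b.
  by rewrite section_of_rng// fb sub0r.
have hwk := Cc_conv Ghaus Glc Get sT hw hk.
have hg := Cc_conv Ghaus Glc Get sT hwk hw.
have q0 : q (femb A (conv (conv w k) w)) = 0.
  suff : closure [set q (femb A g) | g in ideal_span B f] (q (femb A (conv (conv w k) w))).
    by rewrite J0.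
  apply: subset_closure; exists (conv (conv w k) w) => //.
  by rewrite -[conv _ _]addr0; apply: ideal_spanS => //; exact: ideal_span0.
have ov : over u (delta u).
  move=> c cu; rewrite deltaE; have [cE|//] := eqVneq c u.
  by case: cu; rewrite cE unit_rng.
have lw : lam w (delta u) = delta u by rewrite (lam_units _ _ _ hphi ov) wu scale1r.
have /rquo_eq0 /K_E_cond_exp := q0.
move=> /(_ u (cstar (femb A w)) (femb A w)).
rewrite (eval_sandwich Ghaus Glc Get)// lw l2dot_delta !lam_conv// lw lamE//.
rewrite conv_units// unit_rng// wu mul1r lam_delta// ku => /eqP.
by rewrite oppr_eq0 oner_eq0.
Qed.

End Contradiction.

Theorem proposition7p8 (R : realType) (G : topGroupoidType)
    (G_second_countable : @second_countable G)
    (G_locally_compact : locally_compact [set: G])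
    (G_hausdorff : hausdorff_space G)
    (G_etale : etale G)
    (CredG : redCstar R [set: G]) (CredI : redCstar R (@IntIso G))
    (CredG_simple : cstar_simple CredG)
    (aug_cont : exists u0 : G,
       units u0 /\ augmentation_continuous CredI u0) :
  forall u : G, units u -> IntIso_at u = [set u].
Proof.
move=> u uu; have [u0 [u0u ac]] := aug_cont.
have [_ UI _ _] := IntIso_subgroupoid G_etale.
apply/seteqP; split=> [h [Ih hu]|_ -> /=]; last by split; [exact: UI | exact: unit_src].
apply: contrapT => hnu.
have nh : ~ units h by move=> /unit_src hh; apply: hnu; rewrite /= -hu hh.
(* The units are closed, as the set where [gsrc] agrees with the identity in a Hausdorff space; so
   [h] lies on a bisection free of units. *)
have oD : open (@IntIso G `&` ~` @units G).
  apply: openI; first exact: open_interior.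
  apply: closed_openC; apply: (closed_eq_continuous G_hausdorff).
    exact: gsrc_continuous.
  by move=> x; exact: cvg_id.
have [B [bB Bh BD]] := bisection_nbhs G_etale oD (conj Ih nh).
have [oB _ _] := bB.
have BI : B `<=` @IntIso G by move=> b /BD[].
have [phi [hphi _ _ [V1 [_ V1h phi1]]]] := Cc_bump R G_hausdorff G_locally_compact oB Bh.
set f : G -> R[i]^o := fun _ => _ in hphi.
have [|] := CredG_simple _ (ideal_span_closed_ideal G_hausdorff G_locally_compact G_etale
  bB hphi CredG).
- apply: (ideal_span_nontrivial G_hausdorff G_locally_compact G_etale bB BI hphi Bh).
    by rewrite /f phi1.
  by move=> /BD[_]; apply; exact: units_rng.
- move=> JT; have [V [ts [e [e0 oV Vu VU gap]]]] := isotropy_gap_exists G_hausdorff G_locally_compact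
    G_etale u0u bB BI hphi JT.
  exact: (no_isotropy_gap u0u ac e0 oV Vu VU gap).
Qed.
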